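(* Let $f:\mathbb{C}\to\mathbb{C}$ be a transcendental entire function, let $R>0$ be such that $M(r,f)>r$ for all $r\ge R$, and let $A_R(f)$ be a spider's web. (a) All the connected components of $A(f)^c=\mathbb{C}\setminus A(f)$ are compact. (b) Every point of $J(f)$ is the limit of a sequence of points, each of which lies in a distinct connected component of $A(f)^c$.
   Context: $\mathbb{N}=\{1,2,\dots\}$; $f^n$ denotes the $n$th iterate of $f$. The Fatou set $F(f)$ is the set of $z\in\mathbb{C}$ having a neighbourhood in which $(f^n)_{n\in\mathbb{N}}$ is a normal family; the Julia set is $J(f)=\mathbb{C}\setminus F(f)$. $M(r,f)=\max_{|z|=r}|f(z)|$ for $r>0$, and $M^n(r,f)$ denotes the $n$th iterate of $r\mapsto M(r,f)$. $A_R(f)=\{z: |f^n(z)|\ge M^n(R,f)\text{ for all } n\in\mathbb{N}\}$. The fast escaping set is $A(f)=\{z:\text{there exists } L\in\mathbb{N}\text{ such that } |f^{n+L}(z)|\ge M^n(R,f)\text{ for all } n\in\mathbb{N}\}$; it does not depend on the choice of $R$ with $M(r,f)>r$ for $r\ge R$. A set $E\subset\mathbb{C}$ is a spider's web if $E$ is connected and there exists a sequence of bounded simply connected domains $G_n$, $n\in\mathbb{N}$, with $G_n\subset G_{n+1}$ and $\partial G_n\subset E$ for all $n\in\mathbb{N}$, and $\bigcup_{n\in\mathbb{N}}G_n=\mathbb{C}$. *)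

(* Defs.v *)
From HB Require Import structures.
From mathcomp Require Import all_boot all_order all_algebra.
From mathcomp Require Import complex.
From mathcomp Require Import all_classical all_reals all_analysis.

Set Implicit Arguments.
Unset Strict Implicit.
Unset Printing Implicit Defensive.

Import Order.TTheory GRing.Theory Num.Theory.
Import numFieldNormedType.Exports.

Local Open Scope classical_set_scope.
Local Open Scope ring_scope.

(* [R[i]] carries no canonical topology, but every [numClosedFieldType] is a
   normed module over itself; naming the structure gives C that topology. *)
Definition Cplx (R : realType) : numClosedFieldType := complex R.

(* The generic norm [`|z|] takes its values in C; this is the real modulus. *)
Definition modulus (R : realType) (z : Cplx R) : R :=
  ComplexField.Normc.normc z.

Section Topology.
Variable R : realType.
Local Notation C := (Cplx R).

Definition boundary (A : set C) : set C := closure A `\` interior A.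

Definition domain (G : set C) : Prop := [/\ G !=set0, open G & connected G].

Definition components (A : set C) : set (set C) :=
  [set connected_component A z | z in A].

Definition null_homotopic_in (G : set C) (gamma : R -> C) : Prop :=
  exists H : R * R -> C,
    [/\ {within `[0, 1]%classic `*` `[0, 1]%classic, continuous H},
        forall s t, s \in `[0, 1] -> t \in `[0, 1] -> G (H (s, t)),
        forall t, t \in `[0, 1] -> H (0, t) = gamma t,
        forall t, t \in `[0, 1] -> H (1, t) = gamma 0
      & forall s, s \in `[0, 1] -> H (s, 0) = gamma 0 /\ H (s, 1) = gamma 0].

Definition simply_connected_domain (G : set C) : Prop :=
  domain G /\
  forall gamma : R -> C,
    {within `[0, 1], continuous gamma} ->
    (forall t, t \in `[0, 1] -> G (gamma t)) ->
    gamma 0 = gamma 1 ->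
    null_homotopic_in G gamma.

Definition spiders_web (E : set C) : Prop :=
  connected E /\
  exists G : nat -> set C,
    [/\ forall n, bounded_set (G n) /\ simply_connected_domain (G n),
        forall n, G n `<=` G n.+1,
        forall n, boundary (G n) `<=` E
      & \bigcup_n G n = setT].

(* Normality of a family of (analytic) functions on a domain [U], in Montel's
   form: the locally uniform limit is either finite-valued or identically
   infinite. *)
Definition normal_on (U : set C) (F : set (C -> C)) : Prop :=
  forall u : nat -> C -> C, (forall k, F (u k)) ->
  exists phi : nat -> nat, {homo phi : m n / (m < n)%N} /\
    ((exists g : C -> C, forall K : set C, compact K -> K `<=` U ->
        {uniform K, (fun k => u (phi k)) @ \oo --> g}) \/
     (forall K : set C, compact K -> K `<=` U ->
        forall B : R, \forall k \near \oo,
          forall z, K z -> B < modulus (u (phi k) z))).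

End Topology.

Section Dynamics.
Variables (R : realType) (f : Cplx R -> Cplx R).
Local Notation C := (Cplx R).

Definition entire : Prop := forall z : C, derivable f z 1.

Definition transcendental_entire : Prop :=
  entire /\ ~ exists p : {poly C}, forall z, f z = p.[z].

Definition iterates : set (C -> C) :=
  [set g | exists2 n : nat, (0 < n)%N & g = iter n f].

Definition fatou_set : set C :=
  [set z | exists U : set C, [/\ domain U, U z & normal_on U iterates]].

Definition julia_set : set C := ~` fatou_set.

Definition max_modulus (r : R) : R :=
  sup [set modulus (f z) | z in [set z : C | modulus z = r]].

Definition fast_escaping_level (rho : R) : set C :=
  [set z | forall n : nat, (0 < n)%N ->
     iter n max_modulus rho <= modulus (iter n f z)].

(* The radius [rho] is meant to satisfy [r < max_modulus r] for all
   [r >= rho]; the set is then independent of its choice. *)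
Definition fast_escaping_set (rho : R) : set C :=
  [set z | exists2 L : nat, (0 < L)%N &
     forall n : nat, (0 < n)%N ->
       iter n max_modulus rho <= modulus (iter (n + L) f z)].

End Dynamics.

(* Main.v *)
(** Write [M^n] for the iterates of the maximum modulus and [E] for the complement of
    the fast escaping set.  Let [G] be one of the domains of the web that contains the
    disc of radius [rho], and suppose that [G] lies in the disc of radius [M^p(rho)].
    By the open mapping theorem the boundary of [f^n(G)] lies in [f^n] of the boundary
    of [G], hence in the fast escaping set, while [f^n(G)] contains the disc of radius
    [M^n(rho)] and lies in the disc of radius [M^(n+p)(rho)].

    A component [K] of [E] misses these boundaries, so it is bounded.  If [f^(n+L)]
    takes [K] into the disc of radius [M^n(rho)] at one point, then it takes all of the
    closure of [K] into the disc of radius [M^(n+p)(rho)]; this happens for every [L],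
    so the closure of [K] is in [E], and [K] is closed.

    The set [E] is nonempty, because [f^p(G)] contains [G], and unbounded, because
    otherwise [f^(p+1) - e], with [e] in [E], would have finitely many zeros, and
    dividing them out would contradict the growth of a transcendental function.  As its
    components are bounded, [E] has infinitely many of them.  Near a point of the Julia
    set some sequence of iterates has no normal subsequence, so by Montel's theorem its
    members eventually take one of any two values; applied to pairs of points in
    distinct components of [E] this yields points of [E] in arbitrarily many distinct
    components near the given point.

    Montel's theorem is deduced from Bloch's theorem through Schottky's estimate: if
    [h] omits 0 and 1 on a disc, then [2h - 1 = cos (pi cos (pi G))] for some [G] that
    omits a net of points. *)

(* The closedness argument works because the gap [p] between the inner and the outer radius of
   [f^n(G)] does not depend on [n], while a point of [E] violates the escape condition for every
   [L]: passing from [L] to [L + p + 1] absorbs the gap. Near a Julia point, a non-normal sequence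
   may miss one of two values, so points are taken in pairs; and a single iterate has to serve all
   of finitely many pairs, because components are compared through their images under one and the
   same map.

   The function theory uses no integrals over circles, power series or winding numbers. Integrals
   run over sides of rectangles, and Cauchy's formula serves only to show that a derivative is again
   differentiable. Apart from the existence of primitives, the rest is drawn from the second-order
   Taylor expansion: it makes difference quotients holomorphic, so that zeros can be divided out,
   and it yields the maximum principle, from which Cauchy's estimate, the existence of zeros and the
   open mapping theorem follow. *)
Require Import Defs.
From HB Require Import structures.
From mathcomp Require Import all_boot all_order all_algebra.
From mathcomp Require Import complex ring lra.
From mathcomp Require Import all_classical all_reals all_analysis.

Set Implicit Arguments.
Unset Strict Implicit.
Unset Printing Implicit Defensive.

Import Order.TTheory GRing.Theory Num.Theory.
Import numFieldNormedType.Exports.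

Local Open Scope classical_set_scope.
Local Open Scope ring_scope.

(** * The complex plane as a normed field over the reals *)

Section Modulus.
Variable R : realType.
Local Notation C := (Cplx R).
Local Notation md := (@modulus R).
Implicit Types (z w : C) (e d r : R).

Definition toC (x : R) : C := real_complex R x.

Local Arguments toC : simpl never.

Lemma toC0 : toC 0 = 0. Proof. by []. Qed.

Lemma toC1 : toC 1 = 1. Proof. by []. Qed.

Lemma toCD x y : toC (x + y) = toC x + toC y.
Proof. by rewrite /toC rmorphD. Qed.

Lemma toCB x y : toC (x - y) = toC x - toC y.
Proof. by rewrite /toC rmorphB. Qed.

Lemma toCM x y : toC (x * y) = toC x * toC y.
Proof. by rewrite /toC rmorphM. Qed.

Lemma toCN x : toC (- x) = - toC x.
Proof. by rewrite /toC rmorphN. Qed.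

Lemma toCV x : toC x^-1 = (toC x)^-1.
Proof. by rewrite /toC fmorphV. Qed.

Lemma normC_modulus z : `|z| = toC (md z).
Proof. by rewrite normc_def /toC /modulus; case: z. Qed.

Lemma modulus_ge0 z : 0 <= md z.
Proof. by case: z => a b; exact: sqrtr_ge0. Qed.

Lemma modulus0 : md 0 = 0. Proof. exact: ComplexField.Normc.normc0. Qed.

Lemma modulus1 : md 1 = 1. Proof. exact: ComplexField.Normc.normc1. Qed.

Lemma modulusM z w : md (z * w) = md z * md w.
Proof. exact: ComplexField.Normc.normcM. Qed.

Lemma modulusV z : md z^-1 = (md z)^-1.
Proof. exact: ComplexField.Normc.normcV. Qed.

Lemma modulusN z : md (- z) = md z.
Proof. exact: normcN. Qed.

Lemma modulusD z w : md (z + w) <= md z + md w.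
Proof. exact: le_normcD. Qed.

Lemma modulusX z n : md (z ^+ n) = md z ^+ n.
Proof.
elim: n => [|n IH]; first by rewrite !expr0 modulus1.
by rewrite !exprS modulusM IH.
Qed.

Lemma modulus_eq0 z : (md z == 0) = (z == 0).
Proof.
apply/eqP/eqP => [/ComplexField.Normc.eq0_normc//|->]; exact: modulus0.
Qed.

Lemma modulus_gt0 z : (0 < md z) = (z != 0).
Proof. by rewrite lt_def modulus_ge0 andbT modulus_eq0. Qed.

Lemma modulusBC z w : md (z - w) = md (w - z).
Proof. by rewrite -opprB modulusN. Qed.

Lemma modulusB_triangle u z w : md (z - w) <= md (z - u) + md (u - w).
Proof. by rewrite (_ : z - w = (z - u) + (u - w)) ?modulusD//; ring. Qed.

Lemma modulus_leB z w : md z - md w <= md (z - w).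
Proof. by rewrite lerBlDr -{1}(subrK w z) modulusD. Qed.

Lemma modulus_distl z w : `|md z - md w| <= md (z - w).
Proof. by rewrite ler_norml modulus_leB andbT lerNl opprB modulusBC modulus_leB. Qed.

Lemma modulus_toC x : md (toC x) = `|x|.
Proof. by rewrite /modulus /toC /= expr0n /= addr0 sqrtr_sqr. Qed.

Lemma modulus_sqr z : md z ^+ 2 = complex.Re z ^+ 2 + complex.Im z ^+ 2.
Proof.
case: z => a b; rewrite /modulus /= sqr_sqrtr //.
by rewrite addr_ge0 ?sqr_ge0.
Qed.

Lemma modulus_Re z : `|complex.Re z| <= md z.
Proof.
rewrite -(@ler_pXn2r _ 2) ?nnegrE ?modulus_ge0//.
by rewrite modulus_sqr real_normK ?num_real// lerDl sqr_ge0.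
Qed.

Lemma modulus_Im z : `|complex.Im z| <= md z.
Proof.
rewrite -(@ler_pXn2r _ 2) ?nnegrE ?modulus_ge0//.
by rewrite modulus_sqr real_normK ?num_real// lerDr sqr_ge0.
Qed.

Lemma modulusi : md 'i%C = 1.
Proof. by rewrite /modulus /= expr0n /= add0r expr1n sqrtr1. Qed.

Lemma complexE_toC z : z = toC (complex.Re z) + 'i%C * toC (complex.Im z).
Proof. by rewrite {1}(complexE z). Qed.

Lemma modulus_ReIm z : md z <= `|complex.Re z| + `|complex.Im z|.
Proof.
rewrite {1}(complexE_toC z) (le_trans (modulusD _ _))//.
by rewrite modulusM modulusi mul1r !modulus_toC.
Qed.

Lemma ReD z w : complex.Re (z + w) = complex.Re z + complex.Re w.
Proof. by case: z w => [a b] [c d]. Qed.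

Lemma ImD z w : complex.Im (z + w) = complex.Im z + complex.Im w.
Proof. by case: z w => [a b] [c d]. Qed.

Lemma ReN z : complex.Re (- z) = - complex.Re z.
Proof. by case: z => [a b]. Qed.

Lemma ImN z : complex.Im (- z) = - complex.Im z.
Proof. by case: z => [a b]. Qed.

Lemma ReM z w : complex.Re (z * w) =
  complex.Re z * complex.Re w - complex.Im z * complex.Im w.
Proof. by case: z w => [a b] [c d]. Qed.

Lemma ImM z w : complex.Im (z * w) =
  complex.Re z * complex.Im w + complex.Im z * complex.Re w.
Proof. by case: z w => [a b] [c d]. Qed.

Lemma complex_eq z w :
  complex.Re z = complex.Re w -> complex.Im z = complex.Im w -> z = w.
Proof. by case: z w => [a b] [c d] /= -> ->. Qed.

(** The radii in [nbhs_ballP] are positive elements of C, hence real, so real radii suffice and the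
    later epsilon arguments take place in R. *)
Lemma nbhs_modulusP z (A : set C) :
  nbhs z A <-> exists2 e : R, 0 < e & forall w, md (w - z) < e -> A w.
Proof.
split.
  move/nbhs_ballP => [e /= e0 eA].
  have [er eE] : exists r, e = toC r.
    by apply/complex_realP; rewrite gtr0_real.
  have er0 : 0 < er by move: e0; rewrite eE -ltcR.
  exists er => // w wz; apply: eA; rewrite -ball_normE /= distrC normC_modulus eE.
  by rewrite /toC ltcR.
move=> [e e0 eA]; apply/nbhs_ballP; exists (toC e) => /=.
  by rewrite /toC ltcR.
move=> w; rewrite -ball_normE /= distrC normC_modulus /toC ltcR; exact: eA.
Qed.

Definition disc z r : set C := [set w | md (w - z) < r].
Definition cdisc z r : set C := [set w | md (w - z) <= r].

Lemma open_disc z r : open (disc z r).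
Proof.
rewrite openE => w wz; apply/nbhs_modulusP; exists (r - md (w - z)).
  by rewrite subr_gt0.
move=> u uw; rewrite /disc /= (le_lt_trans (modulusB_triangle w _ _))//.
by rewrite -ltrBrDr.
Qed.

Lemma nbhs_disc z r : 0 < r -> nbhs z (disc z r).
Proof. by move=> r0; apply/nbhs_modulusP; exists r. Qed.

Lemma disc_center z r : 0 < r -> disc z r z.
Proof. by move=> r0; rewrite /disc /= subrr modulus0. Qed.

Lemma continuous_modulusP (f : C -> C) z :
  {for z, continuous f} <-> forall e, 0 < e ->
    exists2 d, 0 < d & forall w, md (w - z) < d -> md (f w - f z) < e.
Proof.
split.
  move=> fz e e0; apply/(nbhs_modulusP z (f @^-1` disc (f z) e)).
  exact: fz (nbhs_disc _ e0).
move=> H A /nbhs_modulusP[e e0 eA]; apply/nbhs_modulusP.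
have [d d0 dH] := H _ e0; exists d => // w /dH; exact: eA.
Qed.

Lemma continuous_realP (T : topologicalType) (f : T -> R) (z : T) :
  {for z, continuous f} <-> forall e, 0 < e ->
    \forall w \near z, `|f w - f z| < e.
Proof.
split.
  move=> /cvgrPdist_lt fz e /fz; apply: filterS => w.
  by rewrite distrC.
move=> H; apply/cvgrPdist_lt => e /H; apply: filterS => w.
by rewrite distrC.
Qed.

Lemma continuous_modulus : continuous md.
Proof.
move=> z; apply/continuous_realP => e e0; apply/nbhs_modulusP; exists e => // w wz.
exact: le_lt_trans (modulus_distl _ _) wz.
Qed.

Lemma continuous_Re : continuous (@complex.Re R : C -> R).
Proof.
move=> z; apply/continuous_realP => e e0; apply/nbhs_modulusP; exists e => // w.
by apply: le_lt_trans; rewrite -ReN -ReD modulus_Re.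
Qed.

Lemma continuous_Im : continuous (@complex.Im R : C -> R).
Proof.
move=> z; apply/continuous_realP => e e0; apply/nbhs_modulusP; exists e => // w.
by apply: le_lt_trans; rewrite -ImN -ImD modulus_Im.
Qed.

Lemma continuous_to_complexP (T : topologicalType) (f : T -> C) (z : T) :
  {for z, continuous f} <-> forall e, 0 < e ->
    \forall w \near z, md (f w - f z) < e.
Proof.
split.
  by move=> fz e e0; exact: (fz (disc (f z) e) (nbhs_disc _ e0)).
move=> H A /nbhs_modulusP[e e0 eA].
have He := H _ e0; rewrite /nbhs /=.
by apply: filterS He => w; exact: eA.
Qed.

Lemma continuous_ReIm (T : topologicalType) (f g : T -> R) (z : T) :
  {for z, continuous f} -> {for z, continuous g} ->
  {for z, continuous (fun t => toC (f t) + 'i%C * toC (g t))}.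
Proof.
move=> /continuous_realP cf /continuous_realP cg.
apply/continuous_to_complexP => e e0.
have e2 : 0 < e / 2 by rewrite divr_gt0.
near=> w.
rewrite (_ : _ - _ = toC (f w - f z) + 'i%C * toC (g w - g z)).
  rewrite (le_lt_trans (modulusD _ _))// modulusM modulusi mul1r !modulus_toC.
  by rewrite (splitr e) ltrD//; near: w; [exact: cf|exact: cg].
by rewrite !toCB; ring.
Unshelve. all: by end_near. Qed.

Lemma continuous_toC : continuous toC.
Proof.
move=> x; apply/continuous_to_complexP => e e0.
apply/nbhs_ballP; exists e => // w xw.
by move: xw; rewrite -toCB modulus_toC -ball_normE /= distrC.
Qed.

Lemma continuous_modulusB z : continuous (fun w => md (w - z)).
Proof.
move=> w; apply/continuous_realP => e e0; apply/nbhs_modulusP; exists e => // u uw.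
rewrite (le_lt_trans (modulus_distl _ _))//.
by rewrite (_ : _ - _ = u - w)//; ring.
Qed.

Lemma closed_cdisc z r : closed (cdisc z r).
Proof.
rewrite (_ : cdisc z r = (fun w => md (w - z)) @^-1` [set x | x <= r])//.
apply: closed_comp => [w _|]; last exact: closed_le.
exact: continuous_modulusB.
Qed.

(** The set is a closed subset of the image of a square under the continuous map [h], so compactness
    of real segments is enough. *)
Lemma compact_closed_bounded (A : set C) (B : R) :
  closed A -> (forall z, A z -> md z <= B) -> compact A.
Proof.
move=> cA AB.
pose h (p : R * R) : C := toC p.1 + 'i%C * toC p.2.
have ch : continuous h.
  move=> p; apply: (@continuous_ReIm _ fst snd); [exact: cvg_fst|exact: cvg_snd].
have cK : compact (h @` (`[-B, B]%classic `*` `[-B, B]%classic)).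
  apply: continuous_compact; first exact: continuous_subspaceT.
  by apply: compact_setX; exact: segment_compact.
apply: subclosed_compact cA cK _ => z Az.
exists (complex.Re z, complex.Im z); last by rewrite /h /= -complexE_toC.
by split; rewrite /= in_itv /= -ler_norml (le_trans _ (AB _ Az))//;
  [exact: modulus_Re|exact: modulus_Im].
Qed.

Lemma compact_cdisc z r : compact (cdisc z r).
Proof.
apply: (@compact_closed_bounded _ (r + md z)); first exact: closed_cdisc.
by move=> w wz; rewrite -(subrK z w) (le_trans (modulusD _ _))// lerD2r.
Qed.

Lemma compact_max (A : set C) (g : C -> R) : compact A -> A !=set0 ->
  (forall z, A z -> {for z, continuous g}) ->
  exists2 z, A z & forall w, A w -> g w <= g z.
Proof.
move=> cA [a Aa] cg.
have cgA : compact (g @` A).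
  apply: continuous_compact => //; apply: continuous_in_subspaceT => z zA.
  by apply: cg; rewrite inE in zA.
have [B [_ gB]] := compact_bounded cgA.
have hs : has_sup (g @` A).
  split; first by exists (g a), a.
  exists (`|B| + 1) => _ [w Aw <-].
  apply: le_trans (ler_norm _) _; apply: gB; last by exists w.
  by rewrite (le_lt_trans (ler_norm _))// ltrDl.
have : (g @` A) (sup (g @` A)).
  have := compact_closed (@Rhausdorff R) cgA.
  rewrite closure_id => {1}->; exact: closure_sup hs.1 hs.2.
move=> [z Az gz]; exists z => // w Aw; rewrite gz.
by apply: ub_le_sup; [exact: hs.2|exists w].
Qed.

Lemma compact_min (A : set C) (g : C -> R) : compact A -> A !=set0 ->
  (forall z, A z -> {for z, continuous g}) ->
  exists2 z, A z & forall w, A w -> g z <= g w.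
Proof.
move=> cA A0 cg.
have cNg z : A z -> {for z, continuous (fun w => - g w)}.
  move=> /cg/continuous_realP cgz; apply/continuous_realP => e /cgz.
  by apply: filterS => w; rewrite -opprD normrN.
have [z Az zP] := compact_max cA A0 cNg.
by exists z => // w /zP; rewrite lerN2.
Qed.

End Modulus.

(** * Complex differentiation *)

(** Free of division, so that [w = z] needs no exception. The field is arbitrary because both real
    and complex derivatives are unfolded this way. *)
Lemma is_deriveP (K : numFieldType) (f : K -> K) (z l : K) :
  is_derive z 1 f l <-> forall e : K, 0 < e -> exists2 d : K, 0 < d &
    forall w, `|w - z| < d -> `|f w - f z - l * (w - z)| <= e * `|w - z|.
Proof.
split.
  move=> [df dl] e e0; move: df; rewrite /derivable.
  move=> df; have cl : h^-1 *: ((f \o shift z) (h *: 1) - f z) @[h --> 0^'] --> l.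
    by rewrite -dl.
  move/cvgrPdist_le : cl => /(_ e e0).
  rewrite near_withinE => /nbhs_ballP[d /= d0 H]; exists d => // w wz.
  have [->|wNz] := eqVneq w z; first by rewrite !subrr mulr0 subr0 !normr0 mulr0.
  have wz0 : w - z != 0 by rewrite subr_eq0.
  have := H (w - z); rewrite -ball_normE /= sub0r normrN => /(_ wz wz0).
  rewrite /GRing.scale /= mulr1 subrK.
  rewrite -(@ler_pM2r _ `|w - z|) ?normr_gt0// -normrM.
  rewrite (_ : (l - _) * _ = - (f w - f z - l * (w - z))) ?normrN//.
  by field.
move=> H; have cl : h^-1 *: ((f \o shift z) (h *: 1) - f z) @[h --> 0^'] --> l.
  apply/cvgrPdist_le => e e0; rewrite near_withinE; apply/nbhs_ballP.
  have [d d0 dH] := H e e0; exists d => // h; rewrite -ball_normE /= sub0r normrN.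
  move=> hd h0; have := dH (h + z); rewrite addrK => /(_ hd) B.
  rewrite -(@ler_pM2r _ `|h|) ?normr_gt0// -normrM /GRing.scale /= mulr1.
  rewrite (_ : (l - _) * h = - (f (h + z) - f z - l * h)) ?normrN//.
  by field.
split; first by apply/cvg_ex; exists l.
exact/cvg_lim.
Qed.

Lemma MVT_unit (R : realType) (phi phi' : R -> R) :
  (forall t : R, 0 <= t <= 1 -> is_derive t 1 phi (phi' t)) ->
  exists2 c : R, 0 <= c <= 1 & phi 1 - phi 0 = phi' c.
Proof.
move=> dphi; have cphi : {within `[0, 1], continuous phi}.
  by apply: derivable_within_continuous => t; rewrite in_itv => /dphi[].
have dphio (t : R) : t \in `]0, 1[ -> is_derive t 1 phi (phi' t).
  by rewrite in_itv /= => /andP[/ltW t0 /ltW t1]; apply: dphi; rewrite t0.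
have [c + E] := MVT ltr01 dphio cphi.
rewrite in_itv /= => /andP[/ltW c0 /ltW c1].
by exists c; rewrite ?c0// E subr0 mulr1.
Qed.

(** * Complex derivatives with real error bounds *)

Section ComplexDerivative.
Variable R : realType.
Local Notation C := (Cplx R).
Local Notation md := (@modulus R).
Implicit Types (z w l k : C) (e d r : R) (f g : C -> C).

(** The tolerances are real, unlike those of [is_derive] over C; estimates then become inequalities
    in an ordered field. *)
Definition cder f z l := forall e, 0 < e -> exists2 d, 0 < d &
  forall w, md (w - z) < d -> md (f w - f z - l * (w - z)) <= e * md (w - z).

Lemma cderP f z l : cder f z l <-> is_derive (z : C) 1 f l.
Proof.
split.
  move=> H; apply/is_deriveP => e e0.
  have [er eE] : exists r, e = toC r by apply/complex_realP; rewrite gtr0_real.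
  have er0 : 0 < er by move: e0; rewrite eE /toC ltcR.
  have [d d0 dH] := H _ er0; exists (toC d); first by rewrite /toC ltcR.
  move=> w; rewrite !normC_modulus eE -toCM /toC ltcR lecR; exact: dH.
move=> /is_deriveP H e e0.
have [|d d0 dH] := H (toC e); first by rewrite /toC ltcR.
have [dr dE] : exists r, d = toC r by apply/complex_realP; rewrite gtr0_real.
exists dr; first by move: d0; rewrite dE /toC ltcR.
move=> w wz; have := dH w; rewrite !normC_modulus dE -toCM /toC ltcR lecR; exact.
Qed.

Lemma derivable_cder f z : derivable f z 1 <-> exists l, cder f z l.
Proof.
split=> [df|[l /cderP[]//]]; exists ('D_1 f z); apply/cderP; exact: derivableP.
Qed.

Lemma cder_unique f z l k : cder f z l -> cder f z k -> l = k.
Proof. by move=> /cderP[_ <-] /cderP[_ <-]. Qed.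

Lemma cder_lipschitz f z l : cder f z l -> exists2 d, 0 < d &
  forall w, md (w - z) < d -> md (f w - f z) <= (md l + 1) * md (w - z).
Proof.
move=> /(_ 1 ltr01)[d d0 dH]; exists d => // w /dH H.
rewrite -(subrK (l * (w - z)) (f w - f z)) (le_trans (modulusD _ _))//.
by rewrite mulrDl addrC lerD// modulusM.
Qed.

Lemma cder_continuous f z l : cder f z l -> {for z, continuous f}.
Proof.
move=> /cder_lipschitz[d d0 dH]; apply/continuous_modulusP => e e0.
have l0 : 0 < md l + 1 by rewrite ltr_wpDl ?modulus_ge0.
exists (Num.min d (e / (md l + 1))); first by rewrite lt_min d0 divr_gt0.
move=> w; rewrite lt_min => /andP[/dH wd we].
by rewrite (le_lt_trans wd)// mulrC -ltr_pdivlMr.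
Qed.

Lemma cder_near f g z l r : 0 < r -> (forall w, md (w - z) < r -> f w = g w) ->
  cder f z l -> cder g z l.
Proof.
move=> r0 fg H e /H[d d0 dH]; exists (Num.min d r); first by rewrite lt_min d0.
move=> w; rewrite lt_min => /andP[wd wr]; rewrite -fg// -(fg z) ?dH//.
by rewrite subrr modulus0.
Qed.

Lemma cder_ext f g z l : f =1 g -> cder f z l -> cder g z l.
Proof. by move=> fg; apply: (@cder_near _ _ _ _ 1). Qed.

Lemma cder_eq f z l k : l = k -> cder f z l -> cder f z k.
Proof. by move->. Qed.

Lemma cder_cst k z : cder (fun=> k) z 0.
Proof.
move=> e e0; exists 1 => // w _.
by rewrite mul0r subrr subr0 modulus0 mulr_ge0 ?modulus_ge0// ltW.
Qed.

Lemma cder_id z : cder id z 1.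
Proof.
move=> e e0; exists 1 => // w _.
by rewrite mul1r subrr modulus0 mulr_ge0 ?modulus_ge0// ltW.
Qed.

Lemma cderD f g z l k : cder f z l -> cder g z k ->
  cder (fun w => f w + g w) z (l + k).
Proof.
move=> F G e e0; have e2 : 0 < e / 2 by rewrite divr_gt0.
have [d1 d10 H1] := F _ e2; have [d2 d20 H2] := G _ e2.
exists (Num.min d1 d2); first by rewrite lt_min d10.
move=> w; rewrite lt_min => /andP[/H1 W1 /H2 W2].
rewrite (_ : _ - _ - _ = (f w - f z - l * (w - z)) + (g w - g z - k * (w - z))).
  by rewrite (le_trans (modulusD _ _))// (splitr e) mulrDl lerD.
ring.
Qed.

Lemma cder_comp f g z l k : cder f z l -> cder g (f z) k ->
  cder (g \o f) z (k * l).
Proof.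
move=> F G e e0.
have [d1 d10 L] := cder_lipschitz F.
have l0 : 0 < md l + 1 by rewrite ltr_wpDl ?modulus_ge0.
have k0 : 0 < md k + 1 by rewrite ltr_wpDl ?modulus_ge0.
have [d2 d20 G2] := G (e / 2 / (md l + 1)) (divr_gt0 (divr_gt0 e0 (ltr0Sn _ 1)) l0).
have [d3 d30 F3] := F (e / 2 / (md k + 1)) (divr_gt0 (divr_gt0 e0 (ltr0Sn _ 1)) k0).
exists (Num.min d1 (Num.min d3 (d2 / (md l + 1)))).
  by rewrite !lt_min d10 d30 divr_gt0.
move=> w; rewrite !lt_min => /and3P[/L wL /F3 w3 w2].
have fwz : md (f w - f z) < d2.
  by rewrite (le_lt_trans wL)// mulrC -ltr_pdivlMr.
rewrite /= (_ : _ - _ - _ = (g (f w) - g (f z) - k * (f w - f z)) +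
  k * (f w - f z - l * (w - z))); last by ring.
rewrite (le_trans (modulusD _ _))// (splitr e) mulrDl lerD//.
  rewrite (le_trans (G2 _ fwz))// -mulrA ler_wpM2l ?divr_ge0 ?(ltW e0)//.
  by rewrite mulrC ler_pdivrMr// mulrC.
rewrite modulusM (@le_trans _ _ ((md k + 1) * (e / 2 / (md k + 1) * md (w - z))))//.
  by rewrite ler_pM ?modulus_ge0// lerDl.
by rewrite mulrA mulrCA mulfV ?gt_eqF// mulr1.
Qed.

Lemma cderZ f z l k : cder f z l -> cder (fun w => k * f w) z (k * l).
Proof.
have H y : cder ( *%R k) y k.
  move=> e e0; exists 1 => // w _; rewrite -mulrBr subrr modulus0.
  by rewrite mulr_ge0 ?modulus_ge0// ltW.
by move=> F; exact: (cder_comp F (H (f z))).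
Qed.

Lemma cderN f z l : cder f z l -> cder (fun w => - f w) z (- l).
Proof.
move=> /(cderZ (-1)); rewrite mulN1r; apply: cder_ext => w; exact: mulN1r.
Qed.

Lemma cderB f g z l k : cder f z l -> cder g z k ->
  cder (fun w => f w - g w) z (l - k).
Proof. by move=> F /cderN; exact: cderD. Qed.

Lemma cder_sqr z : cder (fun w => w ^+ 2) z (2 * z).
Proof.
move=> e e0; exists e => // w we.
rewrite (_ : _ - _ - _ = (w - z) * (w - z)); last by ring.
by rewrite modulusM ler_wpM2r ?modulus_ge0// ltW.
Qed.

(* Polarization [4fg = (f + g)^2 - (f - g)^2] reduces products to squares. *)
Lemma cderM f g z l k : cder f z l -> cder g z k ->
  cder (fun w => f w * g w) z (l * g z + f z * k).
Proof.
move=> F G.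
have P := cder_comp (cderD F G) (cder_sqr (f z + g z)).
have Q := cder_comp (cderB F G) (cder_sqr (f z - g z)).
have h4 : (4 : C) != 0 by rewrite pnatr_eq0.
have := cderZ (4^-1) (cderB P Q).
move/(cder_ext (g := fun w => f w * g w)) => /(_ _)/cder_eq; apply.
  by field.
by move=> w /=; field.
Qed.

Lemma cderV f z l : cder f z l -> f z != 0 ->
  cder (fun w => (f w)^-1) z (- l / f z ^+ 2).
Proof.
move=> F fz0.
have H : cder GRing.inv (f z) (- (f z ^+ 2)^-1).
  move: (f z) fz0 => a a0 e e0.
  have A0 : 0 < md a by rewrite modulus_gt0.
  (* The first bound gives [|w| >= |a| / 2]; with the second, the error [(w - a)^2 / (w a^2)] is at
     most [e |w - a|]. *)
  exists (Num.min (md a / 2) (e * (md a ^+ 3 / 2))).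
    by rewrite lt_min divr_gt0// mulr_gt0// divr_gt0// exprn_gt0.
  move=> w; rewrite lt_min => /andP[wa we].
  have wa2 : md a / 2 <= md w.
    have := modulus_leB a w; rewrite modulusBC => ?; lra.
  have W0 : 0 < md w by rewrite (lt_le_trans _ wa2)// divr_gt0.
  have w0 : w != 0 by rewrite -modulus_gt0.
  rewrite (_ : _ - _ - _ = (w - a) * (w - a) / (w * a ^+ 2)); last first.
    by field; rewrite a0.
  rewrite !modulusM modulusV modulusM modulusX -mulrA mulrC ler_wpM2r ?modulus_ge0//.
  rewrite ler_pdivrMr ?mulr_gt0 ?exprn_gt0//.
  rewrite (le_trans (ltW we))// ler_wpM2l ?(ltW e0)//.
  have -> : md a ^+ 3 / 2 = md a / 2 * md a ^+ 2 by rewrite !expr2 exprS expr2; ring.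
  by rewrite ler_wpM2r// exprn_ge0// ltW.
have := cder_comp F H; apply: cder_eq.
by rewrite !mulNr [X in - X]mulrC.
Qed.

Lemma cder_div f g z l k : cder f z l -> cder g z k -> g z != 0 ->
  cder (fun w => f w / g w) z ((l * g z - f z * k) / g z ^+ 2).
Proof.
move=> F G g0; have := cderM F (cderV G g0); apply: cder_eq.
by field.
Qed.

Lemma cderX f z l n : cder f z l ->
  cder (fun w => f w ^+ n) z (n%:R * f z ^+ n.-1 * l).
Proof.
move=> F; elim: n => [|n IH].
  by rewrite !mul0r; apply: cder_ext (cder_cst 1 z) => w; rewrite expr0.
have := cderM F IH; move/(cder_ext (g := fun w => f w ^+ n.+1)) => /(_ _)/cder_eq.
apply; last by move=> w; rewrite exprS.
case: n {IH} => [|n] /=; first by rewrite expr0; ring.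
by rewrite exprS -[in RHS]natr1; ring.
Qed.

Definition holo (A : set C) f := forall z, A z -> exists l, cder f z l.

(* Equals 0 where [f] has no derivative. *)
Definition cderive f z : C := xget 0 [set l | cder f z l].

Lemma cderiveP f z : (exists l, cder f z l) -> cder f z (cderive f z).
Proof. by move=> [l H]; exact: (@xgetPex _ 0 [set l | cder f z l] (ex_intro _ l H)). Qed.

Lemma cderiveE f z l : cder f z l -> cderive f z = l.
Proof. by move=> H; exact: cder_unique (cderiveP (ex_intro _ l H)) H. Qed.

Lemma holo_sub (A B : set C) f : A `<=` B -> holo B f -> holo A f.
Proof. by move=> AB H z /AB/H. Qed.

(** The factor [u] selects the real component: 1 and [-i] give the real and imaginary parts, and a
    unit number gives the projection on a chosen direction. *)
Lemma is_derive_Re_line f (c a u : C) (t : R) l : cder f (c + toC t * a) l ->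
  is_derive t 1 (fun s => complex.Re (u * f (c + toC s * a))) (complex.Re (u * (l * a))).
Proof.
move=> F; apply/is_deriveP => e e0.
have A : cder (fun s => c + s * a) (toC t) a.
  move=> e1 e10; exists 1 => // w _.
  rewrite (_ : _ - _ - _ = 0); last by ring.
  by rewrite modulus0 mulr_ge0 ?modulus_ge0// ltW.
have [d d0 H] := cderZ u (cder_comp A F) e0.
exists d => // s st; have := H (toC s); rewrite -toCB modulus_toC => /(_ st).
apply: le_trans; rewrite (le_trans _ (modulus_Re _))// !ReD !ReN.
by rewrite mulrA [complex.Re (_ * toC _)]ReM mulr0 subr0.
Qed.

(* Projecting on the direction of [f w - f z] reduces this to the real mean value
   theorem. *)
Lemma cder_mean_value f (z w : C) B :
  (forall t : R, 0 <= t <= 1 -> exists2 l, cder f (z + toC t * (w - z)) l & md l <= B) ->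
  md (f w - f z) <= B * md (w - z).
Proof.
move=> H.
have [->|D0] := eqVneq (f w - f z) 0.
  have [|l _ lB] := H 0; first by rewrite lexx ler01.
  by rewrite modulus0 mulr_ge0 ?modulus_ge0// (le_trans _ lB) ?modulus_ge0.
set D := f w - f z in D0 *.
have MD : md D != 0 by rewrite modulus_eq0.
have [u uD mu] : exists2 u : C, u * D = toC (md D) & md u = 1.
  exists (toC (md D) / D); first by rewrite divfK.
  by rewrite modulusM modulusV modulus_toC ger0_norm ?modulus_ge0 ?divff.
pose phi (t : R) : R := complex.Re (u * f (z + toC t * (w - z))).
pose phi' (t : R) : R := complex.Re (u * (cderive f (z + toC t * (w - z)) * (w - z))).
have [|c c01 E] := @MVT_unit _ phi phi'.
  move=> t /H[l L _].
  exact: (@is_derive_Re_line f z (w - z) u t _ (cderiveP (ex_intro _ l L))).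
have E1 : phi 1 - phi 0 = md D.
  have p1 : z + toC 1 * (w - z) = w by rewrite /toC rmorph1 mul1r addrC subrK.
  have p0 : z + toC 0 * (w - z) = z by rewrite /toC rmorph0 mul0r addr0.
  by rewrite /phi p1 p0 -ReN -ReD -mulrN -mulrDr uD.
rewrite -E1 E.
apply: le_trans (ler_norm _) _; apply: le_trans (modulus_Re _) _.
rewrite !modulusM mu mul1r ler_wpM2r ?modulus_ge0//.
by have [l L lB] := H c c01; rewrite (cderiveE L).
Qed.

End ComplexDerivative.

(** * Integration along segments and Goursat's theorem *)

Section RealPrimitive.
Variable R : realType.
Local Notation mu := (@lebesgue_measure R).
Implicit Types (g G : R -> R).

Let I g a x := (\int[mu]_(t in `[a, x]) g t)%R.

Let integrable_itv g a b : continuous g -> mu.-integrable `[a, b] (EFin \o g).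
Proof.
move=> cg; apply: continuous_compact_integrable; first exact: segment_compact.
exact: continuous_subspaceT.
Qed.

Let Icat g a b x : continuous g -> a <= b -> b <= x -> I g a x = I g a b + I g b x.
Proof.
move=> cg ab bx; apply/eqP; rewrite addrC -subr_eq; apply/eqP.
rewrite /I Rintegral_itvB; [|exact: integrable_itv|by []|by []].
rewrite Rintegral_itv_obnd_cbnd//.
apply: integrableS (integrable_itv b x cg) => //.
by apply: subset_itvr; rewrite bnd_simp.
Qed.

(** The base point [-|x| - 1] lies to the left of both 0 and [x]. Subtracting the integral up to 0
    removes the dependence on it, so near each point [P] is an integral from a fixed base point, up
    to a constant. *)
Lemma exists_primitive g : continuous g ->
  exists G, forall x : R, is_derive x 1 G (g x).
Proof.
move=> cg; pose P x := I g (- `|x| - 1) x - I g (- `|x| - 1) 0.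
have PE A x : A <= 0 -> A <= x -> P x = I g A x - I g A 0.
  move=> A0 Ax; rewrite /P; set B := - `|x| - 1.
  have B0 : B <= 0 by rewrite /B; have := normr_ge0 x; lra.
  have Bx : B <= x by rewrite /B; have := lerNnormlW (lexx `|x|); lra.
  have [AB|/ltW BA] := leP A B.
    by rewrite (Icat cg AB Bx) (Icat cg AB B0); lra.
  by rewrite (Icat cg BA Ax) (Icat cg BA A0); lra.
exists P => x; pose A := - `|x| - 2.
have A0 : A <= 0 by rewrite /A; have := normr_ge0 x; lra.
have Ax : A + 1 < x by rewrite /A; have := lerNnormlW (lexx `|x|); lra.
have x1 : x < x + 1 by rewrite ltrDl.
have [dI eI] := continuous_FTC1_closed x1 (integrable_itv A (x + 1) cg)
  (ltac:(lra) : A < x) (cg x).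
have dI' : is_derive x 1 (I g A) (g x).
  by split; [exact: dI|rewrite -eI derive1E].
have dP : is_derive x 1 (fun y => I g A y - I g A 0) (g x).
  have := is_deriveB dI' (is_derive_cst (I g A 0) x 1).
  by rewrite subr0.
apply: near_eq_is_derive dP; near=> y.
rewrite (PE A)//; near: y.
apply/nbhs_ballP; exists 1 => //= y; rewrite -ball_normE /= => /ltr_normlP[] ? ?.
lra.
Unshelve. all: by end_near. Qed.

Definition primitive g : R -> R :=
  xget (cst 0) [set G | forall x : R, is_derive x 1 G (g x)].

Lemma primitiveP g : continuous g -> forall x : R, is_derive x 1 (primitive g) (g x).
Proof. by move=> /exists_primitive[G H]; exact: (@xgetPex _ _ [set G | _] (ex_intro _ G H)). Qed.

(** As a difference of values, the integral is additive and changes sign with its orientation by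
    pure algebra, whatever the order of [a] and [b]. *)
Definition rint g a b := primitive g b - primitive g a.

Lemma rintE g G a b : continuous g -> (forall x : R, is_derive x 1 G (g x)) ->
  rint g a b = G b - G a.
Proof.
move=> cg dG; have H (x : R) : is_derive x 1 (primitive g - G) 0.
  by rewrite -(subrr (g x)); apply: is_deriveB => //; exact: primitiveP.
have /= := is_derive_0_is_cst b a H.
rewrite /rint !fctE; lra.
Qed.

Lemma rintD g h a b : continuous g -> continuous h ->
  rint (fun x => g x + h x) a b = rint g a b + rint h a b.
Proof.
move=> cg ch; have cgh : continuous (fun x => g x + h x).
  by move=> x; apply: continuousD; [exact: cg|exact: ch].
have dG (x : R) : is_derive x 1 (primitive g + primitive h) (g x + h x).
  by apply: is_deriveD; exact: primitiveP.
rewrite (rintE a b cgh dG) /rint !fctE; lra.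
Qed.

Lemma rintZ k g a b : continuous g ->
  rint (fun x => k * g x) a b = k * rint g a b.
Proof.
move=> cg; have ckg : continuous (fun x => k * g x).
  by move=> x; apply: continuousM; [exact: cst_continuous|exact: cg].
have dG (x : R) : is_derive x 1 (fun y => k * primitive g y) (k * g x).
  by apply: (@is_deriveZ _ _ _ (primitive g)); exact: primitiveP.
by rewrite (rintE a b ckg dG) /rint mulrBr.
Qed.

Lemma rint_MVT g a b : continuous g -> a <= b ->
  exists2 c, a <= c <= b & rint g a b = g c * (b - a).
Proof.
move=> cg ab.
have [c cab E] := @MVT_segment R (primitive g) g a b ab
  (fun x _ => primitiveP cg x)
  (derivable_within_continuous (fun x _ => @ex_derive _ _ _ _ _ _ _ (primitiveP cg x))).
by exists c; rewrite // -in_itv.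
Qed.

Lemma rint_rev g a b : rint g b a = - rint g a b.
Proof. by rewrite /rint opprB. Qed.

Lemma rint_bound g a b B : continuous g ->
  (forall x, Num.min a b <= x <= Num.max a b -> `|g x| <= B) ->
  `|rint g a b| <= B * `|b - a|.
Proof.
move=> cg; wlog ab : a b / a <= b => [H|].
  case/orP: (le_total a b) => [|ba]. exact: H.
  move=> gB; rewrite rint_rev normrN (distrC b a); apply: (H _ _ ba) => x.
  by rewrite minC maxC; exact: gB.
rewrite min_l // max_r // => gB; have [c cab ->] := rint_MVT cg ab.
by rewrite normrM ler_wpM2r// gB.
Qed.

End RealPrimitive.

(** * Integrals of complex-valued functions of a real variable *)

Section ComplexIntegral.
Variable R : realType.
Local Notation C := (Cplx R).
Local Notation md := (@modulus R).
Implicit Types (g h : R -> C).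

Definition cint g a b : C :=
  toC (rint (fun t => complex.Re (g t)) a b) + 'i%C * toC (rint (fun t => complex.Im (g t)) a b).

Let cRe g : continuous g -> continuous (fun t => complex.Re (g t)).
Proof. by move=> cg x; apply: continuous_comp; [exact: cg|exact: continuous_Re]. Qed.

Let cIm g : continuous g -> continuous (fun t => complex.Im (g t)).
Proof. by move=> cg x; apply: continuous_comp; [exact: cg|exact: continuous_Im]. Qed.

Lemma cint_chasles g a b c : cint g a b + cint g b c = cint g a c.
Proof. by rewrite /cint /rint !toCB; ring. Qed.

Lemma cint_rev g a b : cint g b a = - cint g a b.
Proof. by rewrite /cint /rint !toCB; ring. Qed.

Lemma cintD g h a b : continuous g -> continuous h ->
  cint (fun x => g x + h x) a b = cint g a b + cint h a b.
Proof.
move=> cg ch; rewrite /cint.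
under eq_fun do rewrite ReD.
under [X in 'i%C * toC (rint X _ _)]eq_fun do rewrite ImD.
by rewrite !rintD ?toCD; [ring|exact: cIm|exact: cIm|exact: cRe|exact: cRe].
Qed.

Lemma cintZ (k : C) g a b : continuous g ->
  cint (fun x => k * g x) a b = k * cint g a b.
Proof.
move=> cg; rewrite /cint.
have E1 : (fun t => complex.Re (k * g t)) =
  (fun t => complex.Re k * complex.Re (g t) + (- complex.Im k) * complex.Im (g t)).
  by apply/funext => t; rewrite ReM mulNr.
have E2 : (fun t => complex.Im (k * g t)) =
  (fun t => complex.Re k * complex.Im (g t) + complex.Im k * complex.Re (g t)).
  by apply/funext => t; rewrite ImM.
have cM (c : R) (u : R -> R) : continuous u -> continuous (fun t => c * u t).
  by move=> cu x; apply: continuousM; [exact: cst_continuous|exact: cu].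
have cr := cRe cg; have ci := cIm cg.
rewrite E1 E2 !rintD; do ?[exact: cM]; rewrite !rintZ//.
move: (rint (fun t => complex.Re (g t)) a b) (rint (fun t => complex.Im (g t)) a b) => u v.
rewrite [in RHS](complexE_toC k) !toCD !toCM toCN.
have i2 : 'i%C * 'i%C = -1 :> C by rewrite -expr2 sqr_i.
set ii := 'i%C in i2 *; ring: i2.
Qed.

Lemma cint_bound g a b B : continuous g ->
  (forall x, Num.min a b <= x <= Num.max a b -> md (g x) <= B) ->
  md (cint g a b) <= 2 * B * `|b - a|.
Proof.
move=> cg gB; rewrite /cint (le_trans (modulusD _ _))//.
rewrite modulusM modulusi mul1r !modulus_toC -mulrA mulr_natl mulr2n lerD//.
  by apply: rint_bound => [|x /gB]; [exact: cRe|apply: le_trans; exact: modulus_Re].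
by apply: rint_bound => [|x /gB]; [exact: cIm|apply: le_trans; exact: modulus_Im].
Qed.

Lemma continuous_line (f : C -> C) (c a : C) : continuous f ->
  continuous (fun t : R => f (c + toC t * a)).
Proof.
move=> cf t; apply: (@continuous_comp _ _ _ (fun t : R => c + toC t * a) f);
  last exact: cf.
apply/continuous_to_complexP => e e0.
have a0 : 0 < md a + 1 by rewrite ltr_wpDl ?modulus_ge0.
apply/nbhs_ballP; exists (e / (md a + 1)); first by rewrite /= divr_gt0.
move=> s; rewrite -ball_normE /= ltr_pdivlMr// distrC => H.
rewrite (_ : _ - _ = toC (s - t) * a); last by rewrite toCB; ring.
rewrite modulusM modulus_toC (le_lt_trans _ H)//.
by rewrite ler_wpM2l// lerDl.
Qed.

Lemma cint_cder (F f : C -> C) (c a : C) x y : continuous f ->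
  (forall t : R, cder F (c + toC t * a) (f (c + toC t * a))) ->
  cint (fun t => f (c + toC t * a) * a) x y =
  F (c + toC y * a) - F (c + toC x * a).
Proof.
move=> cf dF.
have cg : continuous (fun t : R => f (c + toC t * a) * a).
  under eq_fun do rewrite mulrC.
  apply: (@continuous_line (fun z => a * f z)) => z.
  apply: (@continuous_comp _ _ _ f ( *%R a)); first exact: cf.
  by have /cder_continuous := cderZ a (cder_id (f z)).
have D1 (t : R) : is_derive t 1 (fun s => complex.Re (F (c + toC s * a)))
    (complex.Re (f (c + toC t * a) * a)).
  have := is_derive_Re_line 1 (dF t); rewrite mul1r.
  by under eq_fun do rewrite mul1r.
have D2 (t : R) : is_derive t 1 (fun s => complex.Im (F (c + toC s * a)))
    (complex.Im (f (c + toC t * a) * a)).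
  have RI (z : C) : complex.Re (- 'i%C * z) = complex.Im z.
    by case: z => u v; rewrite /=; ring.
  have := is_derive_Re_line (- 'i%C) (dF t); rewrite RI.
  by under eq_fun do rewrite RI.
rewrite /cint (rintE _ _ (cRe cg) D1) (rintE _ _ (cIm cg) D2).
rewrite -!ReN -!ReD -!ImN -!ImD; exact/esym/complexE_toC.
Qed.

End ComplexIntegral.

(** * Goursat's theorem on rectangles *)

Section Goursat.
Variable R : realType.
Local Notation C := (Cplx R).
Local Notation md := (@modulus R).
Implicit Types (f g : C -> C) (x y w h : R).

Definition pt x y : C := toC x + toC y * 'i%C.

Definition hside f y a b : C := cint (fun t => f (pt t y)) a b.
(** The factor ['i] is [dz / dt] on a vertical side. *)
Definition vside f x a b : C := 'i%C * cint (fun t => f (pt x t)) a b.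

Definition rect_int f x1 x2 y1 y2 : C :=
  hside f y1 x1 x2 - hside f y2 x1 x2 + (vside f x2 y1 y2 - vside f x1 y1 y2).

Lemma pt_ReIm (z : C) : pt (complex.Re z) (complex.Im z) = z.
Proof. by rewrite /pt mulrC -complexE_toC. Qed.

Lemma ptD x y x' y' : pt x y + pt x' y' = pt (x + x') (y + y').
Proof. by rewrite /pt !toCD; ring. Qed.

Lemma ptB x y x' y' : pt x y - pt x' y' = pt (x - x') (y - y').
Proof. by rewrite /pt !toCB; ring. Qed.

Lemma Re_pt x y : complex.Re (pt x y) = x.
Proof. by rewrite /pt ReD ReM /=; ring. Qed.

Lemma Im_pt x y : complex.Im (pt x y) = y.
Proof. by rewrite /pt ImD ImM /=; ring. Qed.

Lemma modulus_pt x y : md (pt x y) <= `|x| + `|y|.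
Proof. by rewrite (le_trans (modulus_ReIm _))// Re_pt Im_pt. Qed.

Lemma continuous_hline f y : continuous f -> continuous (fun t => f (pt t y)).
Proof.
move=> cf; have := @continuous_line _ f (toC y * 'i%C) 1 cf.
by under eq_fun do rewrite mulr1 addrC.
Qed.

Lemma continuous_vline f x : continuous f -> continuous (fun t => f (pt x t)).
Proof. by move=> cf; exact: (@continuous_line _ f (toC x) 'i%C cf). Qed.

Lemma hside_chasles f y a b c : hside f y a b + hside f y b c = hside f y a c.
Proof. exact: cint_chasles. Qed.

Lemma vside_chasles f x a b c : vside f x a b + vside f x b c = vside f x a c.
Proof. by rewrite /vside -mulrDr cint_chasles. Qed.

Lemma hsideD f g y a b : continuous f -> continuous g ->
  hside (fun z => f z + g z) y a b = hside f y a b + hside g y a b.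
Proof. by move=> cf cg; rewrite /hside cintD//; exact: continuous_hline. Qed.

Lemma vsideD f g x a b : continuous f -> continuous g ->
  vside (fun z => f z + g z) x a b = vside f x a b + vside g x a b.
Proof. by move=> cf cg; rewrite /vside cintD ?mulrDr//; exact: continuous_vline. Qed.

Lemma rect_intD f g x1 x2 y1 y2 : continuous f -> continuous g ->
  rect_int (fun z => f z + g z) x1 x2 y1 y2 =
  rect_int f x1 x2 y1 y2 + rect_int g x1 x2 y1 y2.
Proof. by move=> cf cg; rewrite /rect_int !hsideD// !vsideD//; ring. Qed.

Lemma hside_bound f y a b B : continuous f ->
  (forall x, Num.min a b <= x <= Num.max a b -> md (f (pt x y)) <= B) ->
  md (hside f y a b) <= 2 * B * `|b - a|.
Proof. by move=> cf; apply: cint_bound; exact: continuous_hline. Qed.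

Lemma vside_bound f x a b B : continuous f ->
  (forall y, Num.min a b <= y <= Num.max a b -> md (f (pt x y)) <= B) ->
  md (vside f x a b) <= 2 * B * `|b - a|.
Proof.
move=> cf fB; rewrite /vside modulusM modulusi mul1r.
by apply: cint_bound => //; exact: continuous_vline.
Qed.

(** The endpoints come in either order: [rect_int] only changes sign when two of them are swapped,
    so any corner of a rectangle can be listed first. *)
Definition hull (a b x : R) := Num.min a b <= x <= Num.max a b.

Lemma hull_l a b : hull a b a.
Proof. by rewrite /hull ge_min le_max lexx. Qed.

Lemma hull_r a b : hull a b b.
Proof. by rewrite /hull ge_min le_max lexx !orbT. Qed.

Lemma hull_le a b x : a <= b -> hull a b x = (a <= x <= b).
Proof. by move=> ab; rewrite /hull min_l// max_r. Qed.

Lemma hullC a b x : hull a b x = hull b a x.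
Proof. by rewrite /hull minC maxC. Qed.

Lemma hull_sub a b c d x : hull a b c -> hull a b d -> hull c d x -> hull a b x.
Proof.
rewrite /hull => /andP[c1 c2] /andP[d1 d2] /andP[x1 x2]; apply/andP; split.
  by rewrite (le_trans _ x1)// le_min c1.
by rewrite (le_trans x2)// ge_max c2.
Qed.

(** Opposite sides account for one factor 2 of the constant; the other comes from [cint_bound],
    which estimates real and imaginary parts separately. *)
Lemma rect_int_bound f x1 x2 y1 y2 B : continuous f ->
  (forall x y, hull x1 x2 x -> hull y1 y2 y -> md (f (pt x y)) <= B) ->
  md (rect_int f x1 x2 y1 y2) <= 4 * B * (`|x2 - x1| + `|y2 - y1|).
Proof.
move=> cf fB; rewrite /rect_int.
have h1 : md (hside f y1 x1 x2) <= 2 * B * `|x2 - x1|.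
  by apply: hside_bound => // x xx; apply: fB => //; exact: hull_l.
have h2 : md (hside f y2 x1 x2) <= 2 * B * `|x2 - x1|.
  by apply: hside_bound => // x xx; apply: fB => //; exact: hull_r.
have v1 : md (vside f x1 y1 y2) <= 2 * B * `|y2 - y1|.
  by apply: vside_bound => // x xx; apply: fB => //; exact: hull_l.
have v2 : md (vside f x2 y1 y2) <= 2 * B * `|y2 - y1|.
  by apply: vside_bound => // x xx; apply: fB => //; exact: hull_r.
rewrite (le_trans (modulusD _ _))//.
have := modulusD (hside f y1 x1 x2) (- hside f y2 x1 x2).
have := modulusD (vside f x2 y1 y2) (- vside f x1 y1 y2).
rewrite !modulusN; lra.
Qed.

Lemma rect_int_chaslesx f x1 x2 x3 y1 y2 :
  rect_int f x1 x2 y1 y2 + rect_int f x2 x3 y1 y2 = rect_int f x1 x3 y1 y2.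
Proof. by rewrite /rect_int -!(@hside_chasles _ _ x1 x2 x3); ring. Qed.

Lemma rect_int_chaslesy f x1 x2 y1 y2 y3 :
  rect_int f x1 x2 y1 y2 + rect_int f x1 x2 y2 y3 = rect_int f x1 x2 y1 y3.
Proof. by rewrite /rect_int -!(@vside_chasles _ _ y1 y2 y3); ring. Qed.

Lemma rect_int_revx f x1 x2 y1 y2 : rect_int f x2 x1 y1 y2 = - rect_int f x1 x2 y1 y2.
Proof.
rewrite /rect_int /hside !(cint_rev _ x1 x2); ring.
Qed.

Lemma rect_int_revy f x1 x2 y1 y2 : rect_int f x1 x2 y2 y1 = - rect_int f x1 x2 y1 y2.
Proof. by rewrite /rect_int /vside !(cint_rev _ y1 y2); ring. Qed.

Lemma rect_int_cder (F f : C -> C) x1 x2 y1 y2 : continuous f ->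
  (forall z, cder F z (f z)) -> rect_int f x1 x2 y1 y2 = 0.
Proof.
move=> cf dF.
have H y a b : hside f y a b = F (pt b y) - F (pt a y).
  have := @cint_cder _ F f (toC y * 'i%C) 1 a b cf (fun t => dF _).
  rewrite /hside /pt !mulr1 => E.
  rewrite (addrC (toC b)) (addrC (toC a)) -E.
  by congr cint; apply/funext => t; rewrite !mulr1 addrC.
have V x a b : vside f x a b = F (pt x b) - F (pt x a).
  have <- := @cint_cder _ F f (toC x) 'i%C a b cf (fun t => dF _).
  rewrite /vside -cintZ; last exact: continuous_vline.
  by congr cint; apply/funext => t; rewrite mulrC.
by rewrite /rect_int !H !V; ring.
Qed.

Lemma continuous_affine (a b : C) : continuous (fun z : C => a + b * z).
Proof.
move=> z; have /cder_continuous := cderD (cder_cst a z) (cderZ b (cder_id z)).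
exact.
Qed.

Lemma rect_int_affine (a b : C) x1 x2 y1 y2 :
  rect_int (fun z => a + b * z) x1 x2 y1 y2 = 0.
Proof.
apply: (@rect_int_cder (fun z => a * z + b / 2 * z ^+ 2)).
  exact: continuous_affine.
move=> z; have := cderD (cderZ a (cder_id z)) (cderZ (b / 2) (cder_sqr z)).
by apply: cder_eq; field.
Qed.

Lemma quarter_step f x y w h (c : R) :
  c <= md (rect_int f x (x + w) y (y + h)) ->
  exists x' y', [/\ x' = x \/ x' = x + w / 2, y' = y \/ y' = y + h / 2 &
    c / 4 <= md (rect_int f x' (x' + w / 2) y' (y' + h / 2))].
Proof.
move=> H; apply: contrapT => N.
have L x' y' : x' = x \/ x' = x + w / 2 -> y' = y \/ y' = y + h / 2 ->
    md (rect_int f x' (x' + w / 2) y' (y' + h / 2)) < c / 4.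
  by move=> hx hy; rewrite ltNge; apply/negP => ?; apply: N; exists x', y'.
have := L _ _ (or_introl erefl) (or_introl erefl).
have := L _ _ (or_introl erefl) (or_intror erefl).
have := L _ _ (or_intror erefl) (or_introl erefl).
have := L _ _ (or_intror erefl) (or_intror erefl).
have -> : x + w / 2 + w / 2 = x + w by lra.
have -> : y + h / 2 + h / 2 = y + h by lra.
move: H; rewrite -(rect_int_chaslesx f x (x + w / 2) (x + w)).
rewrite -!(rect_int_chaslesy f _ _ y (y + h / 2) (y + h)).
set a := rect_int _ _ _ _ _; set b := rect_int _ _ _ _ _.
set u := rect_int _ _ _ _ _; set v := rect_int _ _ _ _ _.
have := modulusD (a + b) (u + v); have := modulusD a b; have := modulusD u v.
lra.
Qed.

Lemma goursat_seq f x y w h : exists p : nat -> R * R,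
  p 0%N = (x, y) /\ forall n,
   [/\ (p n.+1).1 = (p n).1 \/ (p n.+1).1 = (p n).1 + w / 2 ^+ n.+1,
       (p n.+1).2 = (p n).2 \/ (p n.+1).2 = (p n).2 + h / 2 ^+ n.+1 &
   md (rect_int f x (x + w) y (y + h)) / 4 ^+ n <=
   md (rect_int f (p n).1 ((p n).1 + w / 2 ^+ n) (p n).2 ((p n).2 + h / 2 ^+ n))].
Proof.
set c := md _.
pose X := (nat * (R * R))%type.
pose good (s : X) := c / 4 ^+ s.1 <=
   md (rect_int f s.2.1 (s.2.1 + w / 2 ^+ s.1) s.2.2 (s.2.2 + h / 2 ^+ s.1)).
(* The last clause is an implication so that every state, good or not, has a successor, as
   [dependent_choice] demands. *)
pose rel (s t : X) := [/\ t.1 = s.1.+1,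
   t.2.1 = s.2.1 \/ t.2.1 = s.2.1 + w / 2 ^+ s.1.+1,
   t.2.2 = s.2.2 \/ t.2.2 = s.2.2 + h / 2 ^+ s.1.+1 & good s -> good t].
have step s : {t | rel s t}.
  apply: cid; have [gs|ngs] := pselect (good s); last first.
    by exists (s.1.+1, s.2); split; rewrite //=; left.
  have [x' [y' [hx hy H]]] := quarter_step gs.
  have E v : v / 2 ^+ s.1 / 2 = v / 2 ^+ s.1.+1 :> R.
    by rewrite exprSr invfM mulrA.
  rewrite !E in hx hy H.
  exists (s.1.+1, (x', y')); split => //= _; rewrite /good /=.
  by rewrite [4 ^+ _.+1]exprSr invfM mulrA.
have [p [p0 pS]] := dependent_choice step (0%N, (x, y)).
have p1 n : (p n).1 = n by elim: n => [|n IH]; [rewrite p0|have [-> _ _ _] := pS n; rewrite IH].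
have gp n : good (p n).
  elim: n => [|n IH]; last by have [_ _ _] := pS n; exact.
  by rewrite p0 /good /= expr0 !divr1.
exists (fun n => (p n).2); split; first by rewrite p0.
move=> n; have [_ hx hy _] := pS n; have := gp n.
by rewrite /good p1 => g; split => //; rewrite -[in _ ^+ _](p1 n).
Qed.

Lemma bisection_limit (u : nat -> R) w : 0 <= w ->
  (forall n, u n.+1 = u n \/ u n.+1 = u n + w / 2 ^+ n.+1) ->
  exists s, forall n, u n <= s <= u n + w / 2 ^+ n.
Proof.
move=> w0 uS.
have h n : 0 <= w / 2 ^+ n.+1 by rewrite divr_ge0// exprn_ge0.
have hE n : w / 2 ^+ n = w / 2 ^+ n.+1 + w / 2 ^+ n.+1.
  have N0 : 2 ^+ n != 0 :> R by rewrite expf_neq0// pnatr_eq0.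
  by rewrite exprSr; field; rewrite N0.
have mono n k : u n <= u (n + k)%N.
  elim: k => [|k IH]; first by rewrite addn0.
  rewrite addnS (le_trans IH)//; have := h (n + k)%N.
  case: (uS (n + k)%N) => ->; lra.
have anti n k : u (n + k)%N + w / 2 ^+ (n + k) <= u n + w / 2 ^+ n.
  elim: k => [|k IH]; first by rewrite addn0.
  rewrite addnS (le_trans _ IH)//; have := h (n + k)%N.
  rewrite (hE (n + k)%N); case: (uS (n + k)%N) => ->; lra.
have ub n m : u m <= u n + w / 2 ^+ n.
  have [nm|/ltnW mn] := leqP n m.
    have := anti n (m - n)%N; rewrite subnKC//; apply: le_trans.
    by rewrite lerDl divr_ge0// exprn_ge0.
  have := mono m (n - m)%N; rewrite subnKC// => /le_trans; apply.
  by rewrite lerDl divr_ge0// exprn_ge0.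
have hs : has_sup (range u).
  by split; [exists (u 0%N), 0%N|exists (u 0%N + w / 2 ^+ 0) => _ [m _ <-]].
exists (sup (range u)) => n; apply/andP; split.
  by apply: ub_le_sup; [exact: hs.2|exists n].
by apply: ge_sup; [exact: hs.1|move=> _ [m _ <-]].
Qed.

Lemma goursat_box f x y w h : continuous f -> 0 <= w -> 0 <= h ->
  (forall s t, x <= s <= x + w -> y <= t <= y + h -> exists l, cder f (pt s t) l) ->
  rect_int f x (x + w) y (y + h) = 0.
Proof.
move=> cf w0 h0 df; apply/eqP; rewrite -modulus_eq0; apply/eqP.
have [p [p0 pS]] := goursat_seq f x y w h.
have [|s sP] := @bisection_limit (fun n => (p n).1) w w0.
  by move=> n; have [] := pS n.
have [|t tP] := @bisection_limit (fun n => (p n).2) h h0.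
  by move=> n; have [] := pS n.
have [||l dl] := df s t.
- by have := sP 0%N; rewrite p0 expr0 divr1.
- by have := tP 0%N; rewrite p0 expr0 divr1.
apply/eqP; rewrite eq_le modulus_ge0 andbT.
apply/ler_addgt0Pr => e e0; rewrite add0r.
(* On the [n]-th box both the bound of [g] and the side lengths carry a factor [(w + h) / 2 ^+ n];
   their product cancels the [4 ^+ n] of the subdivision and leaves [4 e (w + h)^2 / K]. The 1
   covers degenerate boxes. *)
pose K := 4 * (w + h) ^+ 2 + 1.
have K0 : 0 < K by rewrite ltr_wpDl// mulr_ge0// sqr_ge0.
have [d d0 H] := dl _ (divr_gt0 e0 K0).
have [n nd] : exists n : nat, (w + h) / 2 ^+ n < d.
  have [n] : exists n : nat, (w + h) / d < 2 ^+ n.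
    exists (Num.truncn ((w + h) / d)).+1.
    apply: (lt_trans (truncnS_gt _)).
    by rewrite -natrX ltr_nat ltn_expl.
  by move=> H1; exists n; rewrite ltr_pdivrMr ?exprn_gt0// mulrC -ltr_pdivrMr.
have [_ _ cn] := pS n.
set a := (p n).1 in cn; set b := (p n).2 in cn.
(* Subtracting the affine part leaves the boundary integral unchanged and makes the integrand small
   near the limit point. *)
pose g (z : C) := f z - f (pt s t) - l * (z - pt s t).
have cg : continuous g.
  move=> z; apply: (@continuousD _ _ _ (fun z => f z - f (pt s t)) (fun z => - (l * (z - pt s
    t)))).
    by apply: continuousB; [exact: cf|exact: cst_continuous].
  rewrite (_ : (fun u : C => - (l * (u - pt s t))) = (fun u => l * pt s t + (- l) * u)).
    exact: continuous_affine.
  by apply/funext => u; ring.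
have E : rect_int f a (a + w / 2 ^+ n) b (b + h / 2 ^+ n) =
    rect_int g a (a + w / 2 ^+ n) b (b + h / 2 ^+ n).
  have ca := @continuous_affine (f (pt s t) - l * pt s t) l.
  have := rect_intD a (a + w / 2 ^+ n) b (b + h / 2 ^+ n) cg ca.
  rewrite rect_int_affine addr0 => <-.
  have {1}-> // : f = fun z => g z + (f (pt s t) - l * pt s t + l * z).
  apply/funext => z; rewrite /g.
  by move: (f z) (f (pt s t)) (pt s t) => u v q; ring.
have wn : 0 <= w / 2 ^+ n by rewrite divr_ge0// exprn_ge0.
have hn : 0 <= h / 2 ^+ n by rewrite divr_ge0// exprn_ge0.
have gB u v : hull a (a + w / 2 ^+ n) u -> hull b (b + h / 2 ^+ n) v ->
    md (g (pt u v)) <= e / K * ((w + h) / 2 ^+ n).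
  rewrite !hull_le ?lerDl// => /andP[u1 u2] /andP[v1 v2].
  have [/andP[s1 s2] /andP[t1 t2]] := (sP n, tP n).
  have D : md (pt u v - pt s t) <= (w + h) / 2 ^+ n.
    rewrite ptB (le_trans (modulus_pt _ _))// mulrDl lerD// ler_norml.
      rewrite -/a in s1 s2; lra.
    rewrite -/b in t1 t2; lra.
  rewrite /g (le_trans (H _ (le_lt_trans D nd)))// ler_wpM2l//.
  by rewrite divr_ge0 ?ltW.
have := rect_int_bound cg gB; rewrite -E => /(le_trans cn).
rewrite ![_ + _ / _ - _]addrC !addKr !ger0_norm// -mulrDl.
rewrite ler_pdivrMr ?exprn_gt0// => /le_trans; apply.
have -> : 4 ^+ n = 2 ^+ n * 2 ^+ n :> R.
  by rewrite -exprMn -natrM.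
have N0 : 2 ^+ n != 0 :> R by rewrite expf_neq0// pnatr_eq0.
have gen (L N W : R) : L != 0 -> N != 0 ->
    4 * (e / L * (W / N)) * (W / N) * (N * N) = e * (4 * W ^+ 2 / L).
  by move=> L0 M0; field; rewrite L0 M0.
rewrite gen ?gt_eqF ?exprn_gt0//.
by rewrite (ler_piMr (ltW e0))// ler_pdivrMr// mul1r lerDl.
Qed.

Lemma goursat_hull f x1 x2 y1 y2 : continuous f ->
  (forall s t, hull x1 x2 s -> hull y1 y2 t -> exists l, cder f (pt s t) l) ->
  rect_int f x1 x2 y1 y2 = 0.
Proof.
move=> cf; wlog xx : x1 x2 / x1 <= x2.
  move=> H df; case/orP: (le_total x1 x2) => xx; first exact: H.
  rewrite rect_int_revx H ?oppr0// => s t; rewrite hullC; exact: df.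
wlog yy : y1 y2 / y1 <= y2.
  move=> H df; case/orP: (le_total y1 y2) => yy; first exact: H.
  rewrite rect_int_revy H ?oppr0// => s t; rewrite (hullC y2); exact: df.
move=> df; have := @goursat_box f x1 y1 (x2 - x1) (y2 - y1) cf.
rewrite !subr_ge0 => /(_ xx yy); rewrite ![_ + (_ - _)]addrC !subrK; apply.
by move=> s t; rewrite -!hull_le//; exact: df.
Qed.

(* Cutting off a small rectangle at the exceptional corner leaves two rectangles on
   which the integral vanishes. *)
Lemma goursat_corner f x1 x2 y1 y2 : continuous f ->
  (forall s t, hull x1 x2 s -> hull y1 y2 t -> (s, t) != (x1, y1) ->
     exists l, cder f (pt s t) l) ->
  rect_int f x1 x2 y1 y2 = 0.
Proof.
move=> cf df.
have [xx|xx] := eqVneq x1 x2.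
  rewrite xx; apply: (@addrI _ (rect_int f x2 x2 y1 y2)).
  by rewrite rect_int_chaslesx addr0.
have [yy|yy] := eqVneq y1 y2.
  rewrite yy; apply: (@addrI _ (rect_int f x1 x2 y2 y2)).
  by rewrite rect_int_chaslesy addr0.
pose N := `|x1| + `|x2| + `|y1| + `|y2|.
have hullN a b x : hull a b x -> `|x| <= `|a| + `|b|.
  rewrite /hull => /andP[x0 x3]; rewrite ler_norml.
  have := ler_norm a; have := ler_norm b.
  have := lerNnormlW (lexx `|a|); have := lerNnormlW (lexx `|b|).
  have := normr_ge0 a; have := normr_ge0 b.
  move: x0 x3; rewrite ge_min le_max => /orP[] ? /orP[] ?; lra.
have [z0 _ zB] : exists2 z, cdisc 0 N z & forall u, cdisc 0 N u -> md (f u) <= md (f z).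
  apply: (@compact_max _ _ (fun z => md (f z))); first exact: compact_cdisc.
    by exists (0 : C); rewrite /cdisc /mkset subrr modulus0 /N !addr_ge0.
  move=> z _; apply: continuous_comp; [exact: cf|exact: continuous_modulus].
pose B := md (f z0).
have fB s t : hull x1 x2 s -> hull y1 y2 t -> md (f (pt s t)) <= B.
  move=> /hullN hs /hullN ht; apply: zB; rewrite /cdisc /mkset subr0.
  by rewrite (le_trans (modulus_pt _ _))// /N -!addrA addrA lerD.
apply/eqP; rewrite -modulus_eq0 eq_le modulus_ge0 andbT.
apply/ler_addgt0Pr => e e0; rewrite add0r.
pose K := 4 * B * (`|x2 - x1| + `|y2 - y1|) + 1.
have K0 : 0 < K by rewrite ltr_wpDl// !mulr_ge0// ?modulus_ge0// addr_ge0.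
pose d := Num.min 1 (e / K).
have d0 : 0 < d by rewrite lt_min ltr01 divr_gt0.
have d1 : d <= 1 by rewrite ge_min lexx.
have dK : d * K <= e by rewrite -ler_pdivlMr// ge_min lexx orbT.
have hullm a b : hull a b (a + d * (b - a)).
  rewrite /hull ge_min le_max; case/orP: (le_total a b) => ab; apply/andP; split;
  apply/orP; [left|right|right|left]; nra.
have mid a b s : a != b -> hull (a + d * (b - a)) b s -> s != a.
  move=> ab; rewrite /hull => /andP[s1 s2]; apply/negP => /eqP sa.
  move: s1 s2; rewrite sa ge_min le_max.
  have : d * (b - a) != 0.
    by apply: mulf_neq0; [rewrite gt_eqF|rewrite subr_eq0 eq_sym].
  case: (ltgtP a b) ab => // ab _ dn; nra.
set x' := x1 + d * (x2 - x1); set y' := y1 + d * (y2 - y1).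
have hx' : hull x1 x2 x' by exact: hullm.
have hy' : hull y1 y2 y' by exact: hullm.
rewrite -(rect_int_chaslesx f x1 x' x2).
rewrite (_ : rect_int f x' x2 y1 y2 = 0); last first.
  apply: goursat_hull => // s t hs ht; apply: df => //.
    by apply: hull_sub hs; [|exact: hull_r].
  by apply/eqP => -[E _]; move: (mid _ _ _ xx hs); rewrite E eqxx.
rewrite addr0 -(rect_int_chaslesy f _ _ y1 y' y2).
rewrite (_ : rect_int f x1 x' y' y2 = 0); last first.
  apply: goursat_hull => // s t hs ht; apply: df => //.
  - by apply: hull_sub hs; [exact: hull_l|].
  - by apply: hull_sub ht; [|exact: hull_r].
  by apply/eqP => -[_ E]; move: (mid _ _ _ yy ht); rewrite E eqxx.
rewrite addr0 (le_trans (@rect_int_bound f x1 x' y1 y' B cf _))//.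
  move=> s t hs ht; apply: fB.
    by apply: hull_sub hs; [exact: hull_l|].
  by apply: hull_sub ht; [exact: hull_l|].
rewrite /x' /y' ![_ + d * _ - _]addrC !addKr !normrM (gtr0_norm d0) -mulrDr.
apply: le_trans dK; rewrite mulrCA ler_wpM2l ?(ltW d0)// lerDl//.
Qed.

(** The lines through the exceptional point cut the rectangle into four that have it as a corner.
    The exception is what lets the theorem apply to a difference quotient, known to be only
    continuous at its centre. *)
Theorem goursat f x1 x2 y1 y2 a b : continuous f ->
  hull x1 x2 a -> hull y1 y2 b ->
  (forall s t, hull x1 x2 s -> hull y1 y2 t -> (s, t) != (a, b) ->
     exists l, cder f (pt s t) l) ->
  rect_int f x1 x2 y1 y2 = 0.
Proof.
move=> cf ha hb df.
have Z x y : hull x1 x2 x -> hull y1 y2 y -> rect_int f a x b y = 0.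
  move=> hx hy; apply: goursat_corner => // s t hs ht; apply: df.
    exact: hull_sub hs.
  exact: hull_sub ht.
rewrite -(rect_int_chaslesx f x1 a x2) -!(rect_int_chaslesy f _ _ y1 b y2).
rewrite !(rect_int_revx _ a x1) !(rect_int_revy _ _ _ b y1).
by rewrite !Z ?oppr0 ?addr0//; (exact: hull_l || exact: hull_r).
Qed.

End Goursat.

(** * Cauchy's formula and the maximum principle *)

Section CauchySquare.
Variable R : realType.
Local Notation C := (Cplx R).
Local Notation md := (@modulus R).
Implicit Types (f g phi : C -> C) (z : C).

Lemma Re_cint (g : R -> C) a b :
  complex.Re (cint g a b) = rint (fun t => complex.Re (g t)) a b.
Proof. by rewrite /cint ReD ReM /=; ring. Qed.

Lemma Im_cint (g : R -> C) a b :
  complex.Im (cint g a b) = rint (fun t => complex.Im (g t)) a b.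
Proof. by rewrite /cint ImD ImM /=; ring. Qed.

Variable a : R.
Hypothesis a0 : 0 < a.

(** Continuity is asked only along the four lines carrying the sides, because the Cauchy kernel has
    its pole inside the square. *)
Definition square_continuous phi := forall s : R, `|s| = a ->
  continuous (fun t : R => phi (pt t s)) /\ continuous (fun t : R => phi (pt s t)).

Definition square_int phi := rect_int phi (- a) a (- a) a.

Let na : `|- a| = a. Proof. by rewrite normrN gtr0_norm. Qed.
Let pa : `|a| = a. Proof. by rewrite gtr0_norm. Qed.

Lemma continuous_square phi : continuous phi -> square_continuous phi.
Proof.
by move=> c s _; split; [exact: continuous_hline|exact: continuous_vline].
Qed.

Lemma square_intD f g : square_continuous f -> square_continuous g ->
  square_int (fun z => f z + g z) = square_int f + square_int g.
Proof.
move=> cf cg.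
have H s : `|s| = a -> hside (fun z => f z + g z) s (- a) a =
    hside f s (- a) a + hside g s (- a) a.
  by move=> sa; exact: cintD (cf s sa).1 (cg s sa).1.
have V s : `|s| = a -> vside (fun z => f z + g z) s (- a) a =
    vside f s (- a) a + vside g s (- a) a.
  by move=> sa; rewrite /vside -mulrDr; congr (_ * _); exact: cintD (cf s sa).2 (cg s sa).2.
by rewrite /square_int /rect_int !H// !V//; ring.
Qed.

Lemma square_intZ k f : square_continuous f -> square_int (fun z => k * f z) = k * square_int f.
Proof.
move=> cf.
have H s : `|s| = a -> hside (fun z => k * f z) s (- a) a = k * hside f s (- a) a.
  by move=> sa; exact: cintZ (cf s sa).1.
have V s : `|s| = a -> vside (fun z => k * f z) s (- a) a = k * vside f s (- a) a.
  by move=> sa; rewrite /vside mulrCA; congr (_ * _); exact: cintZ (cf s sa).2.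
by rewrite /square_int /rect_int !H// !V//; ring.
Qed.

Lemma square_continuousD f g : square_continuous f -> square_continuous g -> square_continuous
  (fun z => f z + g z).
Proof.
move=> cf cg s sa; have [f1 f2] := cf s sa; have [g1 g2] := cg s sa.
by split=> t; apply: cvgD; [exact: f1|exact: g1|exact: f2|exact: g2].
Qed.

Lemma square_continuousM f g : square_continuous f -> square_continuous g -> square_continuous
  (fun z => f z * g z).
Proof.
move=> cf cg s sa; have [f1 f2] := cf s sa; have [g1 g2] := cg s sa.
by split=> t; apply: cvgM; [exact: f1|exact: g1|exact: f2|exact: g2].
Qed.

Definition on_square (z : C) := exists s t : R, [/\ `|s| = a, `|t| <= a & z = pt s t \/ z = pt
  t s].

Lemma square_int_bound f B : square_continuous f -> (forall z, on_square z -> md (f z) <= B) ->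
  md (square_int f) <= 16 * B * a.
Proof.
move=> cf fB.
have H s : `|s| = a -> md (hside f s (- a) a) <= 2 * B * `|a - - a|.
  move=> sa; apply: cint_bound; first exact: (cf s sa).1.
  move=> t; rewrite -/(hull _ _ _) hull_le ?ge0_cp ?(ltW a0)// -ler_norml => ta.
  by apply: fB; exists s, t; split=> //; right.
have V s : `|s| = a -> md (vside f s (- a) a) <= 2 * B * `|a - - a|.
  move=> sa; rewrite /vside modulusM modulusi mul1r.
  apply: cint_bound; first exact: (cf s sa).2.
  move=> t; rewrite -/(hull _ _ _) hull_le ?ge0_cp ?(ltW a0)// -ler_norml => ta.
  by apply: fB; exists s, t; split=> //; left.
have := H _ na; have := H _ pa; have := V _ na; have := V _ pa.
rewrite opprK ger0_norm ?addr_ge0 ?(ltW a0)// /square_int /rect_int.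
set u1 := hside _ _ _ _; set u2 := hside _ _ _ _.
set v1 := vside _ _ _ _; set v2 := vside _ _ _ _.
have := modulusD (u2 - u1) (v1 - v2); have := modulusD u2 (- u1).
have := modulusD v1 (- v2); rewrite !modulusN; lra.
Qed.

Lemma on_square_modulus z : on_square z -> a <= md z.
Proof.
move=> [s [t [sa _ [->|->]]]]; rewrite -sa.
  by rewrite -{1}(Re_pt s t) modulus_Re.
by rewrite -{1}(Im_pt t s) modulus_Im.
Qed.

Lemma line_modulus (s t : R) : `|s| = a -> a <= md (pt s t) /\ a <= md (pt t s).
Proof.
move=> sa; rewrite -sa; split.
  by rewrite -{1}(Re_pt s t) modulus_Re.
by rewrite -{1}(Im_pt t s) modulus_Im.
Qed.

Lemma square_continuous_kernel k z : md z < a -> square_continuous (fun w => (w - z)^-1 ^+ k).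
Proof.
move=> za.
have H w : a <= md w -> {for w, continuous (fun w : C => (w - z)^-1 ^+ k)}.
  move=> aw; have wz0 : w - z != 0.
    by rewrite subr_eq0; apply/eqP => E; move: aw; rewrite E leNgt za.
  have := cderX k (cderV (cderB (cder_id w) (cder_cst z w)) wz0).
  exact: cder_continuous.
have cid : continuous (@id C) by move=> x; exact: cvg_id.
move=> s /line_modulus sa; split=> t.
  apply: (@continuous_comp _ _ _ (fun t : R => pt t s) (fun w : C => (w - z)^-1 ^+ k)).
    exact: (@continuous_hline _ id s cid).
  by apply: H; exact: (sa t).2.
apply: (@continuous_comp _ _ _ (fun t : R => pt s t) (fun w : C => (w - z)^-1 ^+ k)).
  exact: (@continuous_vline _ id s cid).
by apply: H; exact: (sa t).1.
Qed.

(** Not normalized: the value [cauchy (fun=> 1) 1] stands in for [2 pi i], and it is enough to know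
    that it does not vanish at 0. *)
Definition cauchy phi k z := square_int (fun w => phi w * (w - z)^-1 ^+ k).

(** Differentiation under the integral sign. The constant [L] controls the second-order remainder of
    [u^-k] and is used with [u - z] for [u] and [w - z] for [h]. *)
Lemma cauchy_cder_bound phi k B (L : R) z : square_continuous phi ->
  (forall w, on_square w -> md (phi w) <= B) -> md z < a / 2 -> 0 < L ->
  (forall u h, a / 2 <= md u -> md h < a / 4 ->
     md ((u - h)^-1 ^+ k - u^-1 ^+ k - h * (k%:R * u^-1 ^+ k.+1)) <= L * md h ^+ 2) ->
  cder (cauchy phi k) z (k%:R * cauchy phi k.+1 z).
Proof.
move=> cphi phiB za L0 H e e0.
have a4 : 0 < a / 4 by rewrite divr_gt0.
have z1 : md z < a by have := a0; lra.
pose K := 16 * (`|B| * L) * a + 1.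
have K0 : 0 < K by rewrite ltr_wpDl// !mulr_ge0// ltW.
exists (Num.min (a / 4) (e / K)); first by rewrite lt_min a4 divr_gt0.
move=> w; rewrite lt_min => /andP[wa we].
have w1 : md w < a.
  by rewrite -(subrK z w) (le_lt_trans (modulusD _ _))//; have := a0; lra.
have ck := square_continuous_kernel.
have cc j v : md v < a -> square_continuous (fun u => phi u * (u - v)^-1 ^+ j).
  by move=> va; exact: (square_continuousM cphi (ck j v va)).
have cz (x : C) g : square_continuous g -> square_continuous (fun u => x * g u).
  by move=> cg; exact: (square_continuousM (continuous_square (@cst_continuous _ _ x)) cg).
have E : cauchy phi k w - cauchy phi k z - k%:R * cauchy phi k.+1 z * (w - z) =
  square_int (fun u => phi u * (u - w)^-1 ^+ k + ((-1) * (phi u * (u - z)^-1 ^+ k) +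
     (- (k%:R * (w - z))) * (phi u * (u - z)^-1 ^+ k.+1))).
  rewrite square_intD; [|exact: cc|by apply: square_continuousD; apply: cz; exact: cc].
  rewrite square_intD; [|by apply: cz; exact: cc|by apply: cz; exact: cc].
  rewrite !square_intZ; [|exact: cc|exact: cc].
  rewrite -/(cauchy phi k w) -/(cauchy phi k z) -/(cauchy phi k.+1 z).
  by move: (cauchy phi k w) (cauchy phi k z) (cauchy phi k.+1 z) => p q r; ring.
rewrite E; apply: (@le_trans _ _ (16 * (`|B| * (L * md (w - z) ^+ 2)) * a)).
apply: square_int_bound.
- by apply: square_continuousD; [exact: cc|apply: square_continuousD; apply: cz; exact: cc].
- move=> u bu.
  have uz : a / 2 <= md (u - z).
    have := on_square_modulus bu; have := modulus_leB u z; lra.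
  have := H _ _ uz wa; rewrite opprB addrA subrK => H'.
  rewrite (_ : _ + _ = phi u * ((u - w)^-1 ^+ k - (u - z)^-1 ^+ k - (w - z) * (k%:R * (u -
    z)^-1 ^+ k.+1))); last by ring.
  rewrite modulusM ler_pM ?modulus_ge0//.
  exact: le_trans (phiB _ bu) (ler_norm _).
rewrite expr2 (_ : 16 * _ * a = (16 * (`|B| * L) * a) * md (w - z) * md (w - z)); last by ring.
rewrite ler_wpM2r ?modulus_ge0// (@le_trans _ _ (K * md (w - z)))//.
  by rewrite ler_wpM2r ?modulus_ge0// lerDl.
by rewrite mulrC -ler_pdivlMr// ltW.
Qed.

(** The cases [k = 1] and [k = 2] are those met in differentiating a quotient of Cauchy integrals
    twice. For them the remainder of the kernel is an explicit rational function with [h ^+ 2] as a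
    factor. *)
Lemma cauchy_cder phi B z : square_continuous phi -> (forall w, on_square w -> md (phi w) <= B) ->
  md z < a / 2 ->
  cder (cauchy phi 1) z (1%:R * cauchy phi 2 z) /\
  cder (cauchy phi 2) z (2%:R * cauchy phi 3 z).
Proof.
move=> cphi phiB za.
have key u h : a / 2 <= md u -> md h < a / 4 ->
    [/\ u != 0, u - h != 0, md u^-1 <= 2 / a & md (u - h)^-1 <= 4 / a].
  move=> ua ha; have u0 : 0 < md u by have := a0; lra.
  have uh : a / 4 <= md (u - h) by have := modulus_leB u h; have := a0; lra.
  have uh0 : 0 < md (u - h) by have := a0; lra.
  rewrite -!modulus_gt0 !modulusV; split=> //.
    by rewrite -[2 / a]invf_div lef_pV2// posrE divr_gt0.
  by rewrite -[4 / a]invf_div lef_pV2// posrE divr_gt0.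
have pos (n : nat) : 0 <= n%:R / a by rewrite divr_ge0 ?ler0n ?(ltW a0).
split.
  apply: (@cauchy_cder_bound _ 1 B ((2 / a) ^+ 2 * (4 / a))) => //.
    by rewrite mulr_gt0 ?exprn_gt0 ?divr_gt0.
  move=> u h ua ha; have [u0 uh0 U UH] := key u h ua ha.
  rewrite (_ : _ - _ - _ = (u^-1 ^+ 2 * (u - h)^-1) * h ^+ 2); last first.
    by field; rewrite u0 uh0.
  rewrite 2!modulusM !modulusX ler_wpM2r ?exprn_ge0 ?modulus_ge0//.
  by rewrite ler_pM ?exprn_ge0 ?modulus_ge0// lerXn2r ?nnegrE ?modulus_ge0 ?(pos 2%N).
refine (@cauchy_cder_bound phi 2%N B (7 * (2 / a) ^+ 2 * (4 / a) ^+ 2) z cphi phiB za _ _).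
  have p2 : 0 < 2 / a by rewrite divr_gt0.
  have p4 : 0 < 4 / a by rewrite divr_gt0.
  by rewrite mulr_gt0 ?exprn_gt0// mulr_gt0// exprn_gt0.
move=> u h ua ha; have [u0 uh0 U UH] := key u h ua ha.
rewrite (_ : _ - _ - _ = ((3 - 2 * h * u^-1) * u^-1 ^+ 2 * (u - h)^-1 ^+ 2) * h ^+ 2); last first.
  by field; rewrite u0 uh0.
rewrite 3!modulusM !modulusX ler_wpM2r ?exprn_ge0 ?modulus_ge0//.
have X1 : md u^-1 ^+ 2 <= (2 / a) ^+ 2.
  by rewrite lerXn2r ?nnegrE ?modulus_ge0.
have X2 : md (u - h)^-1 ^+ 2 <= (4 / a) ^+ 2.
  by rewrite lerXn2r ?nnegrE ?modulus_ge0.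
have m2 n : md n%:R = n%:R.
  by rewrite -(rmorph_nat (real_complex R)) modulus_toC ger0_norm.
have X3 : md (3 - 2 * h * u^-1) <= 7.
  rewrite (le_trans (modulusD _ _))// modulusN !modulusM !m2 modulusV.
  have : md h * (md u)^-1 <= 1.
    rewrite ler_pdivrMr ?modulus_gt0// mul1r; have := a0; lra.
  rewrite -mulrA; lra.
rewrite ler_pM ?mulr_ge0 ?exprn_ge0 ?modulus_ge0//.
by rewrite ler_pM ?exprn_ge0 ?modulus_ge0.
Qed.

(* On each side of the square the imaginary part of [dw / w] is positive. *)
Lemma cauchy1_neq0 : cauchy (fun=> 1) 1 0 != 0.
Proof.
have E : cauchy (fun=> 1) 1 0 = square_int (fun w => w^-1).
  by congr square_int; apply/funext => w; rewrite mul1r subr0 expr1.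
have c1 : square_continuous (fun w => w^-1).
  have := @square_continuous_kernel 1 0; rewrite modulus0 => /(_ a0).
  by under eq_fun do rewrite expr1 subr0.
have Iinv (s t : R) : `|s| = a ->
   complex.Im (pt t s)^-1 = - s / (t ^+ 2 + a ^+ 2) /\
   complex.Re (pt s t)^-1 = s / (t ^+ 2 + a ^+ 2).
  move=> sa; have E2 : a ^+ 2 = s ^+ 2 by rewrite -sa real_normK ?num_real.
  rewrite E2; split.
    have -> : pt t s = Complex t s by apply: complex_eq; rewrite ?Re_pt ?Im_pt.
    by rewrite /= mulNr.
  have -> : pt s t = Complex s t by apply: complex_eq; rewrite ?Re_pt ?Im_pt.
  by rewrite /= [in RHS]addrC.
have aa : - a <= a by have := a0; lra.
have dpos (t : R) : 0 < t ^+ 2 + a ^+ 2.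
  by rewrite ltr_wpDl ?sqr_ge0// exprn_gt0.
have cI s : `|s| = a -> continuous (fun t => complex.Im (pt t s)^-1).
  by move=> sa t; exact: (@continuous_comp _ _ _ (fun t : R => (pt t s)^-1) (@complex.Im R : C
    -> R) t ((c1 s sa).1 t) (@continuous_Im R _)).
have cR s : `|s| = a -> continuous (fun t => complex.Re (pt s t)^-1).
  by move=> sa t; exact: (@continuous_comp _ _ _ (fun t : R => (pt s t)^-1) (@complex.Re R : C
    -> R) t ((c1 s sa).2 t) (@continuous_Re R _)).
have I2 (z : C) : complex.Im ('i%C * z) = complex.Re z by rewrite ImM /=; ring.
have : 0 < complex.Im (square_int (fun w => w^-1)).
  have EH s : complex.Im (hside (fun w : C => w^-1) s (- a) a) =
      rint (fun t => complex.Im (pt t s)^-1) (- a) a by exact: Im_cint.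
  have EV s : complex.Im (vside (fun w : C => w^-1) s (- a) a) =
      rint (fun t => complex.Re (pt s t)^-1) (- a) a by rewrite I2; exact: Re_cint.
  rewrite /square_int /rect_int.
  move: (EH (- a)) (EH a) (EV (- a)) (EV a).
  move: (hside _ (- a) _ _) (hside _ a _ _) (vside _ (- a) _ _) (vside _ a _ _).
  move=> h1 h2 v1 v2 e1 e2 e3 e4; rewrite !ImD !ImN e1 e2 e3 e4.
  have [c1' _ ->] := rint_MVT (cI _ na) aa.
  have [c2 _ ->] := rint_MVT (cI _ pa) aa.
  have [c3 _ ->] := rint_MVT (cR _ na) aa.
  have [c4 _ ->] := rint_MVT (cR _ pa) aa.
  rewrite !(proj1 (Iinv _ _ na)) !(proj1 (Iinv _ _ pa)).
  rewrite !(proj2 (Iinv _ _ na)) !(proj2 (Iinv _ _ pa)) !opprK !mulNr !opprK.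
  have q (t : R) : 0 < a / (t ^+ 2 + a ^+ 2) * (a + a).
    by apply: mulr_gt0; [exact: divr_gt0|exact: addr_gt0].
  by rewrite addr_gt0 ?addr_gt0.
by rewrite E; apply: contraTneq => ->; rewrite ltxx.
Qed.

End CauchySquare.

(** * The derivative of a holomorphic function is holomorphic *)

Section DerivativeHolo.
Variable R : realType.
Local Notation C := (Cplx R).
Local Notation md := (@modulus R).
Implicit Types (f g : C -> C) (z w c : C) (r : R).

Lemma cder_shift f c z l :
  cder f (c + z) l <-> cder (fun w => f (c + w)) z l.
Proof.
split=> H e /H[d d0 dH]; exists d => // w wz.
  have := dH (c + w); rewrite (_ : c + w - (c + z) = w - z); last by ring.
  by apply.
have := dH (w - c); rewrite (_ : w - c - z = w - (c + z)); last by ring.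
by rewrite (_ : c + (w - c) = w); [exact|ring].
Qed.

(* Retraction onto the closed disc of radius [p]: composing with it makes a
   function holomorphic on a disc globally continuous. *)
Definition clamp (p : R) z : C := toC (p / Num.max p (md z)) * z.

Lemma clamp_id p z : md z <= p -> 0 < p -> clamp p z = z.
Proof. by move=> zp p0; rewrite /clamp max_l// divff ?gt_eqF// /toC rmorph1 mul1r. Qed.

Lemma clamp_le p z : 0 < p -> md (clamp p z) <= p.
Proof.
move=> p0; have m0 : 0 < Num.max p (md z) by rewrite lt_max p0.
have [p1 m1] := (ltW p0, ltW m0).
rewrite /clamp modulusM modulus_toC ger0_norm ?divr_ge0//.
by rewrite mulrAC ler_pdivrMr// ler_wpM2l// le_max lexx orbT.
Qed.

Lemma continuous_clamp p : 0 < p -> continuous (clamp p).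
Proof.
move=> p0 z; have m0 : 0 < Num.max p (md z) by rewrite lt_max p0.
apply: (@continuousM _ _ (fun z : C => toC (p / Num.max p (md z))) id); last exact: cvg_id.
apply: (@continuous_comp _ _ _ (fun z : C => p / Num.max p (md z)) (@toC R));
  last exact: continuous_toC.
apply: (@continuousM _ _ (fun z : C => p) (fun z : C => (Num.max p (md z))^-1)).
  exact: cst_continuous.
apply: continuousV; first by rewrite gt_eqF.
by apply: (@continuous_max _ _ (fun z : C => p) md); [exact: cst_continuous|exact:
  continuous_modulus].
Qed.

Lemma holo_extend f c r p : 0 < p -> p < r -> holo (disc c r) f ->
  exists2 g, continuous g & forall z, md (z - c) <= p -> g z = f z.
Proof.
move=> p0 pr hf; exists (fun z => f (c + clamp p (z - c))); last first.
  by move=> z zp; rewrite clamp_id// addrC subrK.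
move=> z; apply: (@continuous_comp _ _ _ (fun z => c + clamp p (z - c)) f).
  apply: (@continuousD _ _ _ (fun=> c) (fun z => clamp p (z - c))); first exact: cst_continuous.
  apply: (@continuous_comp _ _ _ (fun z => z - c) (clamp p)); last exact: continuous_clamp.
  by have /cder_continuous := cderB (cder_id z) (cder_cst c z).
have [|l /cder_continuous//] := hf (c + clamp p (z - c)).
by rewrite /disc /mkset addrC addKr (le_lt_trans (clamp_le _ p0)).
Qed.

(** With [l] the derivative at [z], this is the holomorphic cofactor by which zeros are divided
    out. *)
Definition dquot f z l w : C := if w == z then l else (f w - f z) / (w - z).

Lemma dquot_neq f z l w : w != z -> dquot f z l w = (f w - f z) / (w - z).
Proof. by rewrite /dquot => /negPf->. Qed.

Lemma dquotE f z l w : f w = f z + (w - z) * dquot f z l w.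
Proof.
rewrite /dquot; case: eqVneq => [->|wz]; first by rewrite subrr mul0r addr0.
by field; rewrite subr_eq0.
Qed.

Lemma cder_dquot_neq f z l w k : w != z -> cder f w k ->
  cder (dquot f z l) w (((k - 0) * (w - z) - (f w - f z) * (1 - 0)) / (w - z) ^+ 2).
Proof.
move=> wz fw; have wz0 : w - z != 0 by rewrite subr_eq0.
have := cder_div (cderB fw (cder_cst (f z) w)) (cderB (cder_id w) (cder_cst z w)) wz0.
apply: (@cder_near _ _ _ _ _ (md (w - z))); first by rewrite modulus_gt0.
move=> u uw; rewrite dquot_neq//; apply: contraTneq uw => ->.
by rewrite modulusBC ltxx.
Qed.

Lemma continuous_dquot_center f z l : cder f z l -> {for z, continuous (dquot f z l)}.
Proof.
move=> H; apply/continuous_modulusP => e e0.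
have [d d0 dH] := H _ (divr_gt0 e0 (ltr0Sn _ 1)).
exists d => // w wz; rewrite {2}/dquot eqxx.
have [->|wNz] := eqVneq w z; first by rewrite /dquot eqxx subrr modulus0.
rewrite dquot_neq//; have m0 : 0 < md (w - z) by rewrite modulus_gt0 subr_eq0.
rewrite (_ : _ - l = (f w - f z - l * (w - z)) / (w - z)); last first.
  by field; rewrite subr_eq0.
rewrite modulusM modulusV ltr_pdivrMr// (le_lt_trans (dH _ wz))//.
by rewrite ltr_pM2r// ltr_pdivrMr// ltr_pMr// ltr1n.
Qed.

Lemma continuous_dquot f z l : continuous f -> cder f z l -> continuous (dquot f z l).
Proof.
move=> cf fz w; have [->|wz] := eqVneq w z; first exact: continuous_dquot_center.
have wz0 : w - z != 0 by rewrite subr_eq0.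
have /continuous_modulusP K : {for w, continuous (fun u => (f u - f z) * (u - z)^-1)}.
  apply: (@continuousM _ _ (fun u => f u - f z) (fun u => (u - z)^-1)).
    by apply: (@continuousB _ _ _ f (fun=> f z)); [exact: cf|exact: cst_continuous].
  by have /cder_continuous := cderV (cderB (cder_id w) (cder_cst z w)) wz0.
apply/continuous_modulusP => e /K[d d0 dK].
exists (Num.min d (md (w - z))); first by rewrite lt_min d0 modulus_gt0.
move=> u; rewrite lt_min => /andP[ud uw].
rewrite !dquot_neq//; first exact: dK.
by apply: contraTneq uw => ->; rewrite modulusBC ltxx.
Qed.

(* With [W z] the integral of [dw / (w - z)] round a square, [g z * W z] is a Cauchy
   integral and [W 0 != 0], so [g] is a quotient of twice differentiable functions. *)
Lemma cderive_cder0 f r : 0 < r -> holo (disc 0 r) f -> exists l, cder (cderive f) 0 l.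
Proof.
move=> r0 hf; pose p := r / 2.
have p0 : 0 < p by rewrite divr_gt0.
have pr : p < r by rewrite ltr_pdivrMr// ltr_pMr// ltr1n.
have [g cg gf] := holo_extend p0 pr hf.
have {}gf z : md z <= p -> g z = f z by move=> zp; apply: gf; rewrite subr0.
have hg z : md z < p -> cder g z (cderive f z).
  move=> zp; have [|l fl] := hf z; first by rewrite /disc /mkset subr0 (lt_trans zp).
  have p1 : 0 < p - md z by rewrite subr_gt0.
  apply: (cder_near p1) (cderiveP (ex_intro _ l fl)) => w wz.
  rewrite gf// -(subrK z w) (le_trans (modulusD _ _))//; lra.
(* Points of the square have modulus at most [2 * a], which is less than [p]. *)
pose a := p / 4; have a0 : 0 < a by rewrite divr_gt0.
have [z0 _ zB] : exists2 z, cdisc 0 p z & forall u, cdisc 0 p u -> md (g u) <= md (g z).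
  apply: (@compact_max _ _ (fun z => md (g z))); first exact: compact_cdisc.
    by exists (0 : C); rewrite /cdisc /mkset subrr modulus0 ltW.
  by move=> z _; apply: continuous_comp; [exact: cg|exact: continuous_modulus].
have bdp z : on_square a z -> md z < p.
  move=> [s [t [sa ta zE]]]; have : md z <= `|s| + `|t|.
    by case: zE => ->; [|rewrite addrC]; exact: modulus_pt.
  rewrite sa /a in ta *; have := p0; lra.
have bg z : on_square a z -> md (g z) <= md (g z0).
  by move=> /bdp zp; apply: zB; rewrite /cdisc /mkset subr0 ltW.
have b1 z : on_square a z -> md ((fun=> 1 : C) z) <= 1 by rewrite modulus1.
have cg' : square_continuous a g := continuous_square cg.
have c1 : square_continuous a (fun=> 1) by apply: continuous_square; exact: cst_continuous.
pose N := cauchy a g; pose W := cauchy a (fun=> 1).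
have NE z : md z < a / 2 -> g z * W 1%N z = N 1%N z.
  move=> za; have zp : md z < p by rewrite /a in za; have := p0; lra.
  have za1 : md z < a by have := a0; lra.
  have ck := square_continuous_kernel 1 za1.
  (* Goursat's theorem with exceptional point [z]; splitting the quotient into its two terms gives
     Cauchy's formula without its constant. *)
  have : square_int a (dquot g z (cderive f z)) = 0.
    apply: (@goursat _ _ _ _ _ _ (complex.Re z) (complex.Im z)).
    - exact: continuous_dquot (hg z zp).
    - rewrite hull_le; last by have := a0; lra.
      by rewrite -ler_norml (le_trans (modulus_Re _))// ltW.
    - rewrite hull_le; last by have := a0; lra.
      by rewrite -ler_norml (le_trans (modulus_Im _))// ltW.
    move=> s t; rewrite !hull_le; [|by have := a0; lra|by have := a0; lra].
    rewrite -!ler_norml => sa ta stz; eexists; apply: cder_dquot_neq.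
      apply: contraNneq stz => <-; by rewrite Re_pt Im_pt.
    apply: hg; rewrite (le_lt_trans (modulus_pt _ _))//.
    by rewrite /a in sa ta; have := p0; lra.
  have -> : square_int a (dquot g z (cderive f z)) =
     square_int a (fun w => g w * (w - z)^-1 ^+ 1 + (- g z) * (1 * (w - z)^-1 ^+ 1)).
    have E w : a <= md w -> dquot g z (cderive f z) w =
        g w * (w - z)^-1 ^+ 1 + (- g z) * (1 * (w - z)^-1 ^+ 1).
      move=> aw; rewrite dquot_neq; first by rewrite expr1; ring.
      by apply: contraTneq aw => ->; rewrite -ltNge.
    have lm := line_modulus.
    rewrite /square_int /rect_int /hside /vside.
    have na : `|- a| = a by rewrite normrN gtr0_norm.
    have pa : `|a| = a by rewrite gtr0_norm.
    do 2 congr (_ + _); [|congr (- _)| congr (_ * _)|congr (- (_ * _))];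
      congr cint; apply/funext => t; apply: E;
      by [case: (lm _ a (- a) t na)|case: (lm _ a a t pa)].
  have cz : square_continuous a (fun w => (- g z) * (1 * (w - z)^-1 ^+ 1)).
    apply: (@square_continuousM _ _ (fun=> - g z)).
      by apply: continuous_square; exact: cst_continuous.
    exact: (square_continuousM c1 ck).
  rewrite (square_intD a0 (square_continuousM cg' ck) cz) (square_intZ a0 _ (square_continuousM
    c1 ck)).
  rewrite -/(cauchy a g 1 z) -/(cauchy a (fun=> 1) 1 z) -/N -/W => /eqP.
  by rewrite mulNr => /eqP/subr0_eq E; rewrite E.
have a2 : 0 < a / 2 by rewrite divr_gt0.
have W0 : W 1%N 0 != 0 by exact: cauchy1_neq0.
have dN z : md z < a / 2 -> _ := cauchy_cder a0 cg' bg.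
have dW z : md z < a / 2 -> _ := cauchy_cder a0 c1 b1.
have z0a : md (0 : C) < a / 2 by rewrite modulus0.
have /cder_continuous/continuous_modulusP cW := (dW 0 z0a).1.
have [d d0 dWn] : exists2 d, 0 < d & forall z, md z < d -> W 1%N z != 0.
  have [|d d0 dH] := cW (md (W 1%N 0)); first by rewrite modulus_gt0.
  exists d => // z zd.
  have : md (W 1%N z - W 1%N 0) < md (W 1%N 0) by apply: dH; rewrite subr0.
  by apply: contraTneq => ->; rewrite sub0r modulusN ltxx.
(* The quotient rule for [N 1 / W 1]; it equals the derivative of [f] near 0 and can itself be
   differentiated there. *)
pose G z := (1%:R * N 2%N z * W 1%N z - N 1%N z * (1%:R * W 2%N z)) / W 1%N z ^+ 2.
have E z : md z < Num.min d (a / 2) -> cderive f z = G z.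
  rewrite lt_min => /andP[zd za].
  have zp : md z < p by rewrite /a in za; have := p0; lra.
  have q0 : 0 < a / 2 - md z by rewrite subr_gt0.
  have q1 : 0 < Num.min (a / 2 - md z) (d - md z) by rewrite lt_min q0 subr_gt0.
  apply: cder_unique (hg z zp) _.
  apply: (cder_near q1 _ (cder_div (dN z za).1 (dW z za).1 (dWn z zd))).
  move=> w; rewrite lt_min => /andP[wa wd].
  have wz := modulusD (w - z) z; rewrite subrK in wz.
  have wa' : md w < a / 2 by lra.
  have wd' : md w < d by lra.
  by rewrite -/N -/W -NE// mulfK// dWn.
have m0 : 0 < Num.min d (a / 2) by rewrite lt_min d0.
eexists; apply: (cder_near m0 (f := G)).
  by move=> w; rewrite subr0 => /E.
apply: cder_div.
- apply: cderB.
    by apply: cderM; [apply: cderZ; exact: (dN 0 z0a).2|exact: (dW 0 z0a).1].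
  by apply: cderM; [exact: (dN 0 z0a).1|apply: cderZ; exact: (dW 0 z0a).2].
- exact: cderX (dW 0 z0a).1.
- by rewrite expf_neq0.
Qed.

Theorem cderive_holo f c r : holo (disc c r) f -> holo (disc c r) (cderive f).
Proof.
move=> hf z zc; have d0 : 0 < r - md (z - c) by rewrite subr_gt0.
have [|l] := @cderive_cder0 (fun w => f (z + w)) _ d0.
  move=> w; rewrite /disc /mkset subr0 => wd.
  have [|l fl] := hf (z + w).
    rewrite /disc /mkset (_ : _ - c = (z - c) + w); last by ring.
    by rewrite (le_lt_trans (modulusD _ _))//; lra.
  by exists l; apply/cder_shift.
move=> H; exists l; rewrite -(addr0 z); apply/cder_shift.
apply: (cder_near d0 _ H) => w; rewrite subr0 => wd.
apply: cderiveE; apply/cder_shift; apply: cderiveP; apply: hf.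
rewrite /disc /mkset (_ : _ - c = (z - c) + w); last by ring.
by rewrite (le_lt_trans (modulusD _ _))//; lra.
Qed.

End DerivativeHolo.

(** * The maximum principle, existence of zeros and Cauchy's estimate *)

Section MaximumPrinciple.
Variable R : realType.
Local Notation C := (Cplx R).
Local Notation md := (@modulus R).
Implicit Types (f g : C -> C) (z w c : C) (r : R).

Lemma disc_sub z w r s : md (w - z) + s <= r -> disc w s `<=` disc z r.
Proof.
move=> H u; rewrite /disc /mkset => us.
by have := modulusB_triangle w u z; lra.
Qed.

Lemma modulus_unit t : 0 <= t <= 1 -> md (toC t) <= 1.
Proof. by move=> /andP[t0 t1]; rewrite modulus_toC ger0_norm. Qed.

Lemma segment_disc z r t : 0 <= t <= 1 -> forall w u, md (w - z) <= r ->
  md (u - z) <= r -> md (w + toC t * (u - w) - z) <= r.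
Proof.
move=> /andP[t0 t1] w u wr ur.
rewrite (_ : _ - z = toC (1 - t) * (w - z) + toC t * (u - z)); last first.
  by rewrite toCB /toC rmorph1; ring.
rewrite (le_trans (modulusD _ _))// !modulusM !modulus_toC !ger0_norm ?subr_ge0//.
by have := ler_wpM2l t0 ur; have : (1 - t) * md (w - z) <= (1 - t) * r;
  [rewrite ler_wpM2l ?subr_ge0|lra].
Qed.

Lemma segment_disc_lt z r t : 0 <= t <= 1 -> forall w u, md (w - z) < r ->
  md (u - z) < r -> md (w + toC t * (u - w) - z) < r.
Proof.
move=> t01 w u wr ur; apply: (@le_lt_trans _ _ (Num.max (md (w - z)) (md (u - z)))).
  by apply: segment_disc => //; rewrite le_max lexx ?orbT.
by rewrite gt_max wr.
Qed.

(** The remainder vanishes at [z], and its derivative is [o(|w - z|)] because the derivative of [f]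
    is differentiable; the mean value inequality supplies one more factor [|w - z|]. *)
Lemma taylor2 f z r : 0 < r -> holo (disc z r) f -> exists p q : C, p = cderive f z /\
  forall e, 0 < e -> exists2 d, 0 < d & forall w, md (w - z) < d ->
    md (f w - (f z + p * (w - z) + q * (w - z) ^+ 2)) <= e * md (w - z) ^+ 2.
Proof.
move=> r0 hf; have hf' := cderive_holo hf.
have [k Hk] := hf' z (disc_center _ r0).
exists (cderive f z), (k / 2); split=> // e e0.
have [d d0 dH] := Hk _ e0.
exists (Num.min d r); first by rewrite lt_min d0.
move=> w; rewrite lt_min => /andP[wd wr].
pose g u := f u - (f z + cderive f z * (u - z) + k / 2 * (u - z) ^+ 2).
have gz : g z = 0 by rewrite /g subrr expr0n /=; ring.
rewrite -/(g w) -[g w]subr0 -gz expr2 mulrA.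
apply: cder_mean_value => t t01.
set u := z + toC t * (w - z).
have uz : md (u - z) <= md (w - z).
  rewrite /u addrAC subrr add0r modulusM -[leRHS]mul1r.
  by rewrite ler_wpM2r ?modulus_ge0// modulus_unit.
exists (cderive f u - (0 + cderive f z * (1 - 0) + k / 2 * (2 * (u - z) * (1 - 0)))).
  apply: cderB; first by apply/cderiveP/hf; exact: le_lt_trans uz wr.
  have dz : cder (fun v => v - z) u (1 - 0) by exact: cderB (cder_id u) (cder_cst z u).
  apply: cderD; first by apply: cderD; [exact: cder_cst|exact: cderZ].
  by apply: cderZ; exact: (cder_comp dz (cder_sqr _)).
rewrite (_ : _ - _ = cderive f u - cderive f z - k * (u - z)); last by field.
rewrite (le_trans (dH _ (le_lt_trans uz wd)))// ler_wpM2l//.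
exact: ltW.
Qed.

(** Dividing the second-order expansion of [f] by [w - z] gives a first-order expansion of the
    quotient, which takes the place of the removable singularity theorem. *)
Lemma cder_dquot f z r : 0 < r -> holo (disc z r) f ->
  exists l, cder (dquot f z (cderive f z)) z l.
Proof.
move=> r0 /(taylor2 r0)[p [q [-> H]]]; exists q => e /H[d d0 dH].
exists d => // w wd; rewrite {2}/dquot eqxx.
have [->|wz] := eqVneq w z.
  by rewrite /dquot eqxx !subrr mulr0 subr0 modulus0 mulr0.
have wz0 : w - z != 0 by rewrite subr_eq0.
have m0 : 0 < md (w - z) by rewrite modulus_gt0.
rewrite dquot_neq// -(ler_pM2r m0) -modulusM -mulrA -expr2.
rewrite (_ : _ * _ = f w - (f z + cderive f z * (w - z) + q * (w - z) ^+ 2)).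
  exact: dH.
by field.
Qed.

Lemma dquot_holo (A : set C) f z r : 0 < r -> disc z r `<=` A -> holo A f ->
  holo A (dquot f z (cderive f z)).
Proof.
move=> r0 zA hf w Aw; have [->|wz] := eqVneq w z.
  exact: cder_dquot r0 (holo_sub zA hf).
by have [l fl] := hf w Aw; eexists; exact: cder_dquot_neq wz fl.
Qed.

(* Averaging over the four directions [t, it, -t, -it] kills the linear, the
   quadratic and the mixed terms of the Taylor expansion of [|f|^2]. *)
Lemma four_directions (A p q : C) (t : R) :
  4 * md A ^+ 2 <= md (A + p * toC t + q * toC t ^+ 2) ^+ 2
   + md (A + p * ('i%C * toC t) + q * ('i%C * toC t) ^+ 2) ^+ 2
   + md (A + p * (- toC t) + q * (- toC t) ^+ 2) ^+ 2
   + md (A + p * (- ('i%C * toC t)) + q * (- ('i%C * toC t)) ^+ 2) ^+ 2.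
Proof.
case: A p q => A1 A2 [p1 p2] [q1 q2].
have i2 : ('i%C : C) ^+ 2 = -1 by exact: sqr_i.
have t2 : toC t ^+ 2 = toC (t ^+ 2) by rewrite /toC rmorphXn.
rewrite !sqrrN !exprMn i2 t2 !modulus_sqr !ReD !ImD !ReM !ImM !ReN !ImN !ReM !ImM /=.
have P : 0 <= 4 * (p1 ^+ 2 + p2 ^+ 2) * t ^+ 2 + 4 * (q1 ^+ 2 + q2 ^+ 2) * (t ^+ 2) ^+ 2.
  by apply: addr_ge0; rewrite mulr_ge0 ?sqr_ge0// mulr_ge0// addr_ge0 ?sqr_ge0.
by rewrite -subr_ge0; apply: le_trans P _; rewrite le_eqVlt; apply/orP; left; apply/eqP; ring.
Qed.

Lemma modulus_sqr_perturb (g k : C) (e : R) : md (k - g) <= e -> 0 <= e ->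
  md g ^+ 2 - 2 * e * md g <= md k ^+ 2.
Proof.
move=> H e0; have := modulus_leB g k; rewrite modulusBC => h.
have g0 := modulus_ge0 g; have k0 := modulus_ge0 k.
have [ge|ge] := leP (md g) e; first by nra.
have : md g - e <= md k by lra.
have : 0 <= md g - e by lra.
move: (md g) (md k) => x y in g0 k0 ge *; nra.
Qed.

(** The term in [eps] makes the function strictly subharmonic: summed over four directions at
    distance [t] it gains [4 eps t^2], whereas [e] is chosen so that the Taylor errors cost at most
    [2 eps t^2]. *)
Lemma no_interior_max f z r (eps : R) : 0 < r -> holo (disc z r) f -> 0 < eps ->
  exists2 w, disc z r w & md (f z) ^+ 2 + eps * md z ^+ 2 < md (f w) ^+ 2 + eps * md w ^+ 2.
Proof.
move=> r0 hf eps0; apply: contrapT => N.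
have {}N w : disc z r w -> md (f w) ^+ 2 + eps * md w ^+ 2 <= md (f z) ^+ 2 + eps * md z ^+ 2.
  by move=> zw; rewrite leNgt; apply/negP => H; apply: N; exists w.
have [p [q [_ H]]] := taylor2 r0 hf.
pose G := md (f z) + md p + md q + 1.
have G0 : 0 < G by rewrite ltr_wpDl// !addr_ge0 ?modulus_ge0.
pose e := eps / (4 * G).
have e0 : 0 < e by rewrite divr_gt0// mulr_gt0.
have [d d0 dH] := H e e0.
pose t := Num.min (Num.min d r) 1 / 2.
have t0 : 0 < t by rewrite divr_gt0// !lt_min d0 r0 ltr01.
have td : t < d /\ t < r /\ t < 1.
  have : Num.min (Num.min d r) 1 <= Num.min d r by rewrite ge_min lexx.
  have : Num.min (Num.min d r) 1 <= 1 by rewrite ge_min lexx orbT.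
  have : Num.min d r <= d by rewrite ge_min lexx.
  have : Num.min d r <= r by rewrite ge_min lexx orbT.
  rewrite /t; move: d0 r0; move: (Num.min d r) => m1; move: (Num.min m1 1) => m2.
  by move=> *; split; [lra|split; lra].
have K h : md h = t -> md (f z + p * h + q * h ^+ 2) ^+ 2 - 2 * (e * t ^+ 2) * G <= md (f (z +
  h)) ^+ 2.
  move=> ht.
  have hz : z + h - z = h by rewrite addrAC subrr add0r.
  have := dH (z + h); rewrite hz ht => /(_ td.1) B.
  have e1 : 0 <= e * t ^+ 2 by rewrite mulr_ge0 ?exprn_ge0 ?ltW.
  apply: le_trans (modulus_sqr_perturb B e1).
  apply: lerB => //; apply: ler_wpM2l; first by rewrite mulr_ge0.
  rewrite (le_trans (modulusD _ _))// /G.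
  have -> : md (q * h ^+ 2) = md q * t ^+ 2 by rewrite modulusM modulusX ht.
  have := modulusD (f z) (p * h); rewrite [md (p * h)]modulusM ht.
  have : md p * t <= md p by rewrite ler_piMr ?modulus_ge0// ltW// td.2.2.
  have : md q * t ^+ 2 <= md q.
    by rewrite ler_piMr ?modulus_ge0// exprn_ile1 ?ltW// td.2.2.
  lra.
have mt : md (toC t) = t by rewrite modulus_toC gtr0_norm.
have mit : md ('i%C * toC t) = t by rewrite modulusM modulusi mul1r.
have mNt : md (- toC t) = t by rewrite modulusN.
have mNit : md (- ('i%C * toC t)) = t by rewrite modulusN.
have Nh h : md h = t -> md (f (z + h)) ^+ 2 + eps * md (z + h) ^+ 2 <= md (f z) ^+ 2 + eps * md
  z ^+ 2.
  by move=> ht; apply: N; rewrite /disc /mkset addrAC subrr add0r ht td.2.1.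
have Q : md (z + toC t) ^+ 2 + md (z + 'i%C * toC t) ^+ 2 + md (z + (- toC t)) ^+ 2 +
    md (z + (- ('i%C * toC t))) ^+ 2 = 4 * md z ^+ 2 + 4 * t ^+ 2.
  case: (z) => x y; rewrite !modulus_sqr !ReD !ImD !ReN !ImN !ReM !ImM /=; ring.
have := four_directions (f z) p q t.
have := K _ mt; have := K _ mit; have := K _ mNt; have := K _ mNit.
have := Nh _ mt; have := Nh _ mit; have := Nh _ mNt; have := Nh _ mNit.
have eG : 2 * (e * t ^+ 2) * G = eps * t ^+ 2 / 2.
  by rewrite /e; field; rewrite gt_eqF.
rewrite !eG.
have : 0 < eps * t ^+ 2 by rewrite mulr_gt0// exprn_gt0.
have : eps * (md (z + toC t) ^+ 2 + md (z + 'i%C * toC t) ^+ 2 + md (z + (- toC t)) ^+ 2 +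
    md (z + (- ('i%C * toC t))) ^+ 2) = eps * (4 * md z ^+ 2 + 4 * t ^+ 2) by rewrite Q.
rewrite !mulrDr; lra.
Qed.

Theorem maximum_principle (O : set C) f (M B : R) : open O ->
  (forall z, O z -> md z <= M) -> 0 <= B ->
  holo O f -> (forall z, closure O z -> {for z, continuous f}) ->
  (forall z, closure O z -> ~ O z -> md (f z) <= B) ->
  forall z, O z -> md (f z) <= B.
Proof.
move=> oO OM B0 hf cf fB z Oz; rewrite leNgt; apply/negP => Bz.
have OM' w : closure O w -> md w <= M.
  have cM : closed (cdisc (0 : C) M) by exact: closed_cdisc.
  move=> Ow; have : cdisc 0 M w.
    move/closure_id : cM => ->; apply: closure_subset Ow => u Ou.
    by rewrite /cdisc /mkset subr0 OM.
  by rewrite /cdisc /mkset subr0.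
have cO : compact (closure O).
  by apply: (compact_closed_bounded (B := M)); [exact: closed_closure|].
(* So small that [B^2 + eps M^2 < |f z|^2]: the perturbed function cannot attain its maximum over
   the closure at a frontier point. *)
pose eps := (md (f z) ^+ 2 - B ^+ 2) / (M ^+ 2 + 1).
have M1 : 0 < M ^+ 2 + 1 by rewrite ltr_wpDl// sqr_ge0.
have fz0 : 0 < md (f z) ^+ 2 - B ^+ 2.
  by rewrite subr_gt0 ltrXn2r// nnegrE modulus_ge0.
have eps0 : 0 < eps by rewrite divr_gt0.
have epsE : eps * M ^+ 2 < md (f z) ^+ 2 - B ^+ 2.
  by rewrite /eps mulrAC ltr_pdivrMr// ltr_pM2l// ltrDl.
pose u w := md (f w) ^+ 2 + eps * md w ^+ 2.
have [|w Ow wP] := @compact_max _ (closure O) u cO (ex_intro _ z (subset_closure Oz)).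
  move=> w Ow; have cmf : {for w, continuous (fun v => md (f v))}.
    by apply: continuous_comp; [exact: cf|exact: continuous_modulus].
  apply: (@continuousD _ _ _ (fun v => md (f v) ^+ 2) (fun v => eps * md v ^+ 2)).
    exact: (continuousM cmf cmf).
  apply: (@continuousM _ _ (fun=> eps) (fun v => md v ^+ 2)); first exact: cst_continuous.
  exact: (continuousM (@continuous_modulus R w) (@continuous_modulus R w)).
have [Ow'|nOw] := pselect (O w); last first.
  have := wP z (subset_closure Oz); rewrite /u.
  have m2 : md w ^+ 2 <= M ^+ 2.
    have := OM' _ Ow => mw; rewrite lerXn2r// nnegrE ?modulus_ge0//.
    exact: le_trans (modulus_ge0 _) mw.
  have : eps * md w ^+ 2 <= eps * M ^+ 2 by rewrite ler_wpM2l// ltW.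
  have : 0 <= eps * md z ^+ 2 by rewrite mulr_ge0 ?exprn_ge0 ?modulus_ge0// ltW.
  have : md (f w) ^+ 2 <= B ^+ 2.
    by rewrite lerXn2r// ?nnegrE ?modulus_ge0//; exact: fB.
  lra.
have [r r0 rO] : exists2 r, 0 < r & disc w r `<=` O.
  by have /nbhs_modulusP := open_nbhs_nbhs (conj oO Ow').
have [v /rO Ov uwv] := no_interior_max r0 (holo_sub rO hf) eps0.
by have := lt_le_trans uwv (wP v (subset_closure Ov)); rewrite ltxx.
Qed.

Lemma closure_disc z r : closure (disc z r) `<=` cdisc z r.
Proof.
move=> w; have /closure_id -> : closed (cdisc z r) by exact: closed_cdisc.
by apply: closure_subset => u; exact: ltW.
Qed.

Lemma maximum_disc z r f B : 0 <= B -> holo (cdisc z r) f ->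
  (forall w, md (w - z) = r -> md (f w) <= B) ->
  forall w, cdisc z r w -> md (f w) <= B.
Proof.
move=> B0 hf fB w; rewrite /cdisc /mkset le_eqVlt => /orP[/eqP/fB//|wr].
refine (@maximum_principle (disc z r) f (r + md z) B (@open_disc R z r) _ B0 _ _ _ w wr).
- by move=> u uz; rewrite -(subrK z u) (le_trans (modulusD _ _))// lerD2r ltW.
- by apply: holo_sub hf => u; exact: ltW.
- by move=> u /closure_disc /hf[l /cder_continuous].
move=> u /closure_disc; rewrite /cdisc /disc /mkset => u1 u2; apply: fB.
by apply/eqP; rewrite eq_le u1 leNgt; apply/negP.
Qed.

Lemma circle_point z r : 0 <= r -> exists w, md (w - z) = r.
Proof.
by move=> r0; exists (z + toC r); rewrite addrAC subrr add0r modulus_toC ger0_norm.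
Qed.

(* If [k] had no zero, [1/k] would be too large at the centre. *)
Lemma minimum_disc z r k d : 0 < r -> holo (cdisc z r) k ->
  (forall w, md (w - z) = r -> d <= md (k w)) -> md (k z) < d ->
  exists2 w, disc z r w & k w = 0.
Proof.
move=> r0 hk kd kz; apply: contrapT => N.
have d0 : 0 < d by rewrite (le_lt_trans _ kz) ?modulus_ge0.
have k0 w : cdisc z r w -> k w != 0.
  rewrite /cdisc /mkset le_eqVlt => /orP[/eqP/kd|wr].
    by rewrite -modulus_gt0; exact: lt_le_trans.
  by apply/negP => /eqP kw; apply: N; exists w.
have zz : cdisc z r z by rewrite /cdisc /mkset subrr modulus0 ltW.
have := @maximum_disc z r (fun w => (k w)^-1) d^-1.
rewrite invr_ge0 ltW// => /(_ isT) H.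
have : md (k z)^-1 <= d^-1.
  apply: H zz.
    by move=> w wr; have [l kl] := hk w wr; eexists; exact: cderV kl (k0 _ wr).
  move=> w wr; rewrite modulusV lef_pV2 ?posrE//; first exact: kd.
  by rewrite (lt_le_trans d0)// kd.
rewrite modulusV lef_pV2 ?posrE ?modulus_gt0 ?k0//.
by rewrite leNgt kz.
Qed.

(** The derivative is the value at [z] of the difference quotient, which the maximum principle
    bounds from the circle. The 2 comes from [|f w - f z| <= 2 B]. *)
Lemma cauchy_estimate z r f B : 0 < r -> holo (cdisc z r) f ->
  (forall w, md (w - z) = r -> md (f w) <= B) -> md (cderive f z) <= 2 * B / r.
Proof.
move=> r0 hf fB.
have [w0 w0r] := circle_point z (ltW r0).
have B0 : 0 <= B by rewrite (le_trans _ (fB _ w0r)) ?modulus_ge0.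
have sd : disc z r `<=` cdisc z r by move=> u; exact: ltW.
have zz : cdisc z r z by rewrite /cdisc /mkset subrr modulus0 ltW.
have fz : md (f z) <= B by exact: maximum_disc zz.
have <- : dquot f z (cderive f z) z = cderive f z by rewrite /dquot eqxx.
have hq := dquot_holo r0 sd hf.
apply: (maximum_disc _ hq _ zz).
  by rewrite divr_ge0 ?mulr_ge0 ?(ltW r0).
move=> w wr; have wz : w != z by rewrite -subr_eq0 -modulus_gt0 wr.
rewrite dquot_neq// modulusM modulusV wr ler_pM2r ?invr_gt0//.
by rewrite (le_trans (modulusD _ _))// modulusN; have := fB _ wr; lra.
Qed.

End MaximumPrinciple.

(** * Primitives, the exponential and logarithms *)

Section Primitive.
Variable R : realType.
Local Notation C := (Cplx R).
Local Notation md := (@modulus R).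
Implicit Types (f g : C -> C) (z w c : C) (r p : R).

Lemma cint_cst (k : C) a b : cint (fun=> k) a b = k * toC (b - a).
Proof.
have ck : continuous (fun _ : C => k) by exact: cst_continuous.
have := @cint_cder R (fun z => k * z) (fun=> k) 0 1 a b ck.
rewrite mulr1 !add0r !mulr1 toCB mulrBr; apply=> t.
by rewrite add0r mulr1 -[X in cder _ _ X]mulr1; exact: cderZ (cder_id _).
Qed.

Lemma hside_near f y a b (k : C) e : continuous f ->
  (forall x, hull a b x -> md (f (pt x y) - k) <= e) ->
  md (hside f y a b - k * toC (b - a)) <= 2 * e * `|b - a|.
Proof.
move=> cf H; have ck : continuous (fun _ : R => - k) by exact: cst_continuous.
have := cintD a b (continuous_hline (y := y) cf) ck.
rewrite (cint_cst (- k) a b) mulNr => <-; apply: cint_bound; last exact: H.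
move=> t.
apply: (@continuousD _ _ _ (fun t => f (pt t y)) (fun=> - k)); [exact: continuous_hline|exact:
  ck].
Qed.

Lemma vside_near f x a b (k : C) e : continuous f ->
  (forall y, hull a b y -> md (f (pt x y) - k) <= e) ->
  md (vside f x a b - k * (toC (b - a) * 'i%C)) <= 2 * e * `|b - a|.
Proof.
move=> cf H; have ck : continuous (fun _ : R => - k) by exact: cst_continuous.
have := cintD a b (continuous_vline (x := x) cf) ck.
rewrite (cint_cst (- k) a b) mulNr => E.
rewrite (_ : _ - _ = 'i%C * (cint (fun t => f (pt x t)) a b - k * toC (b - a))); last first.
  by rewrite /vside; ring.
rewrite modulusM modulusi mul1r -E; apply: cint_bound; last exact: H.
move=> t.
apply: (@continuousD _ _ _ (fun t => f (pt x t)) (fun=> - k)); [exact: continuous_vline|exact: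
  ck].
Qed.

Lemma modulus_pt_le (s t s' t' : R) : `|s| <= `|s'| -> `|t| <= `|t'| ->
  md (pt s t) <= md (pt s' t').
Proof.
move=> ss tt; rewrite -(@ler_pXn2r _ 2) ?nnegrE ?modulus_ge0//.
rewrite !modulus_sqr !Re_pt !Im_pt lerD//.
  by rewrite -(real_normK (num_real s)) -(real_normK (num_real s')) lerXn2r.
by rewrite -(real_normK (num_real t)) -(real_normK (num_real t')) lerXn2r.
Qed.

Lemma hull_norm (a b x : R) : hull a b x -> `|x| <= Num.max `|a| `|b|.
Proof.
rewrite /hull ge_min le_max => /andP[x0 x1]; rewrite le_max.
have := ler_norm a; have := ler_norm b.
have := lerNnormlW (lexx `|a|); have := lerNnormlW (lexx `|b|) => b1 a1 b2 a2.
have [x2|x2] := leP 0 x.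
  by rewrite ger0_norm//; case/orP: x1 => ?; apply/orP; [left|right]; lra.
by rewrite ltr0_norm//; case/orP: x0 => ?; apply/orP; [left|right]; lra.
Qed.

Lemma hull_dist (a b x : R) : hull a b x -> `|x - a| <= `|b - a|.
Proof.
rewrite /hull ge_min le_max => /andP[x0 x1]; rewrite ler_norml.
have := ler_norm (b - a); have := lerNnormlW (lexx `|b - a|) => h1 h2.
have := normr_ge0 (b - a) => h3.
by case/orP: x0 => ?; case/orP: x1 => ?; apply/andP; split; lra.
Qed.

Lemma exists_primitive0 g p : continuous g -> holo (disc 0 p) g ->
  exists F, forall z, disc 0 p z -> cder F z (g z).
Proof.
move=> cg hg.
exists (fun z => hside g 0 0 (complex.Re z) + vside g (complex.Re z) 0 (complex.Im z)).
move=> z zp e e0; rewrite /disc /mkset subr0 in zp.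
set x := complex.Re z; set y := complex.Im z.
have zE : z = pt x y by rewrite pt_ReIm.
have e4 : 0 < e / 4 by rewrite divr_gt0.
have /continuous_modulusP/(_ _ e4)[d d0 dH] := cg z.
exists (Num.min (d / 2) (p - md z)); first by rewrite lt_min divr_gt0// subr_gt0.
move=> w; rewrite lt_min => /andP[wd wp].
set x' := complex.Re w; set y' := complex.Im w.
have wE : w = pt x' y' by rewrite pt_ReIm.
have xx : `|x' - x| <= md (w - z) by rewrite -ReN -ReD modulus_Re.
have yy : `|y' - y| <= md (w - z) by rewrite -ImN -ImD modulus_Im.
(* The primitive integrates first along the real axis, then vertically. This rectangle moves the
   horizontal increment from height 0 up to height [y], next to [z]. *)
have H0 : rect_int g x x' 0 y = 0.
  apply: goursat_hull => // s t hs ht; apply: hg; rewrite /disc /mkset subr0.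
  have ht' : `|t| <= `|y|.
    by have := hull_norm ht; rewrite normr0 max_r.
  have := hull_norm hs; rewrite le_max => /orP[] hs'.
    by rewrite (le_lt_trans (modulus_pt_le hs' ht'))// -zE.
  rewrite (le_lt_trans (modulus_pt_le hs' ht'))//.
  rewrite (_ : pt x' y = z + pt (x' - x) 0); last first.
    by rewrite zE ptD addr0 addrC subrK.
  rewrite (le_lt_trans (modulusD _ _))//.
  by have := modulus_pt (x' - x) 0; rewrite normr0 addr0; lra.
have -> : hside g 0 0 x' + vside g x' 0 y' - (hside g 0 0 x + vside g x 0 y) - g z * (w - z) =
   (hside g y x x' - g z * toC (x' - x)) + (vside g x' y y' - g z * (toC (y' - y) * 'i%C)).
  rewrite -(hside_chasles g 0 0 x x') -(vside_chasles g x' 0 y y').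
  rewrite wE zE ptB /pt; move: H0; rewrite /rect_int.
  move: (hside g 0 x x') (hside g y x x') (hside g 0 0 x) => h1 h2 h3.
  move: (vside g x' 0 y) (vside g x' y y') (vside g x 0 y) => v1 v2 v3 H.
  have {H}-> : h1 = h2 - (v1 - v3) by apply/eqP; rewrite -subr_eq0 -H; apply/eqP; ring.
  ring.
have B1 : md (hside g y x x' - g z * toC (x' - x)) <= 2 * (e / 4) * `|x' - x|.
  apply: hside_near => // s hs; apply/ltW/dH.
  rewrite {1}zE ptB subrr (le_lt_trans (modulus_pt _ _))// normr0 addr0.
  by have := hull_dist hs; lra.
have B2 : md (vside g x' y y' - g z * (toC (y' - y) * 'i%C)) <= 2 * (e / 4) * `|y' - y|.
  apply: vside_near => // t ht; apply/ltW/dH.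
  rewrite {1}zE ptB (le_lt_trans (modulus_pt _ _))//.
  by have := hull_dist ht; lra.
rewrite (le_trans (modulusD _ _))//.
have : 2 * (e / 4) * `|x' - x| <= 2 * (e / 4) * md (w - z).
  by rewrite ler_wpM2l// mulr_ge0// ltW.
have : 2 * (e / 4) * `|y' - y| <= 2 * (e / 4) * md (w - z).
  by rewrite ler_wpM2l// mulr_ge0// ltW.
lra.
Qed.

Lemma cder0_cst f c r z w : (forall u, disc c r u -> cder f u 0) ->
  disc c r z -> disc c r w -> f z = f w.
Proof.
move=> df zr wr; apply/eqP; rewrite eq_sym -subr_eq0 -modulus_eq0 eq_le modulus_ge0 andbT.
have <- : 0 * md (w - z) = 0 :> R by rewrite mul0r.
apply: cder_mean_value => t t01; exists 0; last by rewrite modulus0.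
by apply: df; exact: segment_disc_lt.
Qed.

(** A continuous extension of [f] is available only from smaller discs. Their primitives, normalized
    to vanish at [c], agree where they overlap; at [z] the radius halfway between [|z - c|] and [r]
    is used. *)
Theorem holo_primitive f c r : holo (disc c r) f ->
  exists F, forall z, disc c r z -> cder F z (f z).
Proof.
move=> hf.
have H p : exists F, 0 < p -> p < r -> F c = 0 /\ forall z, disc c p z -> cder F z (f z).
  have [p0|p0] := pselect (0 < p); last by exists f.
  have [pr|pr] := pselect (p < r); last by exists f.
  have [g cg gf] := holo_extend p0 pr hf.
  have gE z : md (z - c) < p -> cder g z (cderive f z).
    move=> zp; have p1 : 0 < p - md (z - c) by rewrite subr_gt0.
    have fz := cderiveP (hf z (lt_trans zp pr)).
    apply: (cder_near p1 _ fz) => w wz; rewrite gf//.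
    by have := modulusB_triangle z w c; lra.
  have [||F FP] := @exists_primitive0 (fun z => g (c + z)) p.
  - move=> z; apply: (@continuous_comp _ _ _ (fun z => c + z) g); last exact: cg.
    by have /cder_continuous := cderD (cder_cst c z) (cder_id z).
  - move=> z; rewrite /disc /mkset subr0 => zp; exists (cderive f (c + z)).
    by apply/cder_shift; apply: gE; rewrite addrC addKr.
  exists (fun z => F (z - c) - F 0) => _ _; split; first by rewrite !subrr.
  move=> z zp; rewrite -(gf z (ltW zp)) -(subr0 (g z)).
  apply: cderB; last exact: cder_cst.
  have zc : disc 0 p (z - c) by rewrite /disc /mkset subr0.
  have := cder_comp (cderB (cder_id z) (cder_cst c z)) (FP _ zc).
  by apply: cder_eq; rewrite (addrC c) subrK subr0 mulr1.
have [F FP] := choice H.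
have agree p q z : 0 < p -> p <= q -> q < r -> disc c p z -> F p z = F q z.
  move=> p0 pq qr zp; have q0 := lt_le_trans p0 pq; have pr := le_lt_trans pq qr.
  have [Fp dp] := FP p p0 pr; have [Fq dq] := FP q q0 qr.
  suff : F p z - F q z = F p c - F q c by rewrite Fp Fq subrr => /eqP; rewrite subr_eq0 => /eqP.
  apply: (@cder0_cst (fun u => F p u - F q u) c p z c) => //; last exact: disc_center.
  move=> u up; rewrite -(subrr (f u)); apply: cderB; first exact: dp.
  by apply: dq; exact: lt_le_trans pq.
exists (fun z => F ((r + md (z - c)) / 2) z) => z zr.
pose p := (r + md (z - c)) / 2; rewrite /disc /mkset in zr.
have zp : md (z - c) < p by rewrite /p; lra.
have p0 : 0 < p by rewrite (le_lt_trans _ zp) ?modulus_ge0.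
have pr : p < r by rewrite /p; lra.
have [_ dp] := FP p p0 pr.
have p1 : 0 < p - md (z - c) by rewrite subr_gt0.
apply: (cder_near p1 _ (dp z zp)) => w wz.
have wp : md (w - c) < p by have := modulusB_triangle z w c; lra.
have q0 : 0 < (r + md (w - c)) / 2.
  have := modulus_ge0 (w - c); lra.
have qr : (r + md (w - c)) / 2 < r by lra.
have [pq|/ltW qp] := leP p ((r + md (w - c)) / 2); first exact: agree.
by apply/esym/agree => //; rewrite /disc /mkset; lra.
Qed.

End Primitive.

(** * The exponential, logarithms and lifting through the cosine *)

Section ComplexExponential.
Variable R : realType.
Local Notation C := (Cplx R).
Local Notation md := (@modulus R).
Implicit Types (z w : C).

Definition cexp z : C := toC (expR (complex.Re z)) * pt (cos (complex.Im z)) (sin (complex.Im z)).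

Lemma cexpD z w : cexp (z + w) = cexp z * cexp w.
Proof.
have i2 : ('i%C : C) ^+ 2 = -1 by exact: sqr_i.
rewrite /cexp ReD ImD expRD cosD sinD /pt toCB toCD !toCM.
by set ii := 'i%C in i2 *; ring: i2.
Qed.

Lemma cexp0 : cexp 0 = 1.
Proof. by rewrite /cexp /= expR0 cos0 sin0 /pt /toC rmorph1 rmorph0; ring. Qed.

Lemma cexp_neq0 z : cexp z != 0.
Proof.
apply/eqP => E; have := cexpD z (- z); rewrite subrr cexp0 E mul0r => /eqP.
by rewrite oner_eq0.
Qed.

Lemma cexpN z : cexp (- z) = (cexp z)^-1.
Proof.
by apply: (mulfI (cexp_neq0 z)); rewrite -cexpD subrr cexp0 mulfV// cexp_neq0.
Qed.

Lemma modulus_cexp z : md (cexp z) = expR (complex.Re z).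
Proof.
rewrite /cexp modulusM modulus_toC ger0_norm ?expR_ge0//.
rewrite (_ : md (pt _ _) = 1) ?mulr1//.
apply/eqP; rewrite -(@eqrXn2 _ 2) ?modulus_ge0//.
by rewrite modulus_sqr Re_pt Im_pt cos2Dsin2 expr1n.
Qed.

Lemma cexp_surj (a : C) : a != 0 -> exists z, cexp z = a.
Proof.
rewrite -modulus_gt0 => a0.
have a1 : md a != 0 by rewrite gt_eqF.
pose u := complex.Re a / md a; pose v := complex.Im a / md a.
have uv : u ^+ 2 + v ^+ 2 = 1.
  by rewrite /u /v !expr_div_n -mulrDl -modulus_sqr divff// expf_neq0.
have u1 : -1 <= u <= 1.
  rewrite -ler_norml -(@ler_pXn2r _ 2) ?nnegrE// real_normK ?num_real// expr1n -uv.
  by rewrite lerDl sqr_ge0.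
have [t [ct st]] : exists t, cos t = u /\ sin t = v.
  have s1 : sin (acos u) = `|v|.
    by rewrite sin_acos// -uv addrC addKr sqrtr_sqr.
  have c1 : cos (acos u) = u by apply: acosK; rewrite in_itv.
  have [v0|v0] := leP 0 v.
    by exists (acos u); rewrite s1 ger0_norm.
  by exists (- acos u); rewrite cosN sinN s1 ltr0_norm// opprK.
exists (pt (ln (md a)) t).
rewrite /cexp Re_pt Im_pt lnK ?posrE// ct st /u /v.
apply: complex_eq; rewrite ?ReM ?ImM !Re_pt !Im_pt /=; field=> //.
Qed.

Lemma cexp_cder0 : cder cexp 0 1.
Proof.
move=> e e0.
(* The three error terms below add up to at most [7 e' |w|]. *)
have [e' [e'0 e'1 e'e]] : exists e' : R, [/\ 0 < e', e' <= 1 & 8 * e' <= e].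
  exists (Num.min (e / 8) 1); rewrite lt_min ltr01 divr_gt0// ge_min lexx orbT.
  by rewrite mulrC -ler_pdivlMr// ge_min lexx.
have [d1 d10 H1] := (is_deriveP _ _ _).1 (is_derive_expR (0 : R)) _ e'0.
have [d2 d20 H2] := (is_deriveP _ _ _).1 (is_derive_cos (0 : R)) _ e'0.
have [d3 d30 H3] := (is_deriveP _ _ _).1 (is_derive_sin (0 : R)) _ e'0.
exists (Num.min (Num.min d1 d2) (Num.min d3 e')); first by rewrite !lt_min d10 d20 d30.
move=> w; rewrite !lt_min subr0 => /andP[/andP[w1 w2] /andP[w3 w4]].
set x := complex.Re w; set y := complex.Im w.
have xw : `|x| <= md w by exact: modulus_Re.
have yw : `|y| <= md w by exact: modulus_Im.
have wE : w = pt x y by rewrite pt_ReIm.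
have := H1 x; rewrite subr0 expR0 (mul1r x) => /(_ (le_lt_trans xw w1)) E1.
have := H2 y; rewrite subr0 cos0 sin0 oppr0 mul0r subr0 => /(_ (le_lt_trans yw w2)) E2.
have := H3 y; rewrite !subr0 cos0 sin0 (mul1r y) subr0 => /(_ (le_lt_trans yw w3)) E3.
have x1 : `|x| <= 1 by lra.
rewrite cexp0 mul1r (_ : _ - w = toC (expR x - 1 - x) * pt (cos y) (sin y) +
   toC (1 + x) * pt (cos y - 1) (sin y - y) + toC (x * y) * 'i%C); last first.
  by rewrite {2}wE /cexp -/x -/y /pt !toCB toCD toCM /toC rmorph1; ring.
have P1 : md (pt (cos y) (sin y)) <= 2.
  have : `|cos y| <= 1 by rewrite ler_norml cos_geN1 cos_le1.
  have : `|sin y| <= 1 by rewrite ler_norml sin_geN1 sin_le1.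
  by have := modulus_pt (cos y) (sin y); lra.
have Q1 : md (toC (expR x - 1 - x) * pt (cos y) (sin y)) <= e' * md w * 2.
  rewrite modulusM modulus_toC ler_pM ?modulus_ge0//.
  by rewrite (le_trans E1)// ler_wpM2l// ltW.
have P2 : md (pt (cos y - 1) (sin y - y)) <= e' * md w + e' * md w.
  rewrite (le_trans (modulus_pt _ _))// lerD//.
    by rewrite (le_trans E2)// ler_wpM2l// ltW.
  by rewrite (le_trans E3)// ler_wpM2l// ltW.
have Q2 : md (toC (1 + x) * pt (cos y - 1) (sin y - y)) <= 2 * (e' * md w + e' * md w).
  rewrite modulusM modulus_toC ler_pM ?modulus_ge0//.
  by rewrite (le_trans (ler_normD _ _))// normr1; lra.
have Q3 : md (toC (x * y) * 'i%C) <= e' * md w.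
  rewrite modulusM modulusi mulr1 modulus_toC normrM ler_pM//.
  exact: le_trans xw (ltW w4).
have := modulusD (toC (expR x - 1 - x) * pt (cos y) (sin y)) (toC (1 + x) * pt (cos y - 1) (sin
  y - y)).
set A := toC (expR x - 1 - x) * _ in Q1 *; set B := toC (1 + x) * _ in Q2 *.
have := modulusD (A + B) (toC (x * y) * 'i%C).
have : 8 * (e' * md w) <= e * md w by rewrite mulrA ler_wpM2r// modulus_ge0.
have : 0 <= e' * md w by rewrite mulr_ge0 ?modulus_ge0// ltW.
lra.
Qed.

Lemma cexp_cder z : cder cexp z (cexp z).
Proof.
rewrite -{1}(addr0 z); apply/cder_shift.
have := cderZ (cexp z) cexp_cder0; rewrite mulr1.
by apply: cder_ext => w; rewrite cexpD.
Qed.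

Lemma cexp_mulz (k : int) w : cexp (k%:~R * w) = cexp w ^ k.
Proof.
have nat n : cexp (n%:R * w) = cexp w ^+ n.
  elim: n => [|n IH]; first by rewrite mul0r cexp0 expr0.
  by rewrite -natr1 mulrDl mul1r cexpD IH exprSr.
by case: k => n; [exact: nat|rewrite NegzE mulrNz mulNr cexpN (nat n.+1)].
Qed.

Lemma cexp_ipi : cexp ('i%C * toC pi) = -1.
Proof.
have -> : 'i%C * toC pi = pt 0 pi :> C by rewrite /pt toC0; ring.
rewrite /cexp Re_pt Im_pt expR0 cospi sinpi /pt toCN.
by rewrite toC1 toC0; ring.
Qed.

(** With [L] a primitive of the logarithmic derivative, [f * cexp (- L)] is constant, and [k] is a
    logarithm of that constant. *)
Theorem holo_log f (c : C) (r : R) : 0 < r -> holo (disc c r) f ->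
  (forall z, disc c r z -> f z != 0) ->
  exists2 L, holo (disc c r) L & forall z, disc c r z -> f z = cexp (L z).
Proof.
move=> r0 hf f0; have hf' := cderive_holo hf.
have [|L LP] := @holo_primitive R (fun z => cderive f z / f z) c r.
  move=> z zr; have [l fl] := hf z zr; have [k fk] := hf' z zr.
  by eexists; apply: (cder_div fk fl); exact: f0.
have cc := disc_center c r0.
have [k kE] := cexp_surj (mulf_neq0 (f0 c cc) (cexp_neq0 (- L c))).
exists (fun z => L z + k).
  by move=> z /LP lz; eexists; exact: cderD lz (cder_cst k z).
move=> z zr; rewrite cexpD kE mulrC -mulrA -cexpD.
have E : f z * cexp (- L z) = f c * cexp (- L c).
  apply: (@cder0_cst R (fun u => f u * cexp (- L u)) c r z c) => //.
  move=> u ur; have fu := cderiveP (hf u ur).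
  have Lu := cder_comp (cderN (LP u ur)) (cexp_cder (- L u)).
  by apply: cder_eq (cderM fu Lu) => /=; field; exact: f0.
rewrite cexpD mulrA -E -mulrA -cexpD addNr cexp0 mulr1 //.
Qed.

(* [cos (pi z)] *)
Definition ccospi z : C := (cexp ('i%C * toC pi * z) + cexp (- ('i%C * toC pi * z))) / 2.

(** Solving [H = (u + 1/u) / 2] gives [u = H + s] with [s^2 = H^2 - 1]. The root exists because
    [H^2 - 1] has no zero, and [u] has a logarithm because [H - s] is its inverse. *)
Theorem holo_acos (H : C -> C) (c : C) (r : R) : 0 < r -> holo (disc c r) H ->
  (forall z, disc c r z -> H z != 1 /\ H z != -1) ->
  exists2 F, holo (disc c r) F & forall z, disc c r z -> H z = ccospi (F z).
Proof.
move=> r0 hH H1.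
have [||L hL LP] := @holo_log (fun z => H z ^+ 2 - 1) c r r0.
- by move=> z /hH[l Hl]; eexists; exact: cderB (cderX 2 Hl) (cder_cst 1 z).
- move=> z /H1[h1 h2]; rewrite subr_sqr_1 mulf_neq0//.
    by rewrite subr_eq0.
  by rewrite addr_eq0.
pose s z := cexp (2^-1 * L z).
have s2 z : disc c r z -> s z ^+ 2 = H z ^+ 2 - 1.
  by move=> zr; rewrite LP// /s expr2 -cexpD; congr cexp; field.
have u1 z : disc c r z -> (H z + s z) * (H z - s z) = 1.
  by move=> zr; rewrite mulrC -subr_sqr (s2 z zr); ring.
have [||L2 hL2 L2P] := @holo_log (fun z => H z + s z) c r r0.
- move=> z zr; have [l Hl] := hH z zr; have [k Lk] := hL z zr.
  by eexists; exact: cderD Hl (cder_comp (cderZ 2^-1 Lk) (cexp_cder _)).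
- move=> z zr; apply/eqP => E; have := u1 z zr; rewrite E mul0r => /eqP.
  by rewrite eq_sym oner_eq0.
have pi0 : 'i%C * toC pi != 0 :> C.
  by rewrite -modulus_gt0 modulusM modulusi mul1r modulus_toC gtr0_norm ?pi_gt0.
exists (fun z => ('i%C * toC pi)^-1 * L2 z).
  by move=> z /hL2[l Ll]; eexists; exact: cderZ Ll.
move=> z zr; rewrite /ccospi mulVKf// cexpN -L2P//.
have u0 : H z + s z != 0.
  by apply/eqP => E; have := u1 z zr; rewrite E mul0r => /eqP; rewrite eq_sym oner_eq0.
have -> : (H z + s z)^-1 = H z - s z by apply: (mulfI u0); rewrite mulfV// u1.
by field.
Qed.

Lemma ccospi_shift (k : int) z : ccospi (z + toC (2 * k%:~R)) = ccospi z.
Proof.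
have E : 'i%C * toC pi * (z + toC (2 * k%:~R)) =
   'i%C * toC pi * z + k%:~R * (2%:R * ('i%C * toC pi)) :> C.
  by rewrite toCM /toC rmorph_int rmorph_nat; ring.
have P : cexp (k%:~R * (2%:R * ('i%C * toC pi))) = 1.
  rewrite cexp_mulz (_ : 2%:R * _ = 'i%C * toC pi + 'i%C * toC pi); last by ring.
  by rewrite cexpD cexp_ipi mulrNN mulr1 exp1rz.
by rewrite /ccospi E !cexpN cexpD P mulr1.
Qed.

Lemma ccospi_reduce z : exists k : int, `|complex.Re (z - toC (2 * k%:~R))| <= 1.
Proof.
exists (Num.floor ((complex.Re z + 1) / 2)).
have := floor_itv ((complex.Re z + 1) / 2) => /andP[].
rewrite intrD /= ReD ReN /= ler_norml; set k := _%:~R; lra.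
Qed.

Lemma modulus_cexp_pi z : md (cexp ('i%C * toC pi * z)) = expR (- (pi * complex.Im z)).
Proof. by rewrite modulus_cexp !ReM !ImM /=; congr expR; ring. Qed.

Lemma modulus_cexp_piN z : md (cexp (- ('i%C * toC pi * z))) = expR (pi * complex.Im z).
Proof. by rewrite modulus_cexp ReN !ReM !ImM /=; congr expR; ring. Qed.

Lemma modulus_half z : md (z / 2) = md z / 2.
Proof. by rewrite modulusM modulusV -(rmorph_nat (real_complex R)) modulus_toC ger0_norm. Qed.

Lemma Im_ccospi z : `|complex.Im z| <= md (ccospi z).
Proof.
rewrite /ccospi modulus_half.
set A := cexp _; set B := cexp _.
have A1 : md A = expR (- (pi * complex.Im z)) by exact: modulus_cexp_pi.
have B1 : md B = expR (pi * complex.Im z) by exact: modulus_cexp_piN.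
have h1 := modulus_leB A (- B); have h2 := modulus_leB B (- A).
rewrite !modulusN !opprK (addrC B) in h1 h2.
have p2 := pi_ge2 R.
have [y0|y0] := leP 0 (complex.Im z).
  rewrite ger0_norm//.
  have py : 2 * complex.Im z <= pi * complex.Im z by rewrite ler_wpM2r.
  have := expR_ge1Dx (pi * complex.Im z).
  have : expR (- (pi * complex.Im z)) <= 1 by rewrite expR_le1 oppr_le0; lra.
  lra.
rewrite ltr0_norm//.
have py : pi * complex.Im z <= 2 * complex.Im z by rewrite ler_wnM2r// ltW.
have := expR_ge1Dx (- (pi * complex.Im z)).
have : expR (pi * complex.Im z) <= 1 by rewrite expR_le1; lra.
lra.
Qed.

Lemma ccospi_le z : md (ccospi z) <= expR (pi * md z).
Proof.
rewrite /ccospi modulus_half ler_pdivrMr//.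
rewrite (le_trans (modulusD _ _))// modulus_cexp_pi modulus_cexp_piN.
have y := modulus_Im z; have p0 := pi_gt0 R.
have : expR (- (pi * complex.Im z)) <= expR (pi * md z).
  rewrite ler_expR -mulrN (ler_wpM2l (ltW p0))//; have := lerNnormlW (lexx `|complex.Im z|); lra.
have : expR (pi * complex.Im z) <= expR (pi * md z).
  rewrite ler_expR (ler_wpM2l (ltW p0))//; have := ler_norm (complex.Im z); lra.
lra.
Qed.

Lemma ccospi_pt (k : int) (t : R) :
  ccospi (pt k%:~R t) = (-1) ^ k * toC ((expR (pi * t) + expR (- (pi * t))) / 2).
Proof.
have E : 'i%C * toC pi * pt k%:~R t = k%:~R * ('i%C * toC pi) + toC (- (pi * t)).
  have i2 : ('i%C : C) ^+ 2 = -1 by exact: sqr_i.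
  rewrite /pt toCN toCM /toC rmorph_int.
  by set ii := 'i%C in i2 *; ring: i2.
have ex (x : R) : cexp (toC x) = toC (expR x).
  by rewrite /cexp /= cos0 sin0 /pt /toC rmorph1 rmorph0; ring.
have S : cexp (k%:~R * ('i%C * toC pi)) = (-1) ^ k.
  by rewrite cexp_mulz cexp_ipi.
have SS : ((-1) ^ k)^-1 = (-1) ^ k :> C.
  by rewrite invr_expz -exprz_inv invrN1.
have -> : toC ((expR (pi * t) + expR (- (pi * t))) / 2) =
    (toC (expR (pi * t)) + toC (expR (- (pi * t)))) / 2 :> C.
  by rewrite toCM toCD toCV /toC rmorph_nat.
rewrite /ccospi cexpN E cexpD S ex invfM SS -toCV -expRN opprK; ring.
Qed.

End ComplexExponential.

(** * The theorems of Bloch, Schottky and Montel *)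

Section BlochSchottky.
Variable R : realType.
Local Notation C := (Cplx R).
Local Notation md := (@modulus R).
Implicit Types (f g h : C -> C) (z w c : C) (r t : R).

Lemma holo_mean_value f c r z w B : (forall u, disc c r u -> exists2 l, cder f u l & md l <= B) ->
  disc c r z -> disc c r w -> md (f w - f z) <= B * md (w - z).
Proof.
by move=> H zr wr; apply: cder_mean_value => t t01; apply: H; exact: segment_disc_lt.
Qed.

(** In [g w - g z = (w - z) (g'(z) + (w - z) q2 w)] one has [|q2| <= 6 m / t] on the half disc. On
    the circle of radius [t / 12] the correction is at most [m / 2], so [|g w - g z| >= m t / 24],
    and half of this is the radius that is covered. *)
Lemma disc_cover g z t : 0 < t -> holo (disc z t) g -> 0 < md (cderive g z) ->
  (forall w, disc z t w -> md (cderive g w) <= 2 * md (cderive g z)) ->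
  forall v, md (v - g z) < md (cderive g z) * t / 48 -> exists2 w, disc z t w & g w = v.
Proof.
move=> t0 hg; set m := md (cderive g z) => m0 gm v vz.
have sub r : r < t -> cdisc z r `<=` disc z t.
  by move=> rt w wr; exact: le_lt_trans wr rt.
pose q := dquot g z (cderive g z).
have hq : holo (disc z t) q by exact: (dquot_holo t0 (@subset_refl _ _)).
have zz : disc z t z by exact: disc_center.
have qz : q z = cderive g z by rewrite /q /dquot eqxx.
have q2m w : disc z t w -> md (q w) <= 2 * m.
  move=> wt; have [->|wz] := eqVneq w z; first by rewrite qz -/m; lra.
  rewrite /q dquot_neq// modulusM modulusV ler_pdivrMr ?modulus_gt0 ?subr_eq0//.
  apply: holo_mean_value (zz) (wt) => u ut.
  by exists (cderive g u); [exact/cderiveP/hg|exact: gm].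
pose q2 := dquot q z (cderive q z).
have hq2 : holo (disc z t) q2 by exact: (dquot_holo t0 (@subset_refl _ _)).
have s0 : t / 2 < t by lra.
have q2b w : cdisc z (t / 2) w -> md (q2 w) <= 6 * m / t.
  apply: maximum_disc; first by rewrite divr_ge0 ?mulr_ge0// ltW.
    exact: holo_sub (sub _ s0) hq2.
  move=> u ut; have uz : u != z by rewrite -subr_eq0 -modulus_gt0 ut divr_gt0.
  rewrite /q2 dquot_neq// modulusM modulusV ut ler_pdivrMr ?divr_gt0//.
  rewrite (_ : 6 * m / t * (t / 2) = 3 * m); last by field; rewrite gt_eqF.
  have uT : disc z t u by rewrite /disc /mkset ut.
  have := q2m u uT; have := modulusD (q u) (- q z); rewrite modulusN qz -/m; lra.
have expand w : g w - g z = (w - z) * (cderive g z + (w - z) * q2 w).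
  rewrite {1}(dquotE g z (cderive g z) w) -/q (dquotE q z (cderive q z) w) -/q2 qz; ring.
have t12 : t / 12 < t by lra.
have [||||w wt /eqP] := @minimum_disc R z (t / 12) (fun w => g w - v) (m * t / 48).
- by rewrite divr_gt0.
- move=> w /(sub _ t12)/hg[l gl]; eexists; exact: cderB gl (cder_cst v w).
- move=> w wt; have wh : cdisc z (t / 2) w by rewrite /cdisc /mkset wt; lra.
  have B : m * t / 24 <= md (g w - g z).
    rewrite expand modulusM wt.
    have q2w := q2b w wh.
    have := modulus_leB (cderive g z) (- ((w - z) * q2 w)); rewrite opprK modulusN modulusM wt
      -/m.
    have : t / 12 * md (q2 w) <= m / 2.
      apply: (@le_trans _ _ (t / 12 * (6 * m / t))); first by rewrite ler_wpM2l// ltW// divr_gt0.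
      by rewrite le_eqVlt; apply/orP; left; apply/eqP; field; rewrite gt_eqF.
    move=> h1 h2; have h3 : m / 2 <= md (cderive g z + (w - z) * q2 w) by lra.
    rewrite (_ : m * t / 24 = t / 12 * (m / 2)); last by field.
    by rewrite ler_wpM2l// ltW// divr_gt0.
  have := modulus_leB (g w - g z) (v - g z).
  rewrite (_ : _ - _ - (v - g z) = g w - v); last by ring.
  lra.
- by rewrite modulusBC.
rewrite subr_eq0 => /eqP gw; exists w => //.
by rewrite /disc /mkset (lt_trans wt).
Qed.

(* Maximizing [|g'(z)| (r - |z - p|)] produces a subdisc to which the covering
   lemma applies. *)
Theorem bloch g p r : 0 < r -> holo (disc p r) g ->
  (forall w0, exists2 w, md (w - w0) < 2 & forall u, disc p r u -> g u != w) ->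
  md (cderive g p) * r <= 384.
Proof.
move=> r0 hg omit; pose s := r / 2.
have s0 : 0 < s by rewrite divr_gt0.
have sr : s < r by rewrite /s; lra.
have hg' := cderive_holo hg.
have sub : cdisc p s `<=` disc p r by move=> u us; exact: le_lt_trans us sr.
pose Phi z := md (cderive g z) * (s - md (z - p)).
have pp : cdisc p s p by rewrite /cdisc /mkset subrr modulus0 ltW.
have [|z zs zP] := @compact_max R (cdisc p s) Phi (@compact_cdisc R p s) (ex_intro _ p pp).
  move=> z /sub/hg'[l /cder_continuous cz].
  apply: (@continuousM _ _ (fun z => md (cderive g z)) (fun z => s - md (z - p))).
    exact: continuous_comp cz (@continuous_modulus R _).
  apply: (@continuousB _ _ _ (fun=> s) (fun z => md (z - p))); first exact: cst_continuous.
  exact: continuous_modulusB.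
have Pp : md (cderive g p) * s <= Phi z.
  by have := zP p pp; rewrite {1}/Phi subrr modulus0 subr0.
rewrite leNgt; apply/negP => big.
(* For [t] equal to half of [s - |z - p|] this gives [|g'(z)| t > 96], so the covered radius
   [|g'(z)| t / 48] exceeds 2. *)
have Pz : 192 < Phi z by apply: lt_le_trans Pp; rewrite /s; lra.
have g0 : 0 < md (cderive g z).
  rewrite lt_def modulus_ge0 andbT; apply: contraTneq Pz => E.
  by rewrite /Phi E mul0r -leNgt ler0n.
have t0 : 0 < s - md (z - p).
  rewrite ltNge; apply: contraTN Pz => le0; rewrite -leNgt.
  by apply: (le_trans _ (ler0n _ _)); rewrite /Phi mulr_ge0_le0// modulus_ge0.
pose t := (s - md (z - p)) / 2.
have t1 : 0 < t by rewrite divr_gt0.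
have subz : disc z t `<=` cdisc p s.
  move=> u; rewrite /disc /cdisc /mkset => ut.
  by have := modulusB_triangle z u p; rewrite /t in ut; lra.
have gb u : disc z t u -> md (cderive g u) <= 2 * md (cderive g z).
  move=> ut; have := zP u (subz u ut); rewrite /Phi => H.
  have ut' : t <= s - md (u - p).
    by rewrite /disc /mkset /t in ut *; have := modulusB_triangle z u p; lra.
  rewrite -(ler_pM2r t1) (le_trans (ler_wpM2l (modulus_ge0 _) ut'))// (le_trans H)//.
  by rewrite /t le_eqVlt; apply/orP; left; apply/eqP; field.
have [w0 w0z omitw] := omit (g z).
have [|u ut gu] := disc_cover t1 (holo_sub (subset_trans subz sub) hg) g0 gb (v := w0).
  apply: (lt_le_trans w0z); rewrite ler_pdivlMr//.
  by have := Pz; rewrite /Phi /t; lra.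
by have := omitw u (sub _ (subz _ ut)); rewrite gu eqxx.
Qed.

(** On a line with integral real part, [ccospi] is [cosh (pi t)] up to sign. Over an interval of
    length 1 in [t], away from 0, this grows by at least 1 and so passes through an integer; the
    nearest such line on the left is at distance less than 1. *)
Lemma ccospi_net w0 : exists w, md (w - w0) < 2 /\ exists k : int, ccospi w = toC k%:~R.
Proof.
pose phi (t : R) := (expR (pi * t) + expR (- (pi * t))) / 2.
pose a := `|complex.Im w0|.
have p0 := pi_gt0 R.
have a0 : 0 <= a by exact: normr_ge0.
have pa0 : 0 <= pi * a by rewrite mulr_ge0// ltW.
have gap : phi a + 1 <= phi (a + 1).
  have x1 : 1 <= expR (pi * a) by rewrite -[leLHS]expR0 ler_expR.
  have e2 : 2 <= expR (pi / 2 : R).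
    by have := expR_ge1Dx (pi / 2 : R); have := pihalf_ge1 R; lra.
  have e4 : 4 <= expR pi :> R.
    by rewrite [pi](splitr pi) expRD; nra.
  have en : expR (- (pi * a)) <= 1 by rewrite -[leRHS]expR0 ler_expR oppr_le0.
  have em := expR_gt0 (- (pi * (a + 1))).
  rewrite /phi mulrDr mulr1 [expR (_ + pi)]expRD.
  rewrite mulrDr mulr1 in em.
  have : 4 * expR (pi * a) <= expR (pi * a) * expR pi by rewrite mulrC ler_wpM2l// expR_ge0.
  lra.
pose n := Num.floor (phi (a + 1)).
have /andP[n1 n2] := floor_itv (phi (a + 1)); rewrite intrD /= -/n in n1 n2.
have cphi : continuous phi.
  move=> t; have E : derivable phi t 1 by exact: ex_derive.
  exact/differentiable_continuous/derivable1_diffP.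
have [t tab tn] : exists2 t, t \in `[a, a + 1] & phi t = n%:~R.
  apply: IVT; first by rewrite lerDl.
    exact: continuous_subspaceT.
  by rewrite ge_min le_max n1 orbT andbT; apply/orP; left; lra.
pose m := Num.floor (complex.Re w0).
have /andP[m1 m2] := floor_itv (complex.Re w0); rewrite intrD /= -/m in m1 m2.
rewrite in_itv /= in tab; move/andP: tab => [ta tb].
pose t' := if 0 <= complex.Im w0 then t else - t.
exists (pt m%:~R t'); split.
  apply: (le_lt_trans (modulus_ReIm _)).
  rewrite ReD ReN ImD ImN Re_pt Im_pt.
  have h1 : `|m%:~R - complex.Re w0| < 1 by rewrite ltr_norml; lra.
  have h2 : `|t' - complex.Im w0| <= 1.
    rewrite /t' ler_norml; move: ta tb; rewrite /a.
    by case: (leP 0 (complex.Im w0)) => y0; [rewrite ger0_norm//|rewrite ltr0_norm//]; lra.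
  lra.
rewrite ccospi_pt.
have -> : (expR (pi * t') + expR (- (pi * t'))) / 2 = n%:~R.
  by rewrite -tn /phi /t'; case: ifP => // _; rewrite mulrN opprK addrC.
have [->|->] : (-1 : C) ^ m = 1 \/ (-1 : C) ^ m = -1.
- case: (m) => j.
    by rewrite -exprnP -signr_odd; case: odd; [right; rewrite expr1|left; rewrite expr0].
  rewrite NegzE -exprnN -signr_odd; case: odd; [right|left].
    by rewrite expr1 invrN1.
  by rewrite expr0 invr1.
- by exists n; rewrite mul1r.
- by exists (- n); rewrite mulN1r mulrNz toCN.
Qed.

Lemma ccospi_int (k : int) : ccospi (toC (k%:~R : R)) = 1 \/ ccospi (toC (k%:~R : R)) = -1.
Proof.
have -> : toC k%:~R = pt k%:~R 0 :> C by rewrite /pt toC0 mul0r addr0.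
rewrite ccospi_pt mulr0 oppr0 expR0 (_ : (1 + 1) / 2 = 1 :> R); last by field.
rewrite toC1 mulr1; case: k => j.
  by rewrite -exprnP -signr_odd; case: odd; [right; rewrite expr1|left; rewrite expr0].
rewrite NegzE -exprnN -signr_odd; case: odd; [right|left].
  by rewrite expr1 invrN1.
by rewrite expr0 invr1.
Qed.

(** The period 2 brings the real part at [q] into [[-1, 1]], and the imaginary part is at most
    [|H q|]. So the size of the lift at [q] depends on [|H q|] alone, as a bound uniform in [h]
    requires. *)
Lemma ccospi_lift (H : C -> C) c r q : 0 < r -> holo (disc c r) H ->
  (forall z, disc c r z -> H z != 1 /\ H z != -1) ->
  exists F, [/\ holo (disc c r) F, forall z, disc c r z -> H z = ccospi (F z) &
    disc c r q -> md (F q) <= 1 + md (H q)].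
Proof.
move=> r0 hH H1; have [F hF FP] := holo_acos r0 hH H1.
have [k kP] := ccospi_reduce (F q).
have E z : ccospi (F z - toC (2 * k%:~R)) = ccospi (F z).
  by rewrite -[in RHS](subrK (toC (2 * k%:~R)) (F z)) ccospi_shift.
exists (fun z => F z - toC (2 * k%:~R)); split.
- by move=> z /hF[l Fl]; eexists; exact: cderB Fl (cder_cst _ z).
- by move=> z zr; rewrite E FP.
move=> qr; rewrite (le_trans (modulus_ReIm _))// lerD//.
by rewrite FP// -E Im_ccospi.
Qed.

(* Writing [2h - 1 = cos (pi cos (pi G))], the function [G] omits a net meeting
   every disc of radius 2, so Bloch's theorem bounds its derivative. *)
Theorem schottky c r s B : 0 < s -> s < r -> exists L, forall h,
  holo (disc c r) h -> (forall z, disc c r z -> h z != 0 /\ h z != 1) ->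
  forall q p, cdisc c s q -> cdisc c s p -> md (h q) <= B -> md (h p) <= L.
Proof.
move=> s0 sr; have r0 : 0 < r by exact: lt_trans sr.
have rs : 0 < r - s by rewrite subr_gt0.
(* The value of [2h - 1] at [q] is at most [2 * B + 1] and each lift adds 1; the second term is
   Bloch's bound for the derivative times the diameter. *)
pose L0 := (2 * B + 3) + 384 / (r - s) * (2 * s).
exists (1 + expR (pi * expR (pi * L0))) => h hh h01 q p qs ps hq.
have sub : cdisc c s `<=` disc c r by move=> u us; exact: le_lt_trans us sr.
pose H z := 2 * h z - 1.
have hH : holo (disc c r) H.
  by move=> z /hh[l hl]; eexists; exact: cderB (cderZ 2 hl) (cder_cst 1 z).
have n2 : (2 : C) != 0 by rewrite pnatr_eq0.
have H1 z : disc c r z -> H z != 1 /\ H z != -1.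
  move=> /h01[h0 h1]; split; apply/eqP; rewrite /H => E.
    have : 2 * (h z - 1) = 0 by rewrite mulrBr mulr1 -[in 2](natr1 1) opprD addrA E subrr.
    by move=> /eqP; rewrite mulf_eq0 (negPf n2) subr_eq0 (negPf h1).
  have : 2 * h z = 0 by rewrite -(subrK 1 (2 * h z)) E addNr.
  by move=> /eqP; rewrite mulf_eq0 (negPf n2) (negPf h0).
have [F [hF FP Fq]] := @ccospi_lift H c r q r0 hH H1.
(* The cosine is 1 or -1 at every integer. Omitting 1 and -1 permits the second lift; omitting all
   integers makes [G] omit the net. *)
have Fint z (k : int) : disc c r z -> F z != toC k%:~R.
  move=> zr; apply/eqP => E; have [h1 h2] := H1 z zr.
  have := FP z zr; rewrite E; have [->|->] := ccospi_int k => HE.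
    by rewrite HE eqxx in h1.
  by rewrite HE eqxx in h2.
have F1 z : disc c r z -> F z != 1 /\ F z != -1.
  move=> zr; split; first by have := Fint z 1 zr; rewrite toC1.
  by have := Fint z (-1) zr; rewrite mulrN1z toCN toC1.
have [G [hG GP Gq]] := @ccospi_lift F c r q r0 hF F1.
have md2 : md 2 = 2 by rewrite -(rmorph_nat (real_complex R)) modulus_toC ger0_norm.
have Hq : md (H q) <= 2 * B + 1.
  by rewrite (le_trans (modulusD _ _))// modulusN modulus1 modulusM md2; lra.
have Gq' : md (G q) <= 2 * B + 3 by have := Gq (sub q qs); have := Fq (sub q qs); lra.
have dG z : cdisc c s z -> md (cderive G z) <= 384 / (r - s).
  move=> zs; rewrite ler_pdivlMr//.
  have zsub : disc z (r - s) `<=` disc c r.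
    by apply: disc_sub; rewrite /cdisc /mkset in zs; lra.
  apply: bloch => //; first exact: holo_sub hG.
  move=> w0; have [w [w1 [k kE]]] := ccospi_net w0; exists w => // u /zsub ur.
  by apply/eqP => E; have := Fint u k ur; rewrite GP// E kE eqxx.
have Gp : md (G p) <= L0.
  have D : md (G p - G q) <= 384 / (r - s) * md (p - q).
    apply: cder_mean_value => t t01; exists (cderive G (q + toC t * (p - q))).
      by apply/cderiveP/hG/sub; exact: segment_disc.
    by apply: dG; exact: segment_disc.
  have pq : md (p - q) <= 2 * s.
    have := modulusB_triangle c p q; rewrite (modulusBC c q).
    by rewrite /cdisc /mkset in ps qs; lra.
  have d0 : 0 <= 384 / (r - s) by apply: divr_ge0; [exact: ler0n|exact: ltW].
  have D' := le_trans D (ler_wpM2l d0 pq).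
  by rewrite -(subrK (G q) (G p)) (le_trans (modulusD _ _))// /L0 addrC lerD.
have pr := sub p ps; have p0 := pi_ge0 R.
have Fp : md (F p) <= expR (pi * L0).
  by rewrite GP// (le_trans (ccospi_le _))// ler_expR ler_wpM2l.
have Hp : md (H p) <= expR (pi * expR (pi * L0)).
  by rewrite FP// (le_trans (ccospi_le _))// ler_expR ler_wpM2l.
have -> : h p = (H p + 1) / 2 by rewrite /H; field.
rewrite modulus_half; have := modulusD (H p) 1; rewrite modulus1.
have := expR_ge0 (pi * expR (pi * L0)); lra.
Qed.

Corollary schottky_omit (a b c : C) r s B : a != b -> 0 < s -> s < r -> exists L, forall h,
  holo (disc c r) h -> (forall z, disc c r z -> h z != a /\ h z != b) ->
  forall q p, cdisc c s q -> cdisc c s p -> md (h q) <= B -> md (h p) <= L.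
Proof.
move=> ab s0 sr; have ba : b - a != 0 by rewrite subr_eq0 eq_sym.
have m0 : 0 < md (b - a) by rewrite modulus_gt0.
have [L HL] := @schottky c r s ((B + md a) / md (b - a)) s0 sr.
exists (L * md (b - a) + md a) => h hh hab q p qs ps hq.
have E z : h z = (h z - a) / (b - a) * (b - a) + a by rewrite divfK// subrK.
have hL : md ((h p - a) / (b - a)) <= L.
apply: (HL (fun z => (h z - a) / (b - a)) _ _ q p qs ps).
- move=> z /hh[l hl]; eexists.
  by apply: cder_div (cder_cst (b - a) z) ba; exact: cderB hl (cder_cst a z).
- move=> z /hab[ha hb]; split.
    by rewrite mulf_neq0 ?invr_eq0// subr_eq0.
  by apply: contra hb => /eqP hE; rewrite (E z) hE mul1r subrK.
- rewrite modulusM modulusV ler_pM2r ?invr_gt0//.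
  by rewrite (le_trans (modulusD _ _))// modulusN lerD.
rewrite (E p) (le_trans (modulusD _ _))// lerD// modulusM.
by rewrite ler_wpM2r// ltW.
Qed.

End BlochSchottky.

(** * Montel's theorem *)

Section Montel.
Variable R : realType.
Local Notation C := (Cplx R).
Local Notation md := (@modulus R).
Implicit Types (f g h : C -> C) (z w c : C) (r s t : R).

Lemma compact_sub_cdisc (K : set C) c r : 0 < r -> compact K -> K `<=` disc c r ->
  exists s, [/\ 0 < s, s < r & K `<=` cdisc c s].
Proof.
move=> r0 cK Kr; have [K0|K0] := pselect (K !=set0); last first.
  exists (r / 2); split; [by rewrite divr_gt0|lra|].
  by move=> z Kz; exfalso; apply: K0; exists z.
have [z Kz zP] := compact_max cK K0 (fun z _ => @continuous_modulusB R c z).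
have zr : md (z - c) < r by exact: Kr.
have z0 := modulus_ge0 (z - c).
exists ((md (z - c) + r) / 2); split; [lra|lra|].
by move=> w /zP wz; rewrite /cdisc /mkset; lra.
Qed.

Lemma lipschitz_bounded c s s' r h L : s < s' -> s' < r -> holo (disc c r) h ->
  (forall z, cdisc c s' z -> md (h z) <= L) ->
  forall z w, cdisc c s z -> cdisc c s w ->
    md (h w - h z) <= 2 * L / (s' - s) * md (w - z).
Proof.
move=> ss sr hh hL z w zs ws.
have sub : cdisc c s' `<=` disc c r by move=> u us; exact: le_lt_trans us sr.
apply: cder_mean_value => t t01.
set u := z + toC t * (w - z).
have us : cdisc c s u by exact: segment_disc.
have us' : cdisc u (s' - s) `<=` cdisc c s'.
  move=> v; rewrite /cdisc /mkset in us *.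
  by have := modulusB_triangle u v c; lra.
exists (cderive h u).
  by apply/cderiveP/hh/sub/us'; rewrite /cdisc /mkset subrr modulus0 subr_ge0 ltW.
apply: cauchy_estimate; first by rewrite subr_gt0.
  exact: holo_sub (subset_trans us' sub) hh.
by move=> v vu; apply/hL/us'; rewrite /cdisc /mkset vu.
Qed.

Lemma uniform_cvgP (K : set C) (u : nat -> C -> C) g :
  (forall e : R, 0 < e -> \forall k \near \oo, forall z, K z -> md (u k z - g z) < e) ->
  {uniform K, u @ \oo --> g}.
Proof.
move=> H P /uniform_nbhs[E [entE EP]].
move: entE; rewrite -entourage_ballE => -[e /= e0 eE].
have [er eEr] : exists x, e = toC x by apply/complex_realP; rewrite gtr0_real.
have er0 : 0 < er by move: e0; rewrite eEr /toC ltcR.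
have := H er er0; apply: filterS => k Hk; apply: EP => z Kz; apply: eE.
rewrite /= -ball_normE /= normC_modulus eEr /toC ltcR modulusBC; exact: Hk.
Qed.

Lemma subsequence_choice (S : nat -> set nat) :
  (forall n N, exists2 k, (N <= k)%N & S n k) ->
  exists phi : nat -> nat, {homo phi : m n / (m < n)%N} /\ forall n, S n (phi n).
Proof.
move=> H; have H2 (p : nat * nat) : exists k, (p.2 <= k)%N /\ S p.1 k.
  by have [k ? ?] := H p.1 p.2; exists k.
have [pick pickP] := choice H2.
pose phi := fix phi n := if n is m.+1 then pick (m.+1, (phi m).+1) else pick (0%N, 0%N).
exists phi; split.
  apply: homo_ltn; first exact: ltn_trans.
  by move=> i; exact: (pickP (i.+1, (phi i).+1)).1.
by case=> [|n]; [exact: (pickP (0%N, 0%N)).2|exact: (pickP (n.+1, (phi n).+1)).2].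
Qed.

Lemma ultra_limit (U : set_system nat) (x : nat -> C) (L : R) : UltraFilter U ->
  U [set k | md (x k) <= L] -> exists l, forall e, 0 < e -> U [set k | md (x k - l) < e].
Proof.
move=> uU UL; have pU : ProperFilter U by exact: ultra_proper.
have Ux : (x @ U) (cdisc 0 L).
  have H : [set k | md (x k) <= L] `<=` x @^-1` cdisc 0 L.
    by move=> k; rewrite /preimage /cdisc /mkset subr0.
  exact: filterS H UL.
have [l [_ lP]] := @compact_cdisc R 0 L (x @ U) _ Ux.
exists l => e e0.
have [//|NU] := in_ultra_setVsetC [set k | md (x k - l) < e] uU.
have xN : (x @ U) (~` disc l e) by exact: NU.
by have [w [wN wd]] := lP _ _ xN (nbhs_disc l e0).
Qed.

(* The limit is taken along an ultrafilter refining the indices at which the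
   sequence is bounded at the centre; equicontinuity makes it locally uniform. *)
Lemma montel_bounded (a b c : C) r (u : nat -> C -> C) B : a != b -> 0 < r ->
  (forall k, holo (disc c r) (u k)) ->
  (forall k z, disc c r z -> u k z != a /\ u k z != b) ->
  (forall N, exists2 k, (N <= k)%N & md (u k c) <= B) ->
  exists phi : nat -> nat, {homo phi : m n / (m < n)%N} /\
    exists g : C -> C, forall K : set C, compact K -> K `<=` disc c r ->
        {uniform K, (fun k => u (phi k)) @ \oo --> g}.
Proof.
move=> ab r0 hu uab uB.
pose D := [set k | md (u k c) <= B].
have pD : ProperFilter (within D \oo).
  split; last exact: within_filter.
  by move=> [N _ HN]; have [k Nk Dk] := uB N; exact: (HN k Nk Dk).
have [U [uU DU]] := ultraFilterLemma pD.
have UD : U D by apply: DU; exists 0%N.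
have Uge N : U [set k | (N <= k)%N].
  by apply: DU; exists N => // k /= Nk _.
have cofinal S : U S -> forall N, exists2 k, (N <= k)%N & S k.
  move=> US N; have : U (S `&` [set k | (N <= k)%N]) by exact: filterI.
  by move/filter_ex => [k [Sk Nk]]; exists k.
have bounded s : 0 < s -> s < r -> exists L, forall k, D k -> forall z, cdisc c s z -> md (u k
  z) <= L.
  move=> s0 sr; have [L HL] := @schottky_omit R a b c r s B ab s0 sr.
  exists L => k Dk z zs; apply: (HL (u k) (hu k) (uab k) c z) => //.
  by rewrite /cdisc /mkset subrr modulus0 ltW.
have H z : exists l, disc c r z -> forall e, 0 < e -> U [set k | md (u k z - l) < e].
  have [zr|nzr] := pselect (disc c r z); last by exists 0.
  rewrite /disc /mkset in zr; have z0 := modulus_ge0 (z - c).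
  have [||L HL] := bounded ((md (z - c) + r) / 2); [lra|lra|].
  have [|l lP] := @ultra_limit U (fun k => u k z) L uU.
    by apply: filterS UD => k /HL; apply; rewrite /cdisc /mkset; lra.
  by exists l.
have [g gP] := choice H.
have unif s e : 0 < s -> s < r -> 0 < e ->
    U [set k | forall z, cdisc c s z -> md (u k z - g z) <= e].
  move=> s0 sr e0.
  pose s' := (s + r) / 2.
  have ss' : s < s' by rewrite /s'; lra.
  have s'r : s' < r by rewrite /s'; lra.
  have [L HL] := bounded s' (lt_trans s0 ss') s'r.
  have sub : cdisc c s `<=` disc c r by move=> v vs; exact: le_lt_trans vs sr.
  pose M := `|2 * L / (s' - s)| + 1.
  have M0 : 0 < M by rewrite ltr_wpDl.
  have lip k : D k -> forall z w, cdisc c s z -> cdisc c s w ->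
      md (u k w - u k z) <= M * md (w - z).
    move=> Dk z w zs ws.
    apply: le_trans (lipschitz_bounded ss' s'r (hu k) (HL k Dk) zs ws) _.
    rewrite ler_wpM2r ?modulus_ge0// /M (le_trans (ler_norm _))//.
    by rewrite lerDl.
  have lipg z w : cdisc c s z -> cdisc c s w -> md (g w - g z) <= M * md (w - z).
    move=> zs ws; apply/ler_addgt0Pr => d d0.
    have d2 : 0 < d / 2 by rewrite divr_gt0.
    have : U (D `&` ([set k | md (u k z - g z) < d / 2] `&` [set k | md (u k w - g w) < d / 2])).
      by apply: filterI => //; apply: filterI; apply: gP => //; exact: sub.
    move/filter_ex => [k [Dk [/= k1 k2]]].
    have := lip k Dk z w zs ws.
    have := modulusB_triangle (u k w) (g w) (g z).
    have := modulusB_triangle (u k z) (u k w) (g z).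
    rewrite (modulusBC (g w) (u k w)); lra.
  (* Compactness in covering form along [U] turns pointwise limits into a uniform one: near [z] the
     error is [e / 2] at [z] plus two Lipschitz terms of at most [e / 4]. *)
  have := @compact_cdisc R c s; rewrite compact_near_coveringP => nc.
  pose P k z := cdisc c s z -> md (u k z - g z) <= e.
  suff nP : forall z, cdisc c s z -> \near z & U, P U z.
    have H2 : [set k | cdisc c s `<=` P k] `<=` [set k | forall z, cdisc c s z -> md (u k z - g
      z) <= e].
      by move=> k Hk z zs; exact: Hk.
    exact: filterS H2 (nc nat U P _ nP).
  move=> z zs.
  have e2 : 0 < e / 2 by rewrite divr_gt0.
  pose d := e / 2 / (2 * M).
  have d0 : 0 < d by rewrite divr_gt0// mulr_gt0.
  exists (disc z d, D `&` [set k | md (u k z - g z) < e / 2]).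
    split; first exact: nbhs_disc.
    by apply: filterI => //; apply: gP => //; exact: sub.
  move=> [w k] /= [wz [Dk kz]] ws.
  have h1 := lip k Dk z w zs ws; have h2 := lipg w z ws zs.
  have h3 : M * md (w - z) <= e / 4.
    rewrite (_ : e / 4 = M * d); last by rewrite /d; field; rewrite gt_eqF.
    by rewrite ler_wpM2l// ltW.
  rewrite (modulusBC z w) in h2.
  have := modulusB_triangle (u k z) (u k w) (g w).
  have := modulusB_triangle (g z) (u k z) (g w); lra.
(* The radii tend to [r]; [n.+2] keeps the first one positive. *)
pose rad n : R := r * (1 - n.+2%:R^-1).
have rad01 n : 0 < rad n /\ rad n < r.
  have n0 : 0 < (n.+2%:R : R) by rewrite ltr0n.
  have i1 : n.+2%:R^-1 < 1 :> R by rewrite invf_lt1// ltr1n.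
  have i0 : 0 < n.+2%:R^-1 :> R by rewrite invr_gt0.
  rewrite /rad; split; first by rewrite mulr_gt0// subr_gt0.
  by rewrite gtr_pMr// ltrBlDr ltrDl.
pose S n := [set k | forall z, cdisc c (rad n) z -> md (u k z - g z) <= n.+1%:R^-1].
have [phi [phim phiS]] := @subsequence_choice S (fun n => cofinal (S n)
  (unif _ _ (rad01 n).1 (rad01 n).2 (ltac:(by rewrite invr_gt0 ltr0n) : 0 < n.+1%:R^-1 :> R))).
exists phi; split=> //; exists g => K cK Kr.
have [s [s0 sr Ks]] := compact_sub_cdisc r0 cK Kr.
apply: uniform_cvgP => e e0.
have inv_small (x : R) : 0 < x -> exists N, forall n, (N <= n)%N -> n.+1%:R^-1 < x.
  move=> x0; exists (Num.truncn x^-1) => n Nn.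
  rewrite invf_plt ?posrE ?ltr0n// (lt_le_trans (truncnS_gt _))//.
  by rewrite ler_nat.
have [N1 HN1] := inv_small e e0.
have [N2 HN2] := inv_small (1 - s / r) (ltac:(by rewrite subr_gt0 ltr_pdivrMr// mul1r) : 0 < 1
  - s / r).
near=> n.
move=> z /Ks zs; apply: (@le_lt_trans _ _ n.+1%:R^-1).
  apply: (phiS n); rewrite /cdisc /mkset in zs *; apply: (le_trans zs).
  have h : n.+2%:R^-1 < 1 - s / r by apply: (HN2 n.+1); apply: leqW; near: n; exact:
    nbhs_infty_ge.
  by rewrite /rad mulrC -ler_pdivrMr// lerBrDr -lerBrDl ltW.
by apply: HN1; near: n; exact: nbhs_infty_ge.
Unshelve. all: by end_near. Qed.

Theorem montel (a b c : C) r (u : nat -> C -> C) : a != b -> 0 < r ->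
  (forall k, holo (disc c r) (u k)) ->
  (forall k z, disc c r z -> u k z != a /\ u k z != b) ->
  exists phi : nat -> nat, {homo phi : m n / (m < n)%N} /\
    ((exists g : C -> C, forall K : set C, compact K -> K `<=` disc c r ->
        {uniform K, (fun k => u (phi k)) @ \oo --> g}) \/
     (forall K : set C, compact K -> K `<=` disc c r ->
        forall B : R, \forall k \near \oo,
          forall z, K z -> B < md (u (phi k) z))).
Proof.
move=> ab r0 hu uab.
(* Either infinitely many members share a bound at the centre, or the values there tend to
   infinity. *)
have [[B HB]|N] := pselect (exists B, forall N, exists2 k, (N <= k)%N & md (u k c) <= B).
  have [phi [phim gP]] := montel_bounded ab r0 hu uab HB.
  by exists phi; split=> //; left.
exists id; split=> //; right => K cK Kr B.
have [s [s0 sr Ks]] := compact_sub_cdisc r0 cK Kr.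
(* Schottky's estimate is read from [z] to the centre: a value of modulus at most [B] at a point of
   [K] would keep the value at [c] below [L]. *)
have [L HL] := @schottky_omit R a b c r s B ab s0 sr.
have [M HM] : exists M, forall k, (M <= k)%N -> L < md (u k c).
  apply: contrapT => NM; apply: N; exists L => M; apply: contrapT => Nk.
  apply: NM; exists M => k Mk; rewrite ltNge; apply/negP => kL.
  by apply: Nk; exists k.
near=> k => z /Ks zs; rewrite ltNge; apply/negP => zB.
have cc : cdisc c s c by rewrite /cdisc /mkset subrr modulus0 ltW.
have := HL (u k) (hu k) (uab k) z c zs cc zB; rewrite leNgt HM//.
by near: k; exact: nbhs_infty_ge.
Unshelve. all: by end_near. Qed.

End Montel.

(** * Entire functions *)

Section Entire.
Variable R : realType.
Local Notation C := (Cplx R).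
Local Notation md := (@modulus R).
Implicit Types (f g h : C -> C) (z w : C) (r b : R).

Lemma le_geometric0 (x H : R) : 0 <= x -> (forall n, x <= H / 2 ^+ n) -> x = 0.
Proof.
move=> x0 xH; apply/eqP; rewrite eq_le x0 andbT leNgt; apply/negP => xp.
have H1 : H / x < 2 ^+ (Num.truncn (H / x)).+1.
  by rewrite (lt_trans (truncnS_gt _))// -natrX ltr_nat ltn_expl.
have := xH (Num.truncn (H / x)).+1; rewrite leNgt => /negP; apply.
by rewrite ltr_pdivrMr ?exprn_gt0// mulrC -ltr_pdivrMr.
Qed.

Lemma holo_bounded f r : holo setT f -> exists2 H, 0 <= H & forall z, md z <= r -> md (f z) <= H.
Proof.
move=> hf; have [r0|r0] := leP 0 r; last first.
  by exists 0 => // z; have := modulus_ge0 z; lra.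
have [||z _ zP] := @compact_max R (cdisc 0 r) (fun z => md (f z)) (@compact_cdisc R 0 r).
- by exists (0 : C); rewrite /cdisc /mkset subrr modulus0.
- move=> z _; have [l /cder_continuous cf] := hf z I.
  exact: continuous_comp cf (@continuous_modulus R _).
exists (md (f z)); first exact: modulus_ge0.
by move=> w wr; apply: zP; rewrite /cdisc /mkset subr0.
Qed.

Lemma dquot_entire f z : holo setT f -> holo setT (dquot f z (cderive f z)).
Proof. by move=> hf; apply: (@dquot_holo R setT f z 1). Qed.

(** Were [h] divisible by every power of [z - z0], the maximum principle on a circle about [z0] of
    radius more than [2 |z - z0|] would give [|h z| <= M / 2^n] for all [n]. *)
Lemma zero_order h z0 : holo setT h -> (exists z, h z != 0) ->
  exists m g, [/\ holo setT g, g z0 != 0 & forall z, h z = (z - z0) ^+ m * g z].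
Proof.
move=> hh [z hz]; apply: contrapT => N.
have H n : exists g, [/\ holo setT g, g z0 = 0 & forall z, h z = (z - z0) ^+ n * g z].
  elim: n => [|n [g [hg g0 gE]]].
    exists h; split=> //; last by move=> w; rewrite expr0 mul1r.
    apply/eqP/negP => /negP h0; apply: N; exists 0%N, h; split=> // w.
    by rewrite expr0 mul1r.
  have hq := dquot_entire z0 hg.
  have E w : h w = (w - z0) ^+ n.+1 * dquot g z0 (cderive g z0) w.
    by rewrite gE {1}(dquotE g z0 (cderive g z0) w) g0 add0r exprSr mulrA.
  exists (dquot g z0 (cderive g z0)); split=> //.
  by apply/eqP/negP => /negP q0; apply: N; exists n.+1, (dquot g z0 (cderive g z0)).
pose r := 2 * md (z - z0) + 1; have m0 := modulus_ge0 (z - z0).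
have r0 : 0 < r by rewrite /r; lra.
have [M M0 hM] := holo_bounded (r + md z0) hh.
suff : md (h z) = 0 by move/eqP; rewrite modulus_eq0 (negPf hz).
apply: (@le_geometric0 _ M); first exact: modulus_ge0.
move=> n; have [g [hg _ gE]] := H n.
have gM : md (g z) <= M / r ^+ n.
  apply: (@maximum_disc R z0 r g).
  - by rewrite divr_ge0 ?exprn_ge0// ltW.
  - exact: holo_sub hg.
  - move=> w wr; rewrite ler_pdivlMr ?exprn_gt0// mulrC -wr -modulusX -modulusM -gE.
    by apply: hM; rewrite -(subrK z0 w) (le_trans (modulusD _ _))// wr.
  by rewrite /cdisc /mkset /r; lra.
rewrite gE modulusM modulusX.
apply: (@le_trans _ _ ((r / 2) ^+ n * (M / r ^+ n))).
  rewrite ler_pM ?exprn_ge0 ?modulus_ge0// lerXn2r ?nnegrE ?modulus_ge0//.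
    by rewrite divr_ge0// ltW.
  by rewrite /r; lra.
rewrite expr_div_n le_eqVlt; apply/orP; left; apply/eqP.
have : r ^+ n != 0 by rewrite expf_neq0// gt_eqF.
have : 2 ^+ n != 0 :> R by rewrite expf_neq0// pnatr_eq0.
by move: (r ^+ n) (2 ^+ n) => x y y0 x0; field; rewrite x0 y0.
Qed.

Lemma compact_circle z r : compact [set w : C | md (w - z) = r].
Proof.
apply: subclosed_compact (@compact_cdisc R z r) _; last by move=> w /= wr; rewrite /cdisc
  /mkset wr.
rewrite (_ : [set w | _] = (fun w => md (w - z)) @^-1` [set x | x = r])//.
apply: closed_comp => [w _|]; first exact: continuous_modulusB.
exact: closed_eq.
Qed.

(** Factoring out the zero of [f - f z0] shows that it has no zero on a small circle; [minimum_disc]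
    then solves [f = v] for [v] within half of the minimum of its modulus there. *)
Theorem open_mapping f (O : set C) : holo setT f -> (exists z w, f z != f w) ->
  open O -> open (f @` O).
Proof.
move=> hf [z1 [z2 f12]] oO; rewrite openE => _ [z0 Oz0 <-].
have hh : holo setT (fun z => f z - f z0).
  by move=> z _; have [l fl] := hf z I; eexists; exact: cderB fl (cder_cst _ z).
have [|m [g [hg g0 gE]]] := @zero_order _ z0 hh.
  have [E|N] := eqVneq (f z1) (f z0); last by exists z1; rewrite subr_eq0.
  by exists z2; rewrite subr_eq0 -E eq_sym.
have [e e0 eO] : exists2 e, 0 < e & disc z0 e `<=` O.
  by have /nbhs_modulusP := open_nbhs_nbhs (conj oO Oz0).
have [l /cder_continuous/continuous_modulusP cg] := hg z0 I.
have [|d d0 dg] := cg (md (g z0)); first by rewrite modulus_gt0.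
pose r := Num.min e d / 2.
have r0 : 0 < r by rewrite divr_gt0// lt_min e0.
have re : r < e.
  have : Num.min e d <= e by rewrite ge_min lexx.
  by rewrite /r; move: r0; rewrite /r; lra.
have rd : r < d.
  have : Num.min e d <= d by rewrite ge_min lexx orbT.
  by rewrite /r; move: r0; rewrite /r; lra.
have h0 w : md (w - z0) = r -> f w - f z0 != 0.
  move=> wr; rewrite gE mulf_neq0//.
    by rewrite expf_neq0// -modulus_gt0 wr.
  have := dg w; rewrite wr => /(_ rd); apply: contraTneq => ->.
  by rewrite sub0r modulusN ltxx.
have [||w0 w0r w0P] := @compact_min R _ (fun w => md (f w - f z0)) (@compact_circle z0 r).
- by have [w wr] := circle_point z0 (ltW r0); exists w.
- move=> z _; have [k /cder_continuous ch] := hh z I.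
  exact: continuous_comp ch (@continuous_modulus R _).
have d1 : 0 < md (f w0 - f z0) by rewrite modulus_gt0 h0.
apply/nbhs_modulusP; exists (md (f w0 - f z0) / 2); first by rewrite divr_gt0.
move=> v vd.
have [||||u ur /eqP] := @minimum_disc R z0 r (fun w => f w - v) (md (f w0 - f z0) / 2).
- exact: r0.
- by move=> w _; have [k fk] := hf w I; eexists; exact: cderB fk (cder_cst v w).
- move=> w wr; have := w0P w wr.
  have := modulusB_triangle v (f w) (f z0); lra.
- by rewrite modulusBC.
rewrite subr_eq0 => /eqP uv; exists u => //; apply: eO.
exact: lt_trans ur re.
Qed.

Lemma entire_eq0 f : holo setT f -> (forall e, 0 < e -> forall b, exists r,
   [/\ b <= r, 0 < r & forall z, md z = r -> md (f z) <= e]) -> forall z, f z = 0.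
Proof.
move=> hf H z; apply/eqP; rewrite -modulus_eq0 eq_le modulus_ge0 andbT.
apply/ler_addgt0Pr => e e0; rewrite add0r.
have [r [zr r0 fr]] := H e e0 (md z).
apply: (@maximum_disc R 0 r f).
- exact: ltW.
- exact: holo_sub hf.
- by move=> w; rewrite subr0; exact: fr.
by rewrite /cdisc /mkset subr0.
Qed.

(** The difference quotient at 0 lowers the exponent by one. Circles of unbounded radii suffice, and
    the negation of superpolynomial growth provides no more than these. *)
Theorem polynomial_growth f (K : R) n : holo setT f ->
  (forall b, exists r, [/\ b <= r, 0 < r & forall z, md z = r -> md (f z) <= K * r ^+ n]) ->
  exists p : {poly C}, forall z, f z = p.[z].
Proof.
elim: n f K => [|n IH] f K hf H; pose q := dquot f 0 (cderive f 0).
  have q0 : forall z, q z = 0.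
    apply: entire_eq0 (dquot_entire 0 hf) _ => e e0 b.
    have [r [br r0 fr]] := H (Num.max b (`|K + md (f 0)| / e)).
    exists r; rewrite ge_max in br; have [b1 b2] := andP br; split=> // z zr.
    have z0 : z != 0 by rewrite -modulus_gt0 zr.
    rewrite dquot_neq// subr0 modulusM modulusV zr ler_pdivrMr//.
    rewrite (le_trans (modulusD _ _))// modulusN.
    have := fr z zr; rewrite expr0 mulr1.
    rewrite ler_pdivrMr// mulrC in b2; have := ler_norm (K + md (f 0)); lra.
  exists (f 0)%:P => z; rewrite hornerC (dquotE f 0 (cderive f 0) z) -/q q0.
  by rewrite mulr0 addr0.
have [|p pE] := IH q (`|K| + md (f 0)) (dquot_entire 0 hf).
  move=> b; have [r [br r0 fr]] := H (Num.max b 1).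
  exists r; rewrite ge_max in br; have [b1 b2] := andP br; split=> // z zr.
  have z0 : z != 0 by rewrite -modulus_gt0 zr.
  rewrite /q dquot_neq// subr0 modulusM modulusV zr ler_pdivrMr//.
  rewrite (le_trans (modulusD _ _))// modulusN -mulrA -exprSr mulrDl lerD//.
    rewrite (le_trans (fr z zr))// ler_wpM2r ?ler_norm// exprn_ge0 ?ltW//.
  by rewrite ler_peMr ?modulus_ge0// exprn_ege1.
exists ((f 0)%:P + 'X * p) => z.
by rewrite hornerD hornerM hornerC hornerX -pE (dquotE f 0 (cderive f 0) z) subr0.
Qed.

Theorem finite_zeros h b : holo setT h -> (exists z, h z != 0) ->
  (forall z, h z = 0 -> md z <= b) ->
  exists (s : seq C) g, [/\ holo setT g, forall z, g z != 0,
    forall a, a \in s -> md a <= b & forall z, h z = (\prod_(a <- s) (z - a)) * g z].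
Proof.
move=> hh [z0 hz0] hb; apply: contrapT => N.
have H n : exists (s : seq C) g, [/\ size s = n, holo setT g,
    forall a, a \in s -> md a <= b & forall z, h z = (\prod_(a <- s) (z - a)) * g z].
  elim: n => [|n [s [g [sn hg sb gE]]]].
    by exists [::], h; split=> // z; rewrite big_nil mul1r.
  have [a ga] : exists a, g a = 0.
    apply: contrapT => Na; apply: N; exists s, g; split=> // z.
    by apply/eqP => gz; apply: Na; exists z.
  exists (a :: s), (dquot g a (cderive g a)); split.
  - by rewrite /= sn.
  - exact: dquot_entire.
  - move=> c; rewrite inE => /orP[/eqP->|/sb//]; apply: hb.
    by rewrite gE ga mulr0.
  - move=> z; rewrite gE {1}(dquotE g a (cderive g a) z) ga add0r big_cons.
    by rewrite mulrCA mulrA.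
(* Each factor [w - a] has modulus at least [4 B] on the circle of radius [5 B] and at most [2 B] at
   [z0], so dividing out [n] zeros gives [|h z0| <= M / 2^n]. *)
pose B := Num.max `|b| (md z0) + 1.
have B0 : 0 < B by rewrite ltr_wpDl// le_max normr_ge0.
have bB : b <= B.
  rewrite (le_trans (ler_norm b))// (@le_trans _ _ (Num.max `|b| (md z0)))//.
    by rewrite le_max lexx.
  by rewrite lerDl.
have zB : md z0 <= B.
  by rewrite (@le_trans _ _ (Num.max `|b| (md z0)))// ?lerDl// le_max lexx orbT.
have [M M0 hM] := holo_bounded (5 * B) hh.
suff : md (h z0) = 0 by move/eqP; rewrite modulus_eq0 (negPf hz0).
apply: (@le_geometric0 _ M); first exact: modulus_ge0.
move=> n; have [s [g [sn hg sb gE]]] := H n.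
have B4 : 0 < 4 * B by rewrite mulr_gt0.
have lower w : md w = 5 * B -> (4 * B) ^+ n <= md (\prod_(a <- s) (w - a)).
  move=> wB; rewrite -sn; elim: s sb {sn gE} => [|a s IH] sb.
    by rewrite expr0 big_nil modulus1.
  rewrite /= exprS big_cons modulusM ler_pM ?exprn_ge0// ?(ltW B4)//.
    by have := modulus_leB w a; have := sb a (mem_head _ _); lra.
  by apply: IH => c cs; apply: sb; rewrite inE cs orbT.
have upper : md (\prod_(a <- s) (z0 - a)) <= (2 * B) ^+ n.
  rewrite -sn; elim: s sb {sn gE lower} => [|a s IH] sb.
    by rewrite expr0 big_nil modulus1.
  rewrite /= exprS big_cons modulusM ler_pM ?modulus_ge0//.
    by have := modulusD z0 (- a); rewrite modulusN; have := sb a (mem_head _ _); lra.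
  by apply: IH => c cs; apply: sb; rewrite inE cs orbT.
have gM : md (g z0) <= M / (4 * B) ^+ n.
  apply: (@maximum_disc R 0 (5 * B) g).
  - by rewrite divr_ge0 ?exprn_ge0// ltW.
  - exact: holo_sub hg.
  - move=> w; rewrite subr0 => wB; rewrite ler_pdivlMr ?exprn_gt0//.
    apply: (@le_trans _ _ (md (h w))); last by apply: hM; rewrite wB.
    by rewrite gE modulusM mulrC ler_wpM2r ?modulus_ge0// lower.
  by rewrite /cdisc /mkset subr0; lra.
rewrite gE modulusM.
apply: (@le_trans _ _ ((2 * B) ^+ n * (M / (4 * B) ^+ n))).
  by rewrite ler_pM ?modulus_ge0.
rewrite (_ : 4 * B = 2 * (2 * B)); last by ring.
rewrite [(2 * (2 * B)) ^+ n]exprMn.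
have : (2 * B) ^+ n != 0 by rewrite expf_neq0// gt_eqF// mulr_gt0.
have : 2 ^+ n != 0 :> R by rewrite expf_neq0// pnatr_eq0.
move: ((2 * B) ^+ n) (2 ^+ n) => x y y0 x0.
by rewrite le_eqVlt; apply/orP; left; apply/eqP; field; rewrite x0 y0.
Qed.

End Entire.

(** * Spiders' webs of fast escaping points *)

Section PlaneTopology.
Variable R : realType.
Local Notation C := (Cplx R).
Local Notation md := (@modulus R).
Implicit Types (z w : C) (r : R).

Lemma connected_segment z w : connected [set z + toC t * (w - z) | t in `[0, 1]%classic].
Proof.
apply: connected_continuous_connected; first exact: segment_connected.
apply: continuous_subspaceT; apply: (@continuous_line R id z (w - z)).
by move=> x; exact: cvg_id.
Qed.

Lemma connected_disc z r : connected (disc z r).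
Proof.
have [r0|r0] := ltP 0 r; last first.
  rewrite (_ : disc z r = set0); first exact: connected0.
  by apply/seteqP; split=> // w; rewrite /disc /mkset; have := modulus_ge0 (w - z); lra.
have zz := disc_center z r0.
rewrite (_ : disc z r = connected_component (disc z r) z).
  exact: component_connected.
apply/seteqP; split; last exact: connected_component_sub.
move=> w wr; apply: (@connected_component_max _ _ [set z + toC t * (w - z) | t in `[0,
  1]%classic] z).
- by exists 0; rewrite /= ?in_itv /= ?lexx ?ler01// toC0 mul0r addr0.
- by move=> _ [t /= t01 <-]; apply: segment_disc_lt => //; rewrite in_itv in t01.
- exact: connected_segment.
- by exists 1; rewrite /= ?in_itv /= ?lexx ?ler01// toC1 mul1r addrC subrK.
Qed.

(** Since [S] misses the frontier of [O], its trace on [O] is its trace on the closure of [O], hence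
    both open and closed in [S]. *)
Lemma connected_inside (T : topologicalType) (S O : set T) x : connected S -> open O ->
  S x -> O x -> (forall y, closure O y -> ~ O y -> ~ S y) -> S `<=` O.
Proof.
move=> cS oO Sx Ox bO.
have -> : S = S `&` O.
  apply/esym/cS; first by exists x.
    by exists O.
  exists (closure O); first exact: closed_closure.
  apply/seteqP; split=> y [Sy Oy]; split=> //; first exact: subset_closure.
  by apply: contrapT => nOy; exact: bO Oy nOy Sy.
by move=> y [].
Qed.

Lemma bounded_set_modulus (A : set C) : bounded_set A -> exists B : R, forall z, A z -> md z <= B.
Proof.
move=> [M [Mr MA]].
have [m mE] : exists m, M = toC m by apply/complex_realP.
exists (m + 1) => z Az; have := MA (toC (m + 1)).
rewrite mE /toC ltcR ltrDl ltr01 => /(_ isT z Az).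
by rewrite /= normC_modulus /toC lecR.
Qed.

Lemma closure_bounded (A : set C) B : (forall z, A z -> md z <= B) ->
  forall z, closure A z -> md z <= B.
Proof.
move=> AB z Az; have : cdisc 0 B z.
  have /closure_id -> : closed (cdisc (0 : C) B) by exact: closed_cdisc.
  by apply: closure_subset Az => w /AB; rewrite /cdisc /mkset subr0.
by rewrite /cdisc /mkset subr0.
Qed.

End PlaneTopology.

(** The recursion carries the list of all earlier terms, since a new term has to avoid each of them.
    It serves for the choice of points in distinct components and again for the final sequence. *)
Lemma avoiding_sequence (T : eqType) (P : nat -> T -> Prop) (r : T -> T -> Prop) :
  (forall n (s : seq T), (forall y, y \in s -> exists m, P m y) ->
     exists x, P n x /\ forall y, y \in s -> ~ r y x) ->
  exists x : nat -> T, forall n, P n (x n) /\ forall i, (i < n)%N -> ~ r (x i) (x n).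
Proof.
move=> H.
have H2 (p : nat * seq T) : exists x, (forall y, y \in p.2 -> exists m, P m y) ->
    P p.1 x /\ forall y, y \in p.2 -> ~ r y x.
  have [/(H p.1 p.2)[x xP]|N] := pselect (forall y, y \in p.2 -> exists m, P m y).
    by exists x.
  have [x _] := H 0%N [::] (fun y => ltac:(by [])).
  by exists x.
have [pick pickP] := choice H2.
pose L := fix L n := if n is m.+1 then pick (m, L m) :: L m else [::].
have good n : forall y, y \in L n -> exists m, P m y.
  elim: n => [//|n IH] y /=; rewrite inE => /orP[/eqP->|]; last exact: IH.
  by exists n; exact: (pickP (n, L n) IH).1.
have memL i n : (i < n)%N -> pick (i, L i) \in L n.
  elim: n => [//|n IH]; rewrite ltnS leq_eqVlt => /orP[/eqP->|/IH] /=.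
    by rewrite inE eqxx.
  by rewrite inE => ->; rewrite orbT.
exists (fun n => pick (n, L n)) => n; have [h1 h2] := pickP (n, L n) (good n).
by split=> // i /memL; exact: h2.
Qed.

(** * Growth of iterates and the fast escaping set *)

Section Dynamics.
Variables (R : realType) (f : Cplx R -> Cplx R) (rho : R).
Local Notation C := (Cplx R).
Local Notation md := (@modulus R).
Hypothesis hf : holo setT f.
Hypothesis not_poly : ~ exists p : {poly C}, forall z, f z = p.[z].
Hypothesis rho0 : 0 < rho.
Hypothesis M_gt : forall r : R, rho <= r -> r < max_modulus f r.

Local Notation M := (max_modulus f).
Local Notation Mn n := (iter n M rho).
Local Notation A := (fast_escaping_set f rho).
Local Notation E := (~` A).
Implicit Types (z w : C) (r : R).

Lemma le_max_modulus z r : md z = r -> md (f z) <= M r.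
Proof.
move=> zr; apply: ub_le_sup; last by exists z.
have [H _ fH] := holo_bounded r hf.
by exists H => _ [w /= wr <-]; apply: fH; rewrite wr.
Qed.

Lemma le_max_modulus_disc z r : 0 < r -> md z <= r -> md (f z) <= M r.
Proof.
move=> r0 zr; apply: (@maximum_disc R 0 r f).
- have [w wr] := circle_point (0 : C) (ltW r0); rewrite subr0 in wr.
  exact: le_trans (modulus_ge0 _) (le_max_modulus wr).
- exact: holo_sub hf.
- by move=> w; rewrite subr0; exact: le_max_modulus.
- by rewrite /cdisc /mkset subr0.
Qed.

Lemma iter_max_modulus_ge n : rho <= Mn n.
Proof. by elim: n => [//|n IH] /=; exact: le_trans IH (ltW (M_gt IH)). Qed.

Lemma iter_max_modulus_gt0 n : 0 < Mn n.
Proof. exact: lt_le_trans rho0 (iter_max_modulus_ge n). Qed.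

Lemma iter_max_modulus_ltS n : Mn n < Mn n.+1.
Proof. exact: M_gt (iter_max_modulus_ge n). Qed.

Lemma iter_max_modulus_lt m n : (m < n)%N -> Mn m < Mn n.
Proof. by apply: (homo_ltn (f := fun n => Mn n) lt_trans) => i; exact: iter_max_modulus_ltS. Qed.

Lemma iter_max_modulus_le m n : (m <= n)%N -> Mn m <= Mn n.
Proof. by rewrite leq_eqVlt => /orP[/eqP->//|/iter_max_modulus_lt/ltW]. Qed.

(** At a finite supremum [s], some [z] of modulus [s] has [|f z| > s]. By continuity [|f w| > s] at
    a point [w] slightly nearer to 0; but [|w| <= M^n(rho)] for some [n], whence
    [|f w| <= M^(n+1)(rho) <= s]. *)
Lemma iter_max_modulus_unbounded b : exists n, b < Mn n.
Proof.
apply: contrapT => N.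
have Nb n : Mn n <= b by rewrite leNgt; apply/negP => H; apply: N; exists n.
pose S := range (fun n => Mn n).
have hs : has_sup S by split; [exists rho, 0%N|exists b => _ [n _ <-]].
set s := sup S.
have Ms n : Mn n <= s by apply: ub_le_sup; [exact: hs.2|exists n].
have s0 : 0 < s by exact: lt_le_trans rho0 (Ms 0%N).
have sM : s < M s by apply: M_gt; exact: Ms 0%N.
have [z zs fz] : exists2 z, md z = s & s < md (f z).
  apply: contrapT => Nz; move: sM; rewrite ltNge => /negP; apply.
  apply: ge_sup.
    by have [w ws] := circle_point (0 : C) (ltW s0); exists (md (f w)), w; rewrite //= -ws subr0.
  move=> _ [z /= zs <-]; rewrite leNgt; apply/negP => H; apply: Nz; exists z => //.
have [l /cder_continuous/continuous_modulusP cf] := @hf z I.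
have [|d d0 dH] := cf (md (f z) - s); first by rewrite subr_gt0.
pose t := Num.min (1 / 2) (d / (2 * s)).
have t0 : 0 < t by rewrite lt_min !divr_gt0// mulr_gt0.
have t1 : t <= 1 / 2 by rewrite ge_min lexx.
have td : t * (2 * s) <= d by rewrite -ler_pdivlMr ?mulr_gt0// ge_min lexx orbT.
pose w := z - toC t * z.
have wz : md (w - z) < d.
  rewrite /w (_ : _ - _ - z = - (toC t * z)); last by ring.
  rewrite modulusN modulusM modulus_toC zs gtr0_norm//.
  have : 0 < t * s by rewrite mulr_gt0.
  by lra.
have ws : md w < s.
  rewrite /w (_ : _ - _ = toC (1 - t) * z); last by rewrite toCB toC1; ring.
  rewrite modulusM modulus_toC zs ger0_norm; last by lra.
  by rewrite gtr_pMl//; lra.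
have [_ [n _ <-] wn] := sup_adherent (ltac:(by rewrite subr_gt0) : 0 < s - md w) hs.
rewrite -/s opprB addrCA subrr addr0 in wn.
have := le_max_modulus_disc (iter_max_modulus_gt0 n) (ltW wn); have := Ms n.+1 => /= h1 h2.
have := dH w wz; have := modulus_leB (f z) (f w); rewrite modulusBC; lra.
Qed.

Lemma iter_le_max_modulus n p z : md z <= Mn p -> md (iter n f z) <= Mn (n + p).
Proof.
move=> zp; elim: n => [//|n IH]; rewrite addSn /=.
exact: le_max_modulus_disc (iter_max_modulus_gt0 _) IH.
Qed.

Lemma holo_iter n : holo setT (iter n f).
Proof.
elim: n => [|n IH] z _; first by exists 1; exact: cder_id.
have [l fl] := IH z I; have [k fk] := @hf (iter n f z) I.
by eexists; exact: cder_comp fl fk.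
Qed.

Lemma continuous_iter n : continuous (iter n f).
Proof. by move=> z; have [l /cder_continuous] := @holo_iter n z I. Qed.

Lemma nonconstant : exists z w, f z != f w.
Proof.
apply: contrapT => N; apply: not_poly; exists (f 0)%:P => z; rewrite hornerC.
by apply/eqP/negP => /negP H; apply: N; exists z, 0.
Qed.

Lemma open_iter n (O : set C) : open O -> open (iter n f @` O).
Proof.
move=> oO; elim: n => [|n IH]; first by rewrite (_ : _ @` _ = O)// image_id.
rewrite (_ : _ @` _ = f @` (iter n f @` O)); first exact: open_mapping hf nonconstant IH.
by rewrite -image_comp.
Qed.

Lemma fast_escaping_iter n z : A (iter n f z) <-> A z.
Proof.
elim: n z => [//|n IH] z; rewrite iterSr IH; split=> -[L L0 H].
  by exists L.+1 => // m m0; rewrite addnS iterSr; exact: H.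
exists L => // m m0; rewrite -iterSr -addSn.
by rewrite (le_trans _ (H m.+1 _))// ltW// iter_max_modulus_ltS.
Qed.

Lemma level_fast_escaping : fast_escaping_level f rho `<=` A.
Proof.
(* The definition asks for a positive [L], so one step of growth is given away. *)
move=> z H; exists 1%N => // n n0; rewrite addn1.
by rewrite (le_trans _ (H n.+1 _))// ltW// iter_max_modulus_ltS.
Qed.

(** * Components of the complement of the fast escaping set *)

Section Web.
Variable G : nat -> set C.
Hypothesis G_bounded : forall n, exists B : R, forall z, G n z -> md z <= B.
Hypothesis G_open : forall n, open (G n).
Hypothesis G_mono : forall n, G n `<=` G n.+1.
Hypothesis G_boundary : forall n, boundary (G n) `<=` fast_escaping_level f rho.
Hypothesis G_cover : \bigcup_n G n = setT.

Lemma component_in_G z : E z -> exists n, connected_component E z `<=` G n.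
Proof.
move=> Ez; have : (\bigcup_n G n) z by rewrite G_cover.
move=> [n _ Gz]; exists n.
apply: (@connected_inside _ _ _ z) => //.
- exact: component_connected.
- exact: connected_component_refl.
move=> y Gy nGy /connected_component_sub; apply; apply: level_fast_escaping.
apply: (@G_boundary n); split=> // Gy'; apply: nGy; exact: interior_subset.
Qed.

Lemma component_bounded z : exists B : R, forall w, connected_component E z w -> md w <= B.
Proof.
have [Ez|nEz] := pselect (E z); last first.
  by exists 0 => w; rewrite connected_component_out.
have [n nG] := component_in_G Ez; have [B BG] := G_bounded n.
by exists B => w /nG/BG.
Qed.

Lemma G_contains_disc : exists n, cdisc 0 rho `<=` G n.
Proof.
have mono m n : (m <= n)%N -> G m `<=` G n.
  elim: n => [|n IH]; first by rewrite leqn0 => /eqP->.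
  rewrite leq_eqVlt => /orP[/eqP->//|]; rewrite ltnS => /IH mn.
  exact: subset_trans mn (@G_mono n).
have := @compact_cdisc R 0 rho; rewrite compact_near_coveringP.
move=> /(_ nat \oo (fun n z => G n z) _)[|N _ HN]; last by exists N; exact: HN (leqnn N).
move=> z _; have : (\bigcup_n G n) z by rewrite G_cover.
move=> [n _ Gz]; exists (G n, [set m | (n <= m)%N]).
  split; first by apply: open_nbhs_nbhs; split=> //; exact: G_open.
  exact: nbhs_infty_ge.
by move=> [w m] /= [Gw nm]; exact: mono nm _ Gw.
Qed.

Variables (N p : nat).
Hypothesis p0 : (0 < p)%N.
Hypothesis disc_G : cdisc 0 rho `<=` G N.
Hypothesis G_lt : forall z, G N z -> md z < Mn p.

Let O n := iter n f @` G N.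

Lemma open_image_G n : open (O n). Proof. exact: open_iter. Qed.

Lemma compact_closure_G : compact (closure (G N)).
Proof.
apply: (compact_closed_bounded (B := Mn p)); first exact: closed_closure.
by apply: closure_bounded => w /G_lt/ltW.
Qed.

Lemma frontier_image_G n w : closure (O n) w -> ~ O n w ->
  exists2 v, boundary (G N) v & w = iter n f v.
Proof.
move=> Ow nOw.
have cl : closed (iter n f @` closure (G N)).
  apply: compact_closed; first exact: norm_hausdorff.
  apply: continuous_compact compact_closure_G.
  exact: continuous_subspaceT (@continuous_iter n).
have : (iter n f @` closure (G N)) w.
  move/closure_id : cl => ->; apply: closure_subset Ow => _ [v Gv <-].
  by exists v => //; exact: subset_closure.
move=> [v Gv vw]; exists v => //; split=> // Gv'.
by apply: nOw; exists v => //; exact: interior_subset.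
Qed.

(** Taken with [k = 0] to find a disc inside [O n], and with [k = p.+1] for growth on the frontier.
    The sum is positive because the level set says nothing about the zeroth iterate. *)
Lemma frontier_image_G_ge n w k : closure (O n) w -> ~ O n w -> (0 < n + k)%N ->
  Mn (n + k) <= md (iter k f w).
Proof.
move=> Ow nOw nk; have [v Gv ->] := frontier_image_G Ow nOw.
by rewrite -iterD addnC; apply: (G_boundary Gv); rewrite addnC.
Qed.

Lemma frontier_image_G_escaping n w : closure (O n) w -> ~ O n w -> A w.
Proof.
move=> Ow nOw; have [v Gv ->] := frontier_image_G Ow nOw.
by apply/fast_escaping_iter/level_fast_escaping/G_boundary/Gv.
Qed.

Lemma image_G_le n w : O n w -> md w <= Mn (n + p).
Proof. by move=> [v /G_lt/ltW Gv <-]; exact: iter_le_max_modulus. Qed.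

Lemma disc_image_G n w : (0 < n)%N -> md w < Mn n -> O n w.
Proof.
move=> n0 wn.
have O0 : O n (iter n f 0).
  by exists 0 => //; apply: disc_G; rewrite /cdisc /mkset subrr modulus0 ltW.
set a := iter n f 0 in O0.
have an : md a <= Mn n.
  have := @iter_le_max_modulus n 0%N 0; rewrite modulus0 addn0; apply; exact: ltW
    (iter_max_modulus_gt0 0).
(* The image of 0 might lie on the circle of radius [M^n(rho)] itself; as [O n] is open, it can be
   moved a little towards 0. *)
have [b Ob bn] : exists2 b, O n b & md b < Mn n.
  have [a0|a0] := eqVneq a 0; first by exists a => //; rewrite a0 modulus0 iter_max_modulus_gt0.
  have [e e0 eO] : exists2 e, 0 < e & disc a e `<=` O n.
    by have /nbhs_modulusP := open_nbhs_nbhs (conj (@open_image_G n) O0).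
  rewrite -modulus_gt0 in a0.
  pose t := Num.min (1 / 2) (e / (2 * md a)).
  have t0 : 0 < t by rewrite lt_min !divr_gt0// mulr_gt0.
  have t1 : t <= 1 / 2 by rewrite ge_min lexx.
  have te : t * (2 * md a) <= e by rewrite -ler_pdivlMr ?mulr_gt0// ge_min lexx orbT.
  have ta : 0 < t * md a by rewrite mulr_gt0.
  exists (a - toC t * a).
    apply: eO; rewrite /disc /mkset (_ : _ - _ - a = - (toC t * a)); last by ring.
    by rewrite modulusN modulusM modulus_toC gtr0_norm//; lra.
  rewrite (_ : _ - _ = toC (1 - t) * a); last by rewrite toCB toC1; ring.
  rewrite modulusM modulus_toC ger0_norm; last by lra.
  by rewrite mulrBl mul1r; lra.
have mem0 v : md v < Mn n -> disc 0 (Mn n) v by rewrite /disc /mkset subr0.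
apply: (connected_inside (@connected_disc R 0 (Mn n)) (@open_image_G n) (mem0 b bn) Ob _ (mem0
  w wn)).
move=> y Oy nOy; rewrite /disc /mkset subr0; apply/negP; rewrite -leNgt.
by have := frontier_image_G_ge (k := 0) Oy nOy; rewrite addn0; exact.
Qed.

(* Some iterate maps the component into [O n], whose points grow too slowly for a
   limit point of the component to escape fast. *)
Lemma component_closed z : E z -> closed (connected_component E z).
Proof.
move=> Ez; set K := connected_component E z.
have Kz : K z by exact: connected_component_refl.
have cK : connected K by exact: component_connected.
suff KE : closure K `<=` E.
  apply/closure_id/seteqP; split; first exact: subset_closure.
  apply: connected_component_max KE _; first exact: subset_closure.
  exact: connected_closure.
move=> w Kw [L L0 HL].
(* Since [n + L' = (n + p + 1) + L], the condition on [w] demands modulus at least [M^(n+p+1)(rho)],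
   one step more than the points of [O n] attain. *)
pose L' := (L + p).+1.
have [n n0 zn] : exists2 n, (0 < n)%N & md (iter (n + L') f z) < Mn n.
  apply: contrapT => Nz; apply: Ez; exists L' => // n n0.
  by rewrite leNgt; apply/negP => H; apply: Nz; exists n.
have sub : iter (n + L') f @` K `<=` O n.
  apply: (@connected_inside _ _ _ (iter (n + L') f z)).
  - apply: connected_continuous_connected cK _.
    exact: continuous_subspaceT (@continuous_iter _).
  - exact: open_image_G.
  - by exists z.
  - exact: disc_image_G.
  move=> y Oy nOy [v /connected_component_sub Ev vy]; apply: Ev.
  by apply/(fast_escaping_iter (n + L')); rewrite vy; exact: frontier_image_G_escaping Oy nOy.
have : md (iter (n + L') f w) <= Mn (n + p).
  have : closed [set v | md (iter (n + L') f v) <= Mn (n + p)].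
    rewrite (_ : [set v | _] = (fun v => md (iter (n + L') f v)) @^-1` [set x | x <= Mn (n +
      p)])//.
    apply: closed_comp => [v _|]; last exact: closed_le.
    exact: continuous_comp (@continuous_iter _ v) (@continuous_modulus R _).
  move/closure_id => cl; suff : closure [set v | md (iter (n + L') f v) <= Mn (n + p)] w by
    rewrite -cl.
  by apply: closure_subset Kw => v Kv /=; apply: image_G_le; apply: sub; exists v.
have -> : (n + L' = (n + p).+1 + L)%N by rewrite /L' addnS addSn (addnC L) addnA.
apply/negP; rewrite -ltNge.
exact: lt_le_trans (iter_max_modulus_ltS _) (HL (n + p).+1 isT).
Qed.

Lemma component_compact z : E z -> compact (connected_component E z).
Proof.
move=> Ez; have [B KB] := component_bounded z.
exact: compact_closed_bounded (component_closed Ez) KB.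
Qed.

(* [f^p] maps [G N] onto a superset of itself, so nested preimages give an orbit
   that stays bounded along the multiples of [p]. *)
Lemma slow_nonempty : exists e, E e.
Proof.
have GO z : G N z -> O p z by move=> /G_lt; exact: disc_image_G.
have H n : exists2 z, G N z & forall i, (i <= n)%N -> G N (iter (i * p) f z).
  elim: n => [|n [z Gz zP]].
    have G0 : G N 0 by apply: disc_G; rewrite /cdisc /mkset subrr modulus0 ltW.
    by exists 0 => // i; rewrite leqn0 => /eqP->.
  have [v Gv vz] := GO z Gz; exists v => // -[//|i] ni.
  by rewrite mulSn addnC iterD vz; exact: zP.
have H' n : exists z, forall i, (i <= n)%N -> G N (iter (i * p) f z).
  by have [z _ zP] := H n; exists z.
have [x xP] := choice H'.
have Fx : (x @ \oo) (closure (G N)).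
  by exists 0%N => // n _; apply/subset_closure/(xP n 0%N).
have [w [_ wcl]] := compact_closure_G (F := x @ \oo) _ Fx.
have wG i : closure (G N) (iter (i * p) f w).
  have cli : closed (iter (i * p) f @^-1` closure (G N)).
    by apply: closed_comp => [v _|]; [exact: continuous_iter|exact: closed_closure].
  move/closure_id : cli => cli; suff : closure (iter (i * p) f @^-1` closure (G N)) w by
    rewrite -cli.
  have Fi : (x @ \oo) (iter (i * p) f @^-1` closure (G N)).
    exists i; first exact: I.
    by move=> n ni; apply: subset_closure; exact: (xP n i ni).
  by move=> B wB; exact: wcl Fi wB.
exists w => -[L L0 HL].
have Lp : (L + p.+1 <= (L + p.+1) * p)%N by rewrite leq_pmulr.
(* [n + L] is a multiple of [p], where the orbit lies in the closure of [G N], while [n > p] puts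
   [M^n(rho)] beyond that closure. *)
pose n := ((L + p.+1) * p - L)%N.
have nL : (n + L = (L + p.+1) * p)%N.
  by rewrite subnK// (leq_trans _ Lp)// leq_addr.
have np : (p < n)%N by rewrite /n ltn_subRL (leq_trans _ Lp)// addnS.
have := HL n (leq_ltn_trans (leq0n p) np); rewrite nL leNgt => /negP; apply.
apply: le_lt_trans (iter_max_modulus_lt np).
exact: (closure_bounded (fun z Gz => ltW (G_lt Gz)) (wG (L + p.+1)%N)).
Qed.

Lemma max_modulus_superpolynomial k : exists b, forall r, b <= r -> 0 < r -> r ^+ k < M r.
Proof.
apply: contrapT => Nb; apply: not_poly; apply: (@polynomial_growth R f 1 k hf) => b.
apply: contrapT => Nr; apply: Nb; exists b => r br r0.
apply: contrapT => /negP; rewrite -leNgt => Mr; apply: Nr; exists r; split=> // z zr.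
by rewrite mul1r (le_trans _ Mr)// le_max_modulus.
Qed.

(* If all the zeros of [F - e], [F = f^(p+1)], lie in a disc, then [F - e = P g]
   with [P] a polynomial and [1/g] entire; on the boundary of [O n] the function
   [F] has modulus at least [M r], where [r] bounds the modulus of the points of
   [O n], so that [1/g] tends to 0. *)
Lemma slow_unbounded b : exists2 e, E e & b < md e.
Proof.
apply: contrapT => Nb.
have Eb e : E e -> md e <= b by move=> Ee; rewrite leNgt; apply/negP => H; apply: Nb; exists e.
have [e Ee] := slow_nonempty.
have b0 : 0 <= b by exact: le_trans (modulus_ge0 _) (Eb e Ee).
pose h z := iter p.+1 f z - e.
have hh : holo setT h.
  by move=> z _; have [l fl] := @holo_iter p.+1 z I; eexists; exact: cderB fl (cder_cst e z).
(* A zero of [h] is a preimage of [e] under an iterate, hence itself in [E]. *)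
have hb z : h z = 0 -> md z <= b.
  move=> /eqP; rewrite subr_eq0 => /eqP hz; apply: Eb => Az; apply: Ee.
  by rewrite -hz; apply/fast_escaping_iter.
have hnz : exists z, h z != 0.
  exists (toC (b + 1)); apply/eqP => /hb; rewrite modulus_toC ger0_norm; last by lra.
  by lra.
have [s [g [hg g0 sb gE]]] := finite_zeros hh hnz hb.
pose k := size s.
have prod_le w r : md w <= r -> md (\prod_(a <- s) (w - a)) <= (r + b) ^+ k.
  move=> wr; have rb : 0 <= r + b by have := modulus_ge0 w; lra.
  rewrite /k; elim: (s) sb => [|a s' IH] sb'; first by rewrite big_nil modulus1 expr0.
  rewrite big_cons modulusM /= exprS ler_pM ?modulus_ge0//.
    by have := modulusD w (- a); rewrite modulusN; have := sb' a (mem_head _ _); lra.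
  by apply: IH => c cs; apply: sb'; rewrite inE cs orbT.
pose x := md (g 0)^-1.
have x0 : 0 < x by rewrite modulus_gt0 invr_neq0.
have bound n : (0 < n)%N -> md e < M (Mn (n + p)) ->
    x <= (Mn (n + p) + b) ^+ k / (M (Mn (n + p)) - md e).
  move=> n0 en; set r := Mn (n + p) in en *.
  have r0 : 0 < r by exact: iter_max_modulus_gt0.
  have hgV z : exists l, cder (fun z => (g z)^-1) z l.
    by have [l gl] := @hg z I; eexists; exact: cderV gl (g0 z).
  apply: (@maximum_principle R (O n) (fun z => (g z)^-1) r).
  - exact: open_image_G.
  - exact: image_G_le.
  - rewrite divr_ge0 ?exprn_ge0//; [by rewrite addr_ge0// ltW|by rewrite subr_ge0 ltW].
  - by move=> z _; exact: hgV.
  - by move=> z _; have [l /cder_continuous] := hgV z.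
  - move=> z Oz nOz.
    have zr : md z <= r by apply: closure_bounded Oz; exact: image_G_le.
    have hz : M r - md e <= md (h z).
      have H : M r <= md (iter p.+1 f z).
        by have := frontier_image_G_ge (k := p.+1) Oz nOz; rewrite addnS => /(_ isT).
      by have := modulus_leB (iter p.+1 f z) e; rewrite /h; lra.
    have hz0 : 0 < md (h z) by lra.
    have -> : (g z)^-1 = (\prod_(a <- s) (z - a)) / h z.
      have P0 : \prod_(a <- s) (z - a) != 0.
        by apply: contraTneq hz0 => P0; rewrite gE P0 mul0r modulus0 ltxx.
      by rewrite gE invfM mulrA divff// mul1r.
    rewrite modulusM modulusV ler_pM ?invr_ge0 ?modulus_ge0//; first exact: prod_le.
    by rewrite lef_pV2 ?posrE// subr_gt0.
  - by apply: disc_image_G => //; rewrite modulus0 iter_max_modulus_gt0.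
have [b1 growth] := max_modulus_superpolynomial k.+1.
(* [b1] gives growth of one degree more than the polynomial, [b] gives [r + b <= 2 r], and 1 and
   [2 |e|] give [|e| <= r^(k+1) / 2]. The last entry contradicts the resulting
   [x <= 2^(k+1) / r]. *)
pose T := Num.max (Num.max b1 b) (Num.max (Num.max 1 (2 * md e)) (2 ^+ k.+1 / x)).
have [n nT] := iter_max_modulus_unbounded T.
pose r := Mn (n.+1 + p).
have rT : T < r by apply: lt_le_trans nT _; apply: iter_max_modulus_le; rewrite addSn leqW//
  leq_addr.
move: rT; rewrite /T !gt_max => /andP[/andP[rb1 rb] /andP[/andP[r1 re] rx]].
have r0 : 0 < r by exact: iter_max_modulus_gt0.
have Mr := growth r (ltW rb1) r0.
have rk : r <= r ^+ k.+1 by rewrite exprS ler_peMr// ?(ltW r0)// exprn_ege1// ltW.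
have Mr2 : r ^+ k.+1 / 2 <= M r - md e by lra.
have rk0 : 0 < r ^+ k.+1 by rewrite exprn_gt0.
have eM : md e < M r by have := modulus_ge0 e; lra.
have := bound n.+1 isT eM; rewrite -/r => xb.
have : x <= 2 ^+ k.+1 / r.
  apply: (le_trans xb).
  apply: (@le_trans _ _ ((2 * r) ^+ k / (r ^+ k.+1 / 2))).
    rewrite ler_pM ?invr_ge0 ?exprn_ge0//; [by lra|by lra| |].
      by rewrite lerXn2r ?nnegrE//; lra.
    by rewrite lef_pV2 ?posrE ?subr_gt0 ?divr_gt0.
  rewrite exprMn !exprS le_eqVlt; apply/orP; left; apply/eqP.
  have : r ^+ k != 0 by rewrite expf_neq0// gt_eqF.
  have : r != 0 by rewrite gt_eqF.
  by move: (r ^+ k) (2 ^+ k) (r) => u v t t0 u0; field; rewrite t0 u0.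
rewrite ler_pdivlMr// leNgt => /negP; apply.
by rewrite mulrC -ltr_pdivrMr.
Qed.

Let cc := connected_component E.

Lemma slow_components : exists e : nat -> C,
  forall n, E (e n) /\ forall i, (i < n)%N -> ~ cc (e i) (e n).
Proof.
apply: (avoiding_sequence (P := fun _ => E)) => _ s sE.
have [B BP] : exists B : R, forall y, y \in s -> forall w, cc y w -> md w <= B.
  elim: s {sE} => [|y s [B BP]]; first by exists 0.
  have [B' BP'] := component_bounded y.
  exists (Num.max B B') => v; rewrite inE => /orP[/eqP->|vs] w vw.
    by rewrite le_max BP' ?orbT.
  by rewrite le_max (BP v vs w vw).
have [e Ee be] := slow_unbounded B; exists e; split=> // y ys ye.
by have := BP y ys e ye; rewrite leNgt be.
Qed.

(** Used in contrapositive: points whose images under one iterate lie in distinct components lie in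
    distinct components themselves. *)
Lemma component_iter n y z : cc y z -> cc (iter n f y) (iter n f z).
Proof.
move=> yz; have [Ey|nEy] := pselect (E y); last first.
  by move: yz; rewrite /cc connected_component_out.
apply: (@connected_component_max _ _ (iter n f @` cc y) (iter n f y)).
- by exists y => //; exact: connected_component_refl.
- by move=> _ [v /connected_component_sub Ev <-] Av; apply/Ev/(fast_escaping_iter n).
- apply: connected_continuous_connected; first exact: component_connected.
  exact: continuous_subspaceT (@continuous_iter n).
- by exists z.
Qed.

(** If both values were omitted at infinitely many indices, Montel's theorem along these would give
    a convergent or divergent subsequence of [u]. *)
Lemma nonnormal_hits (u : nat -> C -> C) z r a b : 0 < r ->
  (forall k, iterates f (u k)) -> a != b ->
  ~ (exists phi : nat -> nat, {homo phi : m n / (m < n)%N} /\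
    ((exists g : C -> C, forall K : set C, compact K -> K `<=` disc z r ->
        {uniform K, (fun k => u (phi k)) @ \oo --> g}) \/
     (forall K : set C, compact K -> K `<=` disc z r ->
        forall B : R, \forall k \near \oo,
          forall z, K z -> B < md (u (phi k) z)))) ->
  exists k0, forall k, (k0 <= k)%N -> exists2 w, disc z r w & u k w = a \/ u k w = b.
Proof.
move=> r0 uit ab nonnormal; apply: contrapT => Nk.
have H (n m : nat) : exists2 k, (m <= k)%N & forall w, disc z r w -> u k w != a /\ u k w != b.
  apply: contrapT => Nm; apply: Nk; exists m => k mk; apply: contrapT => Nw.
  apply: Nm; exists k => // w wr; split; apply/eqP => uw; apply: Nw; exists w => //.
    by left.
  by right.
have [psi [psim psiP]] := subsequence_choice H.
apply: nonnormal.
have hu k : holo (disc z r) (u (psi k)).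
  by have [n _ ->] := uit (psi k); move=> w _; exact: holo_iter.
have [phi [phim conv]] := montel ab r0 hu psiP.
exists (psi \o phi); split; first by move=> m n mn; apply/psim/phim.
exact: conv.
Qed.

(* By Montel's theorem the images of the disc under a non-normal sequence of iterates
   eventually hit one of any two given points, hence meet more than [size s]
   components; components of their preimages in the disc are then distinct. *)
Lemma julia_meets_components z r (s : seq C) : julia_set f z -> 0 < r ->
  exists w, [/\ md (w - z) < r, E w & forall y, y \in s -> ~ cc y w].
Proof.
move=> Jz r0; apply: contrapT => Nw.
have Hs w : md (w - z) < r -> E w -> exists2 y, y \in s & cc y w.
  move=> wr Ew; apply: contrapT => Ny; apply: Nw; exists w; split=> // y ys yw.
  by apply: Ny; exists y.
have [e eP] := slow_components.
have e_neq i j : (i < j)%N -> ~ cc (e i) (e j) by move=> /(proj2 (eP j)).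
have [u [uit nonnormal]] : exists u : nat -> C -> C, (forall k, iterates f (u k)) /\
  ~ (exists phi : nat -> nat, {homo phi : m n / (m < n)%N} /\
    ((exists g : C -> C, forall K : set C, compact K -> K `<=` disc z r ->
        {uniform K, (fun k => u (phi k)) @ \oo --> g}) \/
     (forall K : set C, compact K -> K `<=` disc z r ->
        forall B : R, \forall k \near \oo,
          forall z, K z -> B < md (u (phi k) z)))).
  apply: contrapT => Nu; apply: Jz; exists (disc z r); split.
  - by split; [exists z; exact: disc_center|exact: open_disc|exact: connected_disc].
  - exact: disc_center.
  by move=> u uit; apply: contrapT => H; apply: Nu; exists u.
(* The pairs with indices [2i], [2i + 1] are disjoint, so different [i] lead to different components
   whichever value is taken. *)
have hit i : exists k0, forall k, (k0 <= k)%N ->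
    exists2 w, disc z r w & u k w = e i.*2 \/ u k w = e i.*2.+1.
  apply: nonnormal_hits => //; apply/eqP => E1; apply: (@e_neq i.*2 i.*2.+1) => //.
  by rewrite -E1; apply: connected_component_refl; exact: (eP _).1.
(* The first [size s + 1] pairs have a common threshold [k], so a single iterate hits all of
   them. *)
have [k0 k0P] := choice hit.
pose m := size s; pose k := \max_(i < m.+1) k0 i.
have [n _ ukE] := uit k.
have w_ex i : exists w, (i <= m)%N -> [/\ disc z r w, E w &
    iter n f w = e i.*2 \/ iter n f w = e i.*2.+1].
  have [im|_] := leqP i m; last by exists z.
  have ki : (k0 i <= k)%N by exact: (@leq_bigmax _ (fun i : 'I_m.+1 => k0 i) (Ordinal (im : (i
    < m.+1)%N))).
  have [w wr] := k0P i k ki; rewrite ukE => wE; exists w => _; split=> //.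
  by move=> /(fast_escaping_iter n); case: wE => ->; apply: (eP _).1.
have [w wP] := choice w_ex.
have y_ex i : exists y, (i <= m)%N -> y \in s /\ cc y (w i).
  have [im|_] := leqP i m; last by exists z.
  have [wr Ew _] := wP i im; have [y ys yw] := Hs _ wr Ew; by exists y.
have [y yP] := choice y_ex.
(* Pigeonhole: [m + 1] points of the disc lie in the components of only [m] members of [s], so two
   of the points share a component. *)
have : ~~ uniq (map y (iota 0 m.+1)).
  apply/negP => uy.
  have sub : {subset map y (iota 0 m.+1) <= s}.
    move=> _ /mapP[i + ->]; rewrite mem_iota add0n ltnS => /andP[_ im].
    by have [] := yP i im.
  by have := uniq_leq_size uy sub; rewrite size_map size_iota ltnn.
move=> /(uniqPn 0)[i [j [ij]]]; rewrite size_map size_iota => jm.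
have im := ltn_trans ij jm.
rewrite !(nth_map 0%N) ?size_iota// !nth_iota// !add0n => yij.
have [_ yi] := yP i im; have [_ yj] := yP j jm; rewrite -yij in yj.
have wij : cc (w i) (w j) by exact: connected_component_trans (connected_component_sym yi) yj.
have := component_iter n wij.
have [_ _ wi] := wP i im; have [_ _ wj] := wP j jm.
have dij : (i.*2.+1 < j.*2)%N by rewrite -doubleS ltn_double || rewrite -doubleS leq_double.
case: wi => ->; case: wj => ->; apply: e_neq.
- exact: ltn_trans dij.
- by rewrite ltnS; exact: ltnW (ltn_trans (ltnSn _) dij).
- exact: dij.
- exact: ltn_trans dij (ltnSn _).
Qed.

Lemma julia_limit_of_components z : julia_set f z ->
  exists (w : nat -> C) (K : nat -> set C),
       [/\ forall n, components E (K n) /\ K n (w n), injective K & w @ \oo --> z].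
Proof.
move=> Jz.
have [w wP] := @avoiding_sequence C (fun n w => E w /\ md (w - z) < n.+1%:R^-1) cc
  (ltac:(move=> n s _; have [w [? ? ?]] := @julia_meets_components z n.+1%:R^-1 s Jz
     (ltac:(by rewrite invr_gt0 ltr0n)); by exists w)).
exists w, (fun n => cc (w n)); split.
- move=> n; have [[Ew _] _] := wP n; split; first by exists (w n).
  exact: connected_component_refl.
- move=> i j; wlog : i j / (i <= j)%N.
    move=> H ij; case/orP: (leq_total i j) => h; first exact: H.
    by apply/esym/H.
  rewrite leq_eqVlt => /orP[/eqP//|ij] E1; have [[Ew _] /(_ i ij)] := wP j.
  by rewrite E1 => /(_ (connected_component_refl Ew)).
apply/cvgrPdist_lt => e e0.
have [er eE] : exists x, e = toC x by apply/complex_realP; rewrite gtr0_real.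
have er0 : 0 < er by move: e0; rewrite eE /toC ltcR.
exists (Num.truncn er^-1) => // n /= Nn.
rewrite normC_modulus eE /toC ltcR modulusBC; have [[_ wn] _] := wP n.
apply: (lt_trans wn); rewrite invf_plt ?posrE ?ltr0n// (lt_le_trans (truncnS_gt _))//.
by rewrite ler_nat.
Qed.

End Web.
End Dynamics.

Theorem theorem1p6 (R : realType) (f : Cplx R -> Cplx R) (rho : R)
  (f_transcendental : transcendental_entire f)
  (rho_gt0 : 0 < rho)
  (max_modulus_gt : forall r : R, rho <= r -> r < max_modulus f r)
  (web : spiders_web (fast_escaping_level f rho)) :
  (forall K : set (Cplx R),
      components (~` fast_escaping_set f rho) K -> compact K) /\
  (forall z : Cplx R, julia_set f z ->
     exists (w : nat -> Cplx R) (K : nat -> set (Cplx R)),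
       [/\ forall n, components (~` fast_escaping_set f rho) (K n) /\ K n (w n),
           injective K
         & w @ \oo --> z]).
Proof.
have [f_entire not_poly] := f_transcendental.
have hf : holo setT f by move=> z _; apply/derivable_cder.
have [_ [G [G1 G_mono G_boundary G_cover]]] := web.
have G_bounded n : exists B : R, forall z, G n z -> modulus z <= B.
  by apply: bounded_set_modulus; exact: (G1 n).1.
have G_open n : open (G n) by have [_ [[_ ? _] _]] := G1 n.
have [N disc_G] := G_contains_disc rho G_open G_mono G_cover.
have [B GB] := G_bounded N.
have [p Bp] := iter_max_modulus_unbounded hf rho_gt0 max_modulus_gt B.
(* The successor makes the exponent positive, as the results on the web require. *)
have G_lt z : G N z -> modulus z < iter p.+1 (max_modulus f) rho.
  by move=> /GB zB; exact: le_lt_trans zB (lt_trans Bp (iter_max_modulus_ltS max_modulus_gt p)).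
split.
  move=> _ [z Ez <-].
  exact: (component_compact hf not_poly rho_gt0 max_modulus_gt G_bounded G_open G_boundary
    G_cover disc_G G_lt).
move=> z Jz.
exact: (julia_limit_of_components hf not_poly rho_gt0 max_modulus_gt G_bounded G_open
  G_boundary G_cover (ltn0Sn p) disc_G G_lt).
Qed.
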